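(* Let $m,n>1$, $1\leq k\leq\min\{m,n\}$ and $\Phi\in L^{\infty}(\mathbb{M}_{m,n})$. Then \[\sigma_{k}(\Phi)=\big\|H_{\Phi}^{\{k\}}\big\|_{H^{2}(\mathbb{M}_{n,k})\rightarrow L^{2}(\boldsymbol{S}_{1}^{m,k})/H^{2}(\boldsymbol{S}_{1}^{m,k})}.\]
   Context: $\mathbb{T}$ is the unit circle and $\boldsymbol{m}$ is normalized Lebesgue measure on $\mathbb{T}$. $\mathbb{M}_{m,n}$ is the space of complex $m\times n$ matrices with the operator norm. For $A\in\mathbb{M}_{m,n}$ and $j\ge0$, $s_j(A)=\inf\{\|A-B\|_{\mathbb{M}_{m,n}}:\operatorname{rank}B\le j\}$; $\boldsymbol{S}_{1}^{m,n}$ denotes $\mathbb{M}_{m,n}$ equipped with the trace norm $\|A\|_{\boldsymbol{S}_1^{m,n}}=\sum_{j\ge0}s_j(A)$. For a normed function space $X$ on $\mathbb{T}$ ($L^p$, $H^p$, $H^p_0=\{f\in H^p: \hat f(0)=0\}$), $X(\mathbb{M}_{m,n})$ (resp. $X(\boldsymbol{S}_1^{m,n})$) is the space of $m\times n$ matrix functions with entries in $X$, with norm equal to the $X$-norm of $\zeta\mapsto\|\Phi(\zeta)\|_{\mathbb{M}_{m,n}}$ (resp. $\|\Phi(\zeta)\|_{\boldsymbol{S}_1^{m,n}}$). For $m,n>1$ and $1\le k\le\min\{m,n\}$, let \[\mathcal{A}_k^{n,m}=\{\Psi\in H^1_0(\mathbb{M}_{n,m}):\ \|\Psi\|_{L^1(\mathbb{M}_{n,m})}\le1,\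 \operatorname{rank}\Psi(\zeta)\le k \text{ a.e. }\zeta\in\mathbb{T}\},\] and for $\Phi\in L^\infty(\mathbb{M}_{m,n})$, $\sigma_k(\Phi)=\sup_{\Psi\in\mathcal{A}_k^{n,m}}\left|\int_{\mathbb{T}}\operatorname{trace}(\Phi(\zeta)\Psi(\zeta))\,d\boldsymbol{m}(\zeta)\right|$. The Hankel-type operator $H_\Phi^{\{k\}}:H^2(\mathbb{M}_{n,k})\to L^2(\boldsymbol{S}_1^{m,k})/H^2(\boldsymbol{S}_1^{m,k})$ is $H_\Phi^{\{k\}}F=\rho(\Phi F)$, where $\rho$ is the quotient map; the quotient norm of a coset is the infimum of the $L^2(\boldsymbol{S}_1^{m,k})$-norms of its elements. *)

(* Defs.v *)
From HB Require Import structures.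
From mathcomp Require Import all_boot all_order all_algebra.
From mathcomp Require Import all_classical all_reals all_analysis.
From mathcomp Require Import complex.
Set Implicit Arguments. Unset Strict Implicit. Unset Printing Implicit Defensive.
Import Order.TTheory GRing.Theory Num.Theory.
Local Open Scope ring_scope.
Local Open Scope classical_set_scope.

Section HankelDefs.
Context (R : realType).
Local Notation C := (complex R).

(* The unit circle T is parametrized by t in [0,1[ via zeta = exp(2 pi i t);
   normalized Lebesgue measure m on T corresponds to Lebesgue measure on [0,1[. *)
Definition circ_set : set R := `[0%R, 1%R[.
Lemma circ_set_meas : measurable circ_set.
Proof. exact: measurable_itv. Qed.
Definition mT := mrestr (@lebesgue_measure R) circ_set_meas.

Definition cmod (z : C) : R := Num.sqrt (complex.Re z ^+ 2 + complex.Im z ^+ 2).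
Definition cexpi (x : R) : C := Complex (cos x) (sin x).

Definition vnorm p (x : 'cV[C]_p) : R :=
  Num.sqrt (\sum_(i < p) (complex.Re (x i 0) ^+ 2 + complex.Im (x i 0) ^+ 2)).
Definition opnorm p q (A : 'M[C]_(p, q)) : R :=
  sup [set vnorm (A *m x) | x in [set x : 'cV[C]_q | vnorm x <= 1]].

Definition sing_val p q (j : nat) (A : 'M[C]_(p, q)) : R :=
  inf [set opnorm (A - B) | B in [set B : 'M[C]_(p, q) | (\rank B <= j)%N]].
(* trace norm: sum_{j >= 0} s_j(A); s_j(A) = 0 for j >= min(p,q) *)
Definition trnorm p q (A : 'M[C]_(p, q)) : R :=
  \sum_(j < minn p q) sing_val j A.

Definition cint (g : R -> C) : C :=
  Complex (fine (\int[mT]_t (complex.Re (g t))%:E)) (fine (\int[mT]_t (complex.Im (g t))%:E)).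
Definition fcoef (f : R -> C) (j : int) : C :=
  cint (fun t => f t * cexpi (- (2 * pi * j%:~R * t))).

Definition cLp (p : \bar R) (f : R -> C) : Prop :=
  [/\ measurable_fun circ_set (fun t => complex.Re (f t)),
      measurable_fun circ_set (fun t => complex.Im (f t)) &
      (Lnorm mT p (fun t => (cmod (f t))%:E) < +oo)%E].
Definition cHp (p : \bar R) (f : R -> C) : Prop :=
  cLp p f /\ forall j : nat, (0 < j)%N -> fcoef f (- (j%:Z)) = 0.
Definition cHp0 (p : \bar R) (f : R -> C) : Prop :=
  cHp p f /\ fcoef f 0 = 0.

Definition mxLp (p : \bar R) a b (F : R -> 'M[C]_(a, b)) : Prop :=
  forall i j, cLp p (fun t => F t i j).
Definition mxHp (p : \bar R) a b (F : R -> 'M[C]_(a, b)) : Prop :=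
  forall i j, cHp p (fun t => F t i j).
Definition mxHp0 (p : \bar R) a b (F : R -> 'M[C]_(a, b)) : Prop :=
  forall i j, cHp0 p (fun t => F t i j).

Definition normXM (p : \bar R) a b (F : R -> 'M[C]_(a, b)) : \bar R :=
  Lnorm mT p (fun t => (opnorm (F t))%:E).
Definition normXS1 (p : \bar R) a b (F : R -> 'M[C]_(a, b)) : \bar R :=
  Lnorm mT p (fun t => (trnorm (F t))%:E).

Definition A_k (n m k : nat) (Psi : R -> 'M[C]_(n, m)) : Prop :=
  [/\ mxHp0 1%:E Psi, (normXM 1%:E Psi <= 1)%E &
      {ae mT, forall t, (\rank (Psi t) <= k)%N}].

Definition sigma_k (m n k : nat) (Phi : R -> 'M[C]_(m, n)) : \bar R :=
  ereal_sup [set (cmod (cint (fun t => \tr (Phi t *m Psi t))))%:E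
            | Psi in [set Psi : R -> 'M[C]_(n, m) | A_k k Psi]].

Definition hankel_quot_norm (m n k : nat) (Phi : R -> 'M[C]_(m, n))
    (F : R -> 'M[C]_(n, k)) : \bar R :=
  ereal_inf [set normXS1 2%:E (fun t => Phi t *m F t - G t)
            | G in [set G : R -> 'M[C]_(m, k) | mxHp 2%:E G]].

Definition hankel_norm (m n k : nat) (Phi : R -> 'M[C]_(m, n)) : \bar R :=
  ereal_sup [set hankel_quot_norm Phi F
            | F in [set F : R -> 'M[C]_(n, k) |
                     mxHp 2%:E F /\ (normXM 2%:E F <= 1)%E]].

End HankelDefs.

(* Main.v *)
(* Write [H^2_0] for the functions of [H^2] with mean zero.

   If [F] is in the unit ball of [H^2] and [Phi F] has distance more than [r] to [H^2] in
   [L^2(S_1)], the projection [P] of [Phi F] on the closure of the convex set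
   [H^2 + {B | ||B||_{L^2(S_1)} <= r}] provides [Z], a positive multiple of [(Phi F - P)^*], which
   lies in the unit ball of [H^2_0] and satisfies [r <= |int tr (Phi F Z)|]; the function [F Z] is
   then a competitor for [sigma_k].

   Conversely, for [Psi] in [A_k] and [w = ||Psi|| + eps], there is a factorization [Psi = F G]
   with [F] in [H^2] (with values in n x k matrices), [G] in [H^2_0], and [||F||^2], [||G||^2]
   bounded by [w] pointwise.  Since [int tr (H G) = 0] for [H] in [H^2], the pairing of [Phi] with
   [Psi] is at most [(int w) ||H_Phi^{k}||].  To factor, consider the closed shift-invariant space
   generated by the columns of [w^(-1/2) Psi].  The pointwise inner product of two elements of its
   wandering subspace is constant, because all its other Fourier coefficients vanish; hence a
   maximal orthonormal family in that subspace is an isometry [U] at almost every point, of rank at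
   most [k].  Shift-invariance then forces [U U^* Psi = Psi], and one takes [F = w^(1/2) U],
   [G = w^(-1/2) U^* Psi], up to a shift. *)

Require Import Defs.
From mathcomp Require Import all_boot all_order all_fingroup all_algebra.
From mathcomp Require Import all_classical all_reals all_analysis.
From mathcomp Require Import measurable_realfun ess_sup_inf complex ring lra zify.
Import Order.TTheory GRing.Theory Num.Theory.
Import numFieldNormedType.Exports.
Local Open Scope classical_set_scope.
Local Open Scope ring_scope.
Set Implicit Arguments. Unset Strict Implicit. Unset Printing Implicit Defensive.

(** * Integrable and square integrable functions *)

(** [Psi] is merely integrable, and [w^(-1/2) Psi] is square integrable but in general not analytic.
    Multiplication by [w^(1/2)] turns the elements of the generated space into analytic functions:
    it restores shifts of [Psi] on the generators, and Fourier coefficients pass to the limit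
    because [w^(1/2)] is square integrable. This makes [F] analytic. [G] is analytic for another
    reason: its coefficients of negative index are inner products of wandering vectors with shifted
    elements of the space. The term [eps] keeps [w] away from zero and is let go to zero only in the
    final inequality.

    The distance to [H^2] is taken in the trace norm, while the projection uses the Hilbert-Schmidt
    norm. In finite dimension the former is dominated by the latter, so the residual of the
    projection is nonzero. It defines a functional bounded on a trace norm ball; turning this bound
    into an operator norm bound at the level of functions requires test functions chosen measurably.

    Pointwise inner products of [L^2] vectors are only integrable, hence uniqueness of Fourier
    coefficients is established in [L^1]. *)

Lemma discr_le (R : realType) (a b c : R) : 0 <= a -> 0 <= c ->
  (forall s, 0 <= a + 2 * s * b + s ^+ 2 * c) -> b ^+ 2 <= a * c.
Proof.
move=> a0 c0 q; have [c_0|cn0] := eqVneq c 0.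
  have [->|bn0] := eqVneq b 0; first by rewrite expr0n c_0 mulr0.
  (* With [c = 0] the form is affine in [s]; this value of [s] makes it equal to -1. *)
  have := q (- (a + 1) / (2 * b)).
  have -> : a + 2 * (- (a + 1) / (2 * b)) * b + (- (a + 1) / (2 * b)) ^+ 2 * c = -1.
    by rewrite c_0 mulr0 addr0; field.
  lra.
have cp : 0 < c by rewrite lt_neqAle eq_sym cn0.
have := q (- b / c).
have -> : a + 2 * (- b / c) * b + (- b / c) ^+ 2 * c = (a * c - b ^+ 2) / c by field.
by rewrite pmulr_lge0 ?invr_gt0// subr_ge0.
Qed.

(** Finite mass makes constants integrable and gives [L2] inside [L1]. As a class, the condition is
    found by inference for the circle. *)
Class finite_part d (T : measurableType d) (R : realType)
  (mu : {measure set T -> \bar R}) (D : set T) : Prop :=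
  { finite_part_measurable : measurable D; finite_part_lty : (mu D < +oo)%E }.

Section RealL2.
Context d (T : measurableType d) (R : realType) (mu : {measure set T -> \bar R}).
Context (D : set T) {muD : finite_part mu D}.
Implicit Types f g h : T -> R.

Let mD : measurable D. Proof. exact: finite_part_measurable. Qed.

Definition L1 f := mu.-integrable D (EFin \o f).
Definition L2 f := measurable_fun D f /\ L1 (fun t => f t ^+ 2).
Definition Int f := (\int[mu]_(x in D) f x)%R.

Lemma L1_measurable f : L1 f -> measurable_fun D f.
Proof. by move=> /(measurable_int mu)/measurable_EFinP. Qed.

Lemma L2_measurable f : L2 f -> measurable_fun D f.
Proof. by case. Qed.

Lemma L1D f g : L1 f -> L1 g -> L1 (fun t => f t + g t).
Proof. by move=> hf hg; exact: (integrableD mD hf hg). Qed.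

Lemma L1Z a f : L1 f -> L1 (fun t => a * f t).
Proof. by move=> hf; exact: (integrableZl mD a hf). Qed.

Lemma L1N f : L1 f -> L1 (fun t => - f t).
Proof. by move=> /(L1Z (-1)); under eq_fun do rewrite mulN1r. Qed.

Lemma L1B f g : L1 f -> L1 g -> L1 (fun t => f t - g t).
Proof. by move=> hf /L1N; exact: L1D. Qed.

Lemma L1_cst a : L1 (fun=> a).
Proof.
apply/integrableP; split; first exact/measurable_EFinP.
under eq_integral do rewrite /=.
by rewrite integral_cst//= lte_mul_pinfty// finite_part_lty.
Qed.

Lemma L1_sum (I : Type) (s : seq I) (h : I -> T -> R) :
  (forall i, L1 (h i)) -> L1 (fun t => \sum_(i <- s) h i t).
Proof.
move=> hi; elim: s => [|i s ih].
  by under eq_fun do rewrite big_nil; exact: L1_cst.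
by under eq_fun do rewrite big_cons; apply: L1D.
Qed.

Lemma L1_ae_le f g : measurable_fun D f -> L1 g ->
  (\forall t \ae mu, D t -> `|f t| <= g t) -> L1 f.
Proof.
move=> mf hg fg; apply/integrableP; split; first exact/measurable_EFinP.
have /integrableP[mg goo] := hg.
apply: le_lt_trans goo; apply: ae_ge0_le_integral => //.
- by apply: measurableT_comp => //; exact/measurable_EFinP.
- exact: measurableT_comp.
by apply: filterS fg => t + Dt => /(_ Dt) ft /=; rewrite lee_fin (le_trans ft)// ler_norm.
Qed.

Lemma L1_le f g : measurable_fun D f -> L1 g -> (forall t, D t -> `|f t| <= g t) -> L1 f.
Proof. by move=> mf hg fg; apply: (L1_ae_le mf hg); exact: aeW. Qed.

Lemma L1_abs f : L1 f -> L1 (fun t => `|f t|).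
Proof.
move=> hf; have mf := L1_measurable hf.
exact: (integrable_abse hf).
Qed.

Lemma IntD f g : L1 f -> L1 g -> Int (fun t => f t + g t) = Int f + Int g.
Proof. exact: RintegralD. Qed.

Lemma IntZ a f : L1 f -> Int (fun t => a * f t) = a * Int f.
Proof. by move=> hf; rewrite /Int RintegralZl. Qed.

Lemma IntN f : L1 f -> Int (fun t => - f t) = - Int f.
Proof.
by move=> hf; rewrite -mulN1r -IntZ//; apply: eq_Rintegral => t _; rewrite mulN1r.
Qed.

Lemma IntB f g : L1 f -> L1 g -> Int (fun t => f t - g t) = Int f - Int g.
Proof. exact: RintegralB. Qed.

Lemma Int0 : Int (fun=> 0) = 0.
Proof. by rewrite /Int Rintegral_cst// mul0r. Qed.

Lemma Int_sum (I : Type) (s : seq I) (h : I -> T -> R) :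
  (forall i, L1 (h i)) -> Int (fun t => \sum_(i <- s) h i t) = \sum_(i <- s) Int (h i).
Proof.
move=> hi; elim: s => [|i s ih].
  by under [X in Int X]eq_fun do rewrite big_nil; rewrite big_nil Int0.
under [X in Int X]eq_fun do rewrite big_cons.
by rewrite IntD ?ih ?big_cons//; exact: L1_sum.
Qed.

Lemma Int_ae_eq f g : measurable_fun D f -> measurable_fun D g ->
  (\forall t \ae mu, D t -> f t = g t) -> Int f = Int g.
Proof.
move=> mf mg fg; rewrite /Int /Rintegral; congr fine; apply: ae_eq_integral => //.
- exact/measurable_EFinP.
- exact/measurable_EFinP.
by apply: filterS fg => t + Dt => /(_ Dt) ->.
Qed.

Lemma Int_ge0 f : (forall t, D t -> 0 <= f t) -> 0 <= Int f.
Proof. by move=> f0; apply: Rintegral_ge0. Qed.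

Lemma EFin_Int f : L1 f -> (\int[mu]_(x in D) (f x)%:E)%E = (Int f)%:E.
Proof. by move=> hf; rewrite /Int /Rintegral fineK//; exact: integrable_fin_num. Qed.

Lemma Int_le f g : L1 f -> L1 g -> (forall t, D t -> f t <= g t) -> Int f <= Int g.
Proof. by move=> hf hg fg; apply: le_Rintegral. Qed.

Lemma Int_ae_le f g : L1 f -> L1 g -> (\forall t \ae mu, D t -> f t <= g t) -> Int f <= Int g.
Proof.
move=> hf hg fg.
have mf := L1_measurable hf; have mg := L1_measurable hg.
(* The maximum differs from [g] on a null set only, and the inequality with it holds everywhere. *)
have mx : measurable_fun D (fun t => Num.max (f t) (g t)) by exact: measurable_maxr.
rewrite (@Int_ae_eq g (fun t => Num.max (f t) (g t)))//; last first.
  by apply: filterS fg => t + Dt => /(_ Dt) ?; rewrite max_r.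
apply: Int_le => //; last by move=> t _; rewrite le_max lexx.
apply: (L1_le mx (L1D (L1_abs hf) (L1_abs hg))) => t _.
by case: (leP (f t) (g t)) => _; [rewrite lerDr|rewrite lerDl].
Qed.

Lemma Int_cst a : Int (fun=> a) = a * fine (mu D).
Proof. by rewrite /Int Rintegral_cst. Qed.

Lemma L2M f g : L2 f -> L2 g -> L1 (fun t => f t * g t).
Proof.
move=> [mf hf] [mg hg]; apply: (L1_le _ (L1D hf hg)).
  exact: measurable_funM.
move=> t _; rewrite normrM -(real_normK (num_real (f t))) -(real_normK (num_real (g t))).
have := sqr_ge0 (`|f t| - `|g t|); nra.
Qed.

Lemma L2_ae_le f g : measurable_fun D f -> L2 g ->
  (\forall t \ae mu, D t -> `|f t| <= `|g t|) -> L2 f.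
Proof.
move=> mf [mg hg] fg; split=> //; apply: (L1_ae_le _ hg); first exact: measurable_funX.
apply: filterS fg => t + Dt => /(_ Dt) h.
by rewrite normrX -(real_normK (num_real (g t))) lerXn2r ?nnegrE.
Qed.

Lemma L2_cst a : L2 (fun=> a).
Proof. by split => //; exact: L1_cst. Qed.

Lemma L2D f g : L2 f -> L2 g -> L2 (fun t => f t + g t).
Proof.
move=> hf hg; have [mf f2] := hf; have [mg g2] := hg.
split; first exact: measurable_funD.
have := L1D (L1D f2 (L1Z 2 (L2M hf hg))) g2.
by apply: eq_integrable => // t _ /=; congr EFin; ring.
Qed.

Lemma L2Z a f : L2 f -> L2 (fun t => a * f t).
Proof.
move=> [mf f2]; split; first exact: measurable_funM.
have := L1Z (a ^+ 2) f2.
by apply: eq_integrable => // t _ /=; congr EFin; ring.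
Qed.

Lemma L2N f : L2 f -> L2 (fun t => - f t).
Proof. by move=> /(L2Z (-1)); under eq_fun do rewrite mulN1r. Qed.

Lemma L2B f g : L2 f -> L2 g -> L2 (fun t => f t - g t).
Proof. by move=> hf /L2N; exact: L2D. Qed.

Lemma L2_sum (I : Type) (s : seq I) (h : I -> T -> R) :
  (forall i, L2 (h i)) -> L2 (fun t => \sum_(i <- s) h i t).
Proof.
move=> hi; elim: s => [|i s ih].
  by under eq_fun do rewrite big_nil; exact: L2_cst.
by under eq_fun do rewrite big_cons; apply: L2D.
Qed.

Lemma L2_L1 f : L2 f -> L1 f.
Proof. by move=> /L2M /(_ (L2_cst 1)); under eq_fun do rewrite mulr1. Qed.

Lemma L2_abs f : L2 f -> L2 (fun t => `|f t|).
Proof.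
move=> hf; apply: (L2_ae_le _ hf); last by apply: aeW => t _; rewrite normr_id.
by apply: measurableT_comp => //; case: hf.
Qed.

Lemma L2_sqrt f : measurable_fun D f -> (forall t, D t -> 0 <= f t) ->
  L1 f -> L2 (fun t => Num.sqrt (f t)).
Proof.
move=> mf f0 hf; split.
  by apply: measurableT_comp => //; apply: continuous_measurable_fun; exact: sqrt_continuous.
apply: eq_integrable hf => // t /set_mem Dt /=; by rewrite sqr_sqrtr// f0.
Qed.

Lemma bounded_L1 M f g : measurable_fun D f ->
  (\forall t \ae mu, D t -> `|f t| <= M) -> L1 g -> L1 (fun t => f t * g t).
Proof.
move=> mf fM hg; have mg := L1_measurable hg.
apply: (L1_ae_le _ (L1Z M (L1_abs hg))); first exact: measurable_funM.
by apply: filterS fM => t + Dt => /(_ Dt) h; rewrite !normrM ler_wpM2r.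
Qed.

(* The discriminant of [s |-> Int ((f + s g) ^ 2)] is nonpositive. *)
Lemma Int_Cauchy_Schwarz f g : L2 f -> L2 g ->
  Int (fun t => f t * g t) ^+ 2 <= Int (fun t => f t ^+ 2) * Int (fun t => g t ^+ 2).
Proof.
move=> hf hg; have [mf f2] := hf; have [mg g2] := hg; have fg := L2M hf hg.
set a := Int (fun t => f t ^+ 2); set b := Int _; set c := Int (fun t => g t ^+ 2).
have a0 : 0 <= a by apply: Int_ge0 => t _; exact: sqr_ge0.
have c0 : 0 <= c by apply: Int_ge0 => t _; exact: sqr_ge0.
apply: discr_le => // s.
have <- : Int (fun t => (f t + s * g t) ^+ 2) = a + 2 * s * b + s ^+ 2 * c.
  have fgs := L1Z (2 * s) fg; have g2s := L1Z (s ^+ 2) g2.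
  rewrite /a /b /c -IntZ// -[in RHS]IntZ// -IntD// -IntD//; last exact: L1D.
  by apply: eq_Rintegral => t _; ring.
by apply: Int_ge0 => t _; exact: sqr_ge0.
Qed.

Lemma Int_mul_le_sqrt f g : L2 f -> L2 g ->
  Int (fun t => f t * g t) <= Num.sqrt (Int (fun t => f t ^+ 2)) * Num.sqrt (Int (fun t => g t ^+ 2)).
Proof.
move=> hf hg; have := Int_Cauchy_Schwarz hf hg.
have : 0 <= Int (fun t => f t ^+ 2) by apply: Int_ge0 => t _; exact: sqr_ge0.
move: (Int _) (Int (fun t => f t ^+ 2)) (Int (fun t => g t ^+ 2)) => a b c b0 h.
by rewrite -sqrtrM// (le_trans (ler_norm _))// -sqrtr_sqr ler_wsqrtr.
Qed.

End RealL2.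

Arguments L1 {d T R} mu D f.
Arguments L2 {d T R} mu D f.
Arguments Int {d T R} mu D f.

(** * Completeness of real [L^2] *)

Section RieszFischer.
Context d (T : measurableType d) (R : realType) (mu : {measure set T -> \bar R}).
Context (D : set T) {muD : finite_part mu D}.
Local Notation L1 := (L1 mu D).
Local Notation L2 := (L2 mu D).
Local Notation Int := (Int mu D).

Let mD : measurable D. Proof. exact: finite_part_measurable. Qed.

Lemma Int_abs_le_sqrt f : L2 f ->
  Int (fun t => `|f t|) <= Num.sqrt (fine (mu D)) * Num.sqrt (Int (fun t => f t ^+ 2)).
Proof.
move=> hf.
have h : Int (fun t => 1 * `|f t|) ^+ 2 <= Int (fun=> 1 ^+ 2) * Int (fun t => `|f t| ^+ 2).
  by apply: Int_Cauchy_Schwarz; [exact: L2_cst|exact: L2_abs].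
move: h; under [X in X ^+ 2 <= _]eq_Rintegral do rewrite mul1r.
under [X in _ * X]eq_Rintegral do rewrite real_normK ?num_real//.
rewrite Int_cst expr1n mul1r -sqrtrM ?fine_ge0// => h.
by rewrite -[leLHS]ger0_norm ?Int_ge0// -sqrtr_sqr; exact: ler_wsqrtr h.
Qed.

Lemma Int_dominated (F : nat -> T -> R) (f g : T -> R) :
  (forall n, measurable_fun D (F n)) -> measurable_fun D f -> L1 g ->
  (\forall t \ae mu, D t -> F ^~ t @ \oo --> f t) ->
  (forall n t, D t -> `|F n t| <= g t) ->
  (fun n => Int (F n)) @ \oo --> Int f.
Proof.
move=> mF mf g1 Ff Fg.
have F1 n : L1 (F n) by apply: (L1_le (mF n) g1) => t; exact: Fg.
have [||f1 _] := @dominated_convergence _ _ _ mu D mD (fun n t => (F n t)%:E) (EFin \o f)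
  (EFin \o g) (fun n => (measurable_EFinP _ _).2 (mF n)) ((measurable_EFinP _ _).2 mf) _ g1 _.
- apply: filterS Ff => t + Dt => /(_ Dt) h.
  by apply/cvg_EFin; [exact: nearW|exact: h].
- by apply: aeW => t n Dt; rewrite /= lee_fin Fg.
have -> : [sequence (\int[mu]_(x in D) (F n x)%:E)%E]_n = (fun n => (Int (F n))%:E).
  by apply/funext => n; exact: EFin_Int.
have -> : (\int[mu]_(x in D) (EFin \o f) x)%E = (Int f)%:E by exact: EFin_Int.
by move=> /fine_cvg; apply.
Qed.

(** The sum of the absolute increments has a finite integral, hence is finite almost everywhere;
    there the telescoping series converges absolutely. *)
Lemma ae_cvg_of_summable (v : nat -> T -> R) (C : R) :
  (forall k, L1 (v k)) ->
  (forall k, Int (fun t => `|v k.+1 t - v k t|) <= C * 2^-1 ^+ k) ->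
  \forall t \ae mu, D t -> cvgn (v ^~ t).
Proof.
move=> v1 vC.
pose w k t := (`|v k.+1 t - v k t|)%:E.
have w1 k : L1 (fun t => `|v k.+1 t - v k t|) by apply: L1_abs; exact: L1B.
have mw k : measurable_fun D (w k) by exact/measurable_EFinP/L1_measurable.
have C0 : 0 <= C.
  by have := vC 0%N; rewrite expr0 mulr1; apply: le_trans; exact: Int_ge0.
have sfin : (\int[mu]_(t in D) (\sum_(k <oo) w k t) < +oo)%E.
  rewrite integral_nneseries//; last by move=> k t _; rewrite lee_fin.
  apply: (@le_lt_trans _ _ (2 * C)%:E); last exact: ltry.
  apply: lime_le; first by apply: is_cvg_nneseries => k _ _; apply: integral_ge0 => t _; rewrite lee_fin.
  apply: nearW => n.
  apply: (@le_trans _ _ (\sum_(0 <= k < n) (C * 2^-1 ^+ k)%:E)%E).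
    by apply: lee_sum => k _; rewrite /w EFin_Int// lee_fin.
  rewrite sumEFin lee_fin -mulr_sumr mulrC ler_wpM2r//.
  have := @geometric_le_lim R n 1 2^-1 ler01.
  rewrite /series/= /geometric/=; under [X in _ -> _ -> X <= _]eq_bigr do rewrite mul1r.
  move=> h; apply: le_trans (h _ _) _; rewrite ?invr_gt0//.
    by rewrite ger0_norm ?invr_ge0// invf_lt1// ltr1n.
  by rewrite mul1r (_ : (1 - 2^-1)^-1 = 2)//; field.
have ints : mu.-integrable D (fun t => \sum_(k <oo) w k t)%E.
  apply/integrableP; split; first by apply: ge0_emeasurable_sum => // k t _; rewrite lee_fin.
  rewrite (eq_integral (fun t => \sum_(k <oo) w k t)%E)// => t _.
  by rewrite gee0_abs// nneseries_ge0// => k _ _; rewrite lee_fin.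
have := integrable_ae mD ints.
apply: filterS => t + Dt => /(_ Dt) sf.
have vE n : v n t = v 0%N t + \sum_(0 <= k < n) (v k.+1 t - v k t).
  by rewrite telescope_sumr// addrC subrK.
have -> : v ^~ t = (fun n => v 0%N t + series (fun k => v k.+1 t - v k t) n).
  by apply/funext => n; rewrite vE.
apply: is_cvgD; first exact: is_cvg_cst.
apply: normed_cvg.
have h : cvgn (fun n => \sum_(0 <= k < n) `|v k.+1 t - v k t|); last exact: h.
apply: nondecreasing_is_cvgn; first by apply: nondecreasing_series => k _ _; exact: normr_ge0.
exists (fine (\sum_(k <oo) w k t)%E) => _ [n _ <-].
rewrite -lee_fin fineK// -sumEFin.
by apply: nneseries_lim_ge => k _; rewrite lee_fin.
Qed.

Theorem L2_complete (u : nat -> T -> R) : (forall n, L2 (u n)) ->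
  (forall e, 0 < e -> exists N, forall n m, (N <= n)%N -> (N <= m)%N ->
     Int (fun t => (u n t - u m t) ^+ 2) <= e) ->
  exists2 f, L2 f & forall e, 0 < e -> exists N, forall n, (N <= n)%N ->
     Int (fun t => (u n t - f t) ^+ 2) <= e.
Proof.
move=> u2 cau.
(* Squared distances of order [4^-k] become [L^1] distances of order [2^-k] by Cauchy-Schwarz
   against a constant. *)
have e0 k : 0 < (4^-1 : R) ^+ k by rewrite exprn_gt0// invr_gt0.
have /choice[s hs] := fun k => cau _ (e0 k).
(* Adding up the thresholds bounds each of them without a maximum; the extra [k] sends the indices
   to infinity. *)
pose tau k := (\sum_(j < k.+1) s j + k)%N.
have tau_ge k : (k <= tau k)%N by rewrite leq_addl.
have tau_s k l : (k <= l)%N -> (s k <= tau l)%N.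
  move=> kl; rewrite /tau (bigD1 (Ordinal (kl : (k < l.+1)%N)))//= -!addnA.
  exact: leq_addr.
pose v k := u (tau k).
have v2 k : L2 (v k) by exact: u2.
have vcvg : \forall t \ae mu, D t -> cvgn (v ^~ t).
  apply: (@ae_cvg_of_summable _ (Num.sqrt (fine (mu D)))) => [k|k]; first exact: L2_L1.
  apply: le_trans (Int_abs_le_sqrt (L2B (v2 k.+1) (v2 k))) _.
  rewrite ler_wpM2l ?sqrtr_ge0//.
  have -> : (2^-1 : R) ^+ k = Num.sqrt (4^-1 ^+ k).
    have -> : (4^-1 : R) = 2^-1 ^+ 2 by field.
    by rewrite exprAC sqrtr_sqr ger0_norm// exprn_ge0// invr_ge0.
  by apply: ler_wsqrtr; rewrite hs// tau_s.
(* An upper limit is measurable whether or not the sequence converges; [fine] replaces infinite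
   values by 0. *)
pose f t := fine (limn_esup (fun k => (v k t)%:E)).
have mf : measurable_fun D f.
  apply: measurableT_comp => //; apply: measurable_fun_limn_esup => k.
  exact/measurable_EFinP/L2_measurable.
have fE t : cvgn (v ^~ t) -> v ^~ t @ \oo --> f t.
  move=> /cvg_ex[/= l vl]; suff -> : f t = l by [].
  rewrite /f; have /cvg_limn_einf_sup[_ ->//] : (fun k => (v k t)%:E) @ \oo --> l%:E.
  exact/cvg_EFin/vl/nearW.
have key e : 0 < e -> exists N, forall n, (N <= n)%N ->
    L1 (fun t => (u n t - f t) ^+ 2) /\ Int (fun t => (u n t - f t) ^+ 2) <= e.
  move=> ep; have [N hN] := cau _ ep; exists N => n Nn.
  pose g k t := ((u n t - v k t) ^+ 2)%:E.
  have g1 k : L1 (fun t => (u n t - v k t) ^+ 2) by case: (L2B (u2 n) (v2 k)).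
  have mun : measurable_fun D (u n) by exact: L2_measurable.
  have mG : measurable_fun D (fun t => ((u n t - f t) ^+ 2)%:E).
    by apply/measurable_EFinP/measurable_funX/measurable_funB.
  have mg k : measurable_fun D (g k) by exact/measurable_EFinP/L1_measurable.
  (* Fatou's lemma carries the Cauchy estimate from [u n - v k] to [u n - f]. *)
  have le_e : (\int[mu]_(t in D) ((u n t - f t) ^+ 2)%:E <= e%:E)%E.
    rewrite (@ae_eq_integral _ _ _ _ _ (fun t => limn_einf (g ^~ t)))//; last 2 first.
    - under eq_fun do rewrite limn_einf_lim; under eq_fun do rewrite -limn_einf_lim.
      have -> : (fun t => limn_einf (g ^~ t)) = (fun t => - limn_esup (fun k => - g k t)%E)%E.
        by apply/funext => t; rewrite limn_esupN oppeK.
      apply: measurableT_comp => //; apply: measurable_fun_limn_esup => k.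
      exact: measurableT_comp.
    - apply: filterS vcvg => t + Dt => /(_ Dt)/fE vt.
      suff /cvg_limn_einf_sup[-> _] : (g ^~ t) @ \oo --> ((u n t - f t) ^+ 2)%:E by [].
      apply/cvg_EFin; first exact: nearW.
      rewrite (_ : _ \o _ = fun k => (u n t - v k t) * (u n t - v k t)); last first.
        by apply/funext => k /=; rewrite expr2.
      by rewrite expr2; apply: cvgM; apply: cvgB => //; exact: cvg_cst.
    apply: le_trans (fatou mu mD mg _) _; first by move=> k t _; rewrite lee_fin sqr_ge0.
    rewrite limn_einf_lim; apply: lime_le.
      exact: is_cvg_einfs.
    apply: nearW => k; apply: (@le_trans _ _ (\int[mu]_(t in D) g (maxn k N) t)%E).
      by apply: ereal_inf_lbound; exists (maxn k N) => //=; rewrite leq_maxl.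
    rewrite /g EFin_Int// lee_fin hN//.
    by rewrite (leq_trans _ (tau_ge _))// leq_maxr.
  have L : L1 (fun t => (u n t - f t) ^+ 2).
    apply/integrableP; split => //.
    under eq_integral do rewrite gee0_abs ?lee_fin ?sqr_ge0//.
    by apply: le_lt_trans le_e _; rewrite ltry.
  by split=> //; rewrite -lee_fin -EFin_Int.
exists f; last by move=> e /key[N hN]; exists N => n /hN[].
(* [f] is square integrable as [u N] minus the square integrable difference [u N - f]. *)
have [N /(_ _ (leqnn N))[h _]] := key 1 ltr01.
have : L2 (fun t => u N t - (u N t - f t)).
  apply: L2B => //; split => //; apply: measurable_funB => //; exact: L2_measurable.
by under eq_fun do rewrite subKr.
Qed.

End RieszFischer.

(** * Integrals over a set with null complement *)

Section Conull.
Context d (T : measurableType d) (R : realType) (mu : {measure set T -> \bar R}).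
Import HBNNSimple.

(* Truncating simple functions to [D] does not change their integral, so that [f] can be arbitrary. *)
Lemma integral_conull (D : set T) (f : T -> \bar R) : measurable D -> mu (~` D) = 0%E ->
  (\int[mu]_x f x = \int[mu]_(x in D) f x)%E.
Proof.
move=> mD D0.
pose up g := ereal_sup [set sintegral mu h |
  h in [set h : {nnsfun T >-> R} | forall x, ((h x)%:E <= g x)%E]].
have upE (g : T -> \bar R) : (forall x, 0 <= g x)%E -> up g = up (g \_ D).
  move=> g0; apply/eqP; rewrite eq_le; apply/andP; split; apply: ge_ereal_sup => _ /= [h hg <-].
    have -> : sintegral mu h = sintegral mu (proj_nnsfun h mD).
      rewrite -!integralT_nnsfun; apply: ae_eq_integral => //.
      - exact/measurable_EFinP.
      - exact/measurable_EFinP.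
      exists (~` D); split => //; first exact: measurableC.
      move=> x /= + Dx; apply => _; rewrite mindicE mem_set// mulr1//.
    apply: ereal_sup_ubound; exists (proj_nnsfun h mD) => //= x.
    by rewrite /patch mindicE; case: ifP; rewrite (mulr0, mulr1).
  apply: ereal_sup_ubound; exists h => //= x; apply: le_trans (hg x) _.
  by rewrite /patch; case: ifP.
rewrite /integral patch_setT -/(up _) -/(up _) upE// (upE (f ^\-)%E)//.
by rewrite -!/(up _) funepos_restrict funeneg_restrict.
Qed.

End Conull.

#[export] Instance mT_finite_part (R : realType) : finite_part (@mT R) (@circ_set R).
Proof.
split; first exact: circ_set_meas.
suff h : @mT R (@circ_set R) = lebesgue_measure (@circ_set R).
  rewrite [ltLHS]h.
  by rewrite /circ_set lebesgue_measure_itv/= lte_fin ltr01 sube0 ltry.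
by rewrite /mT /mrestr setIid.
Qed.

#[export] Instance mT_ae_filter (R : realType) : Filter (almost_everywhere (@mT R)).
Proof. exact: ae_filter_ringOfSetsType. Qed.

Section Circle.
Context (R : realType).
Local Notation mu := (@mT R).
Local Notation D := (@circ_set R).
Local Notation C := (complex R).
Local Notation L1 := (L1 mu D).
Local Notation L2 := (L2 mu D).
Local Notation Int := (Int mu D).

Lemma mT_circ : mu D = 1%E.
Proof.
suff h : mu D = lebesgue_measure D.
  rewrite [LHS]h.
  by rewrite /circ_set lebesgue_measure_itv/= lte_fin ltr01 sube0.
by rewrite /mT /mrestr setIid.
Qed.

Lemma Int1_cst a : Int (fun=> a) = a.
Proof.
rewrite Int_cst.
have -> : fine (mu D) = 1 by rewrite [X in fine X]mT_circ.
by rewrite mulr1.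
Qed.

Lemma mT_setCcirc : mu (~` D) = 0%E.
Proof. by rewrite /mT /mrestr/= setICl measure0. Qed.

(** The definitions integrate over the whole line against a measure carried by [circ_set]. No
    measurability is asked of [f], so the identity rewrites under any norm or coefficient. *)
Lemma integral_mT (f : R -> \bar R) : (\int[mu]_x f x = \int[mu]_(x in D) f x)%E.
Proof. by apply: integral_conull; [exact: circ_set_meas|exact: mT_setCcirc]. Qed.

Lemma ae_circ (P : R -> Prop) :
  {ae mu, forall t, D t -> P t} -> {ae mu, forall t, P t}.
Proof.
have Dae : {ae mu, forall t, D t}.
  exists (~` D); split; [by apply: measurableC; exact: circ_set_meas|exact: mT_setCcirc|].
  by move=> t /= h; exact: h.
by move=> h; apply: filterS2 h Dae => t; apply.
Qed.

Lemma cintE (f : R -> C) :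
  cint f = Complex (Int (fun t => complex.Re (f t))) (Int (fun t => complex.Im (f t))).
Proof. by rewrite /cint !integral_mT. Qed.

End Circle.

(** * Complex valued functions on the circle *)

Section ComplexNumbers.
Context (R : realType).
Local Notation C := (complex R).
Local Notation Re := complex.Re.
Local Notation Im := complex.Im.
Implicit Types (x y z : C) (a : R).

Lemma complex_eqP x y : Re x = Re y -> Im x = Im y -> x = y.
Proof. by case: x y => a b [c d] /= -> ->. Qed.

Lemma cReD x y : Re (x + y) = Re x + Re y. Proof. by case: x y => a b [c d]. Qed.
Lemma cImD x y : Im (x + y) = Im x + Im y. Proof. by case: x y => a b [c d]. Qed.
Lemma cReN x : Re (- x) = - Re x. Proof. by case: x. Qed.
Lemma cImN x : Im (- x) = - Im x. Proof. by case: x. Qed.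
Lemma cReB x y : Re (x - y) = Re x - Re y. Proof. by rewrite cReD cReN. Qed.
Lemma cImB x y : Im (x - y) = Im x - Im y. Proof. by rewrite cImD cImN. Qed.
Lemma cReM x y : Re (x * y) = Re x * Re y - Im x * Im y. Proof. by case: x y => a b [c d]. Qed.
Lemma cImM x y : Im (x * y) = Re x * Im y + Im x * Re y. Proof. by case: x y => a b [c d]. Qed.
Lemma cReJ x : Re (Num.conj x) = Re x. Proof. by case: x. Qed.
Lemma cImJ x : Im (Num.conj x) = - Im x. Proof. by case: x. Qed.
Lemma cRe_sum (I : Type) (s : seq I) (F : I -> C) : Re (\sum_(i <- s) F i) = \sum_(i <- s) Re (F i).
Proof. by elim/big_rec2: _ => // i a y _ <-; rewrite cReD. Qed.
Lemma cmodE z : `|z| = (cmod z)%:C%C. Proof. by rewrite normc_def. Qed.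

Lemma cmod_ge0 z : 0 <= cmod z. Proof. exact: sqrtr_ge0. Qed.

Lemma cmod_sqr z : cmod z ^+ 2 = Re z ^+ 2 + Im z ^+ 2.
Proof. by rewrite sqr_sqrtr// addr_ge0 ?sqr_ge0. Qed.

Lemma cmodM x y : cmod (x * y) = cmod x * cmod y.
Proof. by apply: complexI; rewrite rmorphM/= -!cmodE normrM. Qed.

Lemma cmodD x y : cmod (x + y) <= cmod x + cmod y.
Proof. by rewrite -lecR rmorphD/= -!cmodE ler_normD. Qed.

Lemma cmodN x : cmod (- x) = cmod x.
Proof. by apply: complexI; rewrite -!cmodE normrN. Qed.

Lemma cmodJ x : cmod (Num.conj x) = cmod x.
Proof. by rewrite /cmod cReJ cImJ sqrrN. Qed.

Lemma cmod0 : cmod (0 : C) = 0.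
Proof. by apply: complexI; rewrite -cmodE normr0. Qed.

Lemma cmod_eq0 x : cmod x = 0 -> x = 0.
Proof. by move=> x0; apply/normr0_eq0; rewrite cmodE x0. Qed.

Lemma cmodR a : cmod (a%:C%C) = `|a|.
Proof. by rewrite /cmod/= expr0n addr0 sqrtr_sqr. Qed.

Lemma cmod_sum (I : Type) (s : seq I) (F : I -> C) : cmod (\sum_(i <- s) F i) <= \sum_(i <- s) cmod (F i).
Proof.
elim/big_rec2: _ => [|i a y _ h]; first by rewrite cmod0.
by apply: le_trans (cmodD _ _) _; rewrite lerD2l.
Qed.

Lemma cRe_le_cmod z : `|Re z| <= cmod z.
Proof. by rewrite -sqrtr_sqr; apply: ler_wsqrtr; rewrite lerDl sqr_ge0. Qed.

Lemma cIm_le_cmod z : `|Im z| <= cmod z.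
Proof. by rewrite -sqrtr_sqr; apply: ler_wsqrtr; rewrite lerDr sqr_ge0. Qed.

Lemma cmod_le z : cmod z <= `|Re z| + `|Im z|.
Proof.
rewrite -[leRHS]ger0_norm ?addr_ge0// -sqrtr_sqr; apply: ler_wsqrtr.
rewrite -(real_normK (num_real (Re z))) -(real_normK (num_real (Im z))).
have := mulr_ge0 (normr_ge0 (Re z)) (normr_ge0 (Im z)); nra.
Qed.

Lemma conj_mul_cmod z : Num.conj z * z = (cmod z ^+ 2)%:C%C.
Proof. by rewrite mulrC -normCK cmodE rmorphXn. Qed.

Lemma conj_real a : Num.conj (a%:C%C) = a%:C%C :> C.
Proof. by apply: complex_eqP; rewrite ?cReJ ?cImJ//= oppr0. Qed.

(** The rotation that converts a bound on real parts, valid for all unimodular multiples, into a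
    bound on the modulus. *)
Lemma phase z : exists2 u : C, cmod u = 1 & u * z = (cmod z)%:C%C.
Proof.
have [->|z0] := eqVneq z 0; first by exists 1; rewrite ?mulr0 ?cmod0// cmodR normr1.
have c0 : cmod z != 0 by apply/eqP => /cmod_eq0/eqP; rewrite (negbTE z0).
exists (Num.conj z / (cmod z)%:C%C).
  by rewrite cmodM cmodJ -fmorphV cmodR ger0_norm ?invr_ge0 ?cmod_ge0// mulfV.
rewrite mulrAC conj_mul_cmod -fmorphV -rmorphM/=; congr (_%:C%C); field.
by [].
Qed.

End ComplexNumbers.

Section ComplexL2.
Context (R : realType).
Local Notation mu := (@mT R).
Local Notation D := (@circ_set R).
Local Notation C := (complex R).
Local Notation L1 := (L1 mu D).
Local Notation L2 := (L2 mu D).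
Local Notation Int := (Int mu D).
Local Notation Re := complex.Re.
Local Notation Im := complex.Im.
Implicit Types f g : R -> C.

Let mD : measurable D. Proof. exact: circ_set_meas. Qed.

Definition cmeas f := measurable_fun D (fun t => Re (f t)) /\ measurable_fun D (fun t => Im (f t)).
Definition cL1 f := L1 (fun t => Re (f t)) /\ L1 (fun t => Im (f t)).
Definition cL2 f := L2 (fun t => Re (f t)) /\ L2 (fun t => Im (f t)).

Lemma cL1_meas f : cL1 f -> cmeas f.
Proof. by move=> [/L1_measurable ? /L1_measurable ?]. Qed.
Lemma cL2_meas f : cL2 f -> cmeas f.
Proof. by move=> [/L2_measurable ? /L2_measurable ?]. Qed.
Lemma cL2_L1 f : cL2 f -> cL1 f.
Proof. by move=> [? ?]; split; exact: L2_L1. Qed.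

Lemma cmeas_cst (c : C) : cmeas (fun=> c). Proof. by split. Qed.
Lemma cmeasD f g : cmeas f -> cmeas g -> cmeas (fun t => f t + g t).
Proof.
move=> [a b] [c e]; split; first by under eq_fun do rewrite cReD; exact: measurable_funD.
by under eq_fun do rewrite cImD; exact: measurable_funD.
Qed.
Lemma cmeasM f g : cmeas f -> cmeas g -> cmeas (fun t => f t * g t).
Proof.
move=> [a b] [c e]; split.
  by under eq_fun do rewrite cReM; apply: measurable_funB; apply: measurable_funM.
by under eq_fun do rewrite cImM; apply: measurable_funD; apply: measurable_funM.
Qed.
Lemma cmeasJ f : cmeas f -> cmeas (fun t => Num.conj (f t)).
Proof.
move=> [a b]; split; first by under eq_fun do rewrite cReJ.
by under eq_fun do rewrite cImJ; exact: measurableT_comp.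
Qed.
Lemma cmeas_sum (I : Type) (s : seq I) (F : I -> R -> C) :
  (forall i, cmeas (F i)) -> cmeas (fun t => \sum_(i <- s) F i t).
Proof.
move=> hF; elim: s => [|i s ih]; first by under eq_fun do rewrite big_nil; exact: cmeas_cst.
by under eq_fun do rewrite big_cons; apply: cmeasD.
Qed.
Lemma cmeasR (f : R -> R) : measurable_fun D f -> cmeas (fun t => (f t)%:C%C).
Proof. by split. Qed.

Lemma measurable_cmod f : cmeas f -> measurable_fun D (fun t => cmod (f t)).
Proof.
move=> [a b]; apply: measurableT_comp.
  by apply: continuous_measurable_fun; exact: sqrt_continuous.
by apply: measurable_funD; exact: measurable_funX.
Qed.

Lemma cL1_le f (g : R -> R) : cmeas f -> L1 g -> {ae mu, forall t, cmod (f t) <= g t} -> cL1 f.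
Proof.
move=> [a b] hg fg; split; apply: (L1_ae_le _ hg) => //; apply: filterS fg => t ft _.
  by apply: le_trans ft; exact: cRe_le_cmod.
by apply: le_trans ft; exact: cIm_le_cmod.
Qed.

Lemma cL2_le f (g : R -> R) : cmeas f -> L2 g -> {ae mu, forall t, cmod (f t) <= g t} -> cL2 f.
Proof.
move=> [a b] hg fg; split; apply: (L2_ae_le _ hg) => //; apply: filterS fg => t ft _;
  apply: (le_trans _ (ler_norm _)); apply: le_trans ft.
  exact: cRe_le_cmod.
exact: cIm_le_cmod.
Qed.

Lemma cL1_cmod f : cL1 f -> L1 (fun t => cmod (f t)).
Proof.
move=> hf; have [a b] := hf; apply: (L1_le _ (L1D (L1_abs a) (L1_abs b))).
  by apply: measurable_cmod; exact: cL1_meas.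
by move=> t _; rewrite ger0_norm ?cmod_ge0// cmod_le.
Qed.

Lemma cL2_cmod f : cL2 f -> L2 (fun t => cmod (f t)).
Proof.
move=> hf; have [a b] := hf; apply: (L2_ae_le _ (L2D (L2_abs a) (L2_abs b))).
  by apply: measurable_cmod; exact: cL2_meas.
apply: aeW => t _; rewrite ger0_norm ?cmod_ge0// (le_trans (cmod_le _))//.
exact: ler_norm.
Qed.

Lemma cL1D f g : cL1 f -> cL1 g -> cL1 (fun t => f t + g t).
Proof.
move=> [a b] [c e]; split; first by under eq_fun do rewrite cReD; exact: L1D.
by under eq_fun do rewrite cImD; exact: L1D.
Qed.
Lemma cL2D f g : cL2 f -> cL2 g -> cL2 (fun t => f t + g t).
Proof.
move=> [a b] [c e]; split; first by under eq_fun do rewrite cReD; exact: L2D.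
by under eq_fun do rewrite cImD; exact: L2D.
Qed.
Lemma cL2N f : cL2 f -> cL2 (fun t => - f t).
Proof.
move=> [a b]; split; first by under eq_fun do rewrite cReN; exact: L2N.
by under eq_fun do rewrite cImN; exact: L2N.
Qed.
Lemma cL2B f g : cL2 f -> cL2 g -> cL2 (fun t => f t - g t).
Proof. by move=> hf /cL2N; exact: cL2D. Qed.
Lemma cL2J f : cL2 f -> cL2 (fun t => Num.conj (f t)).
Proof.
move=> [a b]; split; first by under eq_fun do rewrite cReJ.
by under eq_fun do rewrite cImJ; exact: L2N.
Qed.
Lemma cL1_cst (c : C) : cL1 (fun=> c). Proof. by split; exact: L1_cst. Qed.
Lemma cL2_cst (c : C) : cL2 (fun=> c). Proof. by split; exact: L2_cst. Qed.
Lemma cL1_sum (I : Type) (s : seq I) (F : I -> R -> C) :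
  (forall i, cL1 (F i)) -> cL1 (fun t => \sum_(i <- s) F i t).
Proof.
move=> hF; elim: s => [|i s ih]; first by under eq_fun do rewrite big_nil; exact: cL1_cst.
by under eq_fun do rewrite big_cons; apply: cL1D.
Qed.
Lemma cL2_sum (I : Type) (s : seq I) (F : I -> R -> C) :
  (forall i, cL2 (F i)) -> cL2 (fun t => \sum_(i <- s) F i t).
Proof.
move=> hF; elim: s => [|i s ih]; first by under eq_fun do rewrite big_nil; exact: cL2_cst.
by under eq_fun do rewrite big_cons; apply: cL2D.
Qed.

Lemma cL2M f g : cL2 f -> cL2 g -> cL1 (fun t => f t * g t).
Proof.
move=> hf hg; apply: (cL1_le _ (L2M (cL2_cmod hf) (cL2_cmod hg))).
  by apply: cmeasM; exact: cL2_meas.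
by apply: aeW => t; rewrite cmodM.
Qed.

Lemma cbd_cL1 M f g : cmeas f -> {ae mu, forall t, cmod (f t) <= M} -> cL1 g ->
  cL1 (fun t => f t * g t).
Proof.
move=> mf fM hg; apply: (cL1_le _ (L1Z M (cL1_cmod hg))).
  by apply: cmeasM => //; exact: cL1_meas.
by apply: filterS fM => t ft; rewrite cmodM ler_wpM2r ?cmod_ge0.
Qed.
Lemma cbd_cL2 M f g : cmeas f -> {ae mu, forall t, cmod (f t) <= M} -> cL2 g ->
  cL2 (fun t => f t * g t).
Proof.
move=> mf fM hg; apply: (cL2_le _ (L2Z M (cL2_cmod hg))).
  by apply: cmeasM => //; exact: cL2_meas.
by apply: filterS fM => t ft; rewrite cmodM ler_wpM2r ?cmod_ge0.
Qed.
Lemma cL1Z (c : C) f : cL1 f -> cL1 (fun t => c * f t).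
Proof. by apply: (@cbd_cL1 (cmod c)); [exact: cmeas_cst|exact: aeW]. Qed.
Lemma cL2Z (c : C) f : cL2 f -> cL2 (fun t => c * f t).
Proof. by apply: (@cbd_cL2 (cmod c)); [exact: cmeas_cst|exact: aeW]. Qed.

Lemma cRe_cint f : Re (cint f) = Int (fun t => Re (f t)). Proof. by rewrite cintE. Qed.
Lemma cIm_cint f : Im (cint f) = Int (fun t => Im (f t)). Proof. by rewrite cintE. Qed.

Lemma cintD f g : cL1 f -> cL1 g -> cint (fun t => f t + g t) = cint f + cint g.
Proof.
move=> [a b] [c e]; apply: complex_eqP; rewrite ?cReD ?cImD ?cRe_cint ?cIm_cint -IntD//;
  by apply: eq_Rintegral => t _; rewrite ?cReD ?cImD.
Qed.
Lemma cintJ f : cL1 f -> cint (fun t => Num.conj (f t)) = Num.conj (cint f).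
Proof.
move=> [a b]; apply: complex_eqP; rewrite ?cReJ ?cImJ ?cRe_cint ?cIm_cint -?IntN//;
  by apply: eq_Rintegral => t _; rewrite ?cReJ ?cImJ.
Qed.
Lemma cintZ (c : C) f : cL1 f -> cint (fun t => c * f t) = c * cint f.
Proof.
move=> [a b]; apply: complex_eqP; rewrite ?cReM ?cImM ?cRe_cint ?cIm_cint -!IntZ//.
  by rewrite -IntB; [apply: eq_Rintegral => t _; rewrite cReM|exact: L1Z|exact: L1Z].
by rewrite -IntD; [apply: eq_Rintegral => t _; rewrite cImM|exact: L1Z|exact: L1Z].
Qed.
Lemma cint0 : cint (fun=> 0 : C) = 0.
Proof. by apply: complex_eqP; rewrite ?cRe_cint ?cIm_cint Int0. Qed.
Lemma cint_cst (c : C) : cint (fun=> c) = c.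
Proof. by apply: complex_eqP; rewrite ?cRe_cint ?cIm_cint Int1_cst. Qed.
Lemma cint_sum (I : Type) (s : seq I) (F : I -> R -> C) :
  (forall i, cL1 (F i)) -> cint (fun t => \sum_(i <- s) F i t) = \sum_(i <- s) cint (F i).
Proof.
move=> hi; elim: s => [|i s ih].
  by under [X in cint X]eq_fun do rewrite big_nil; rewrite big_nil cint0.
under [X in cint X]eq_fun do rewrite big_cons.
by rewrite cintD ?ih ?big_cons//; exact: cL1_sum.
Qed.
Lemma cint_ae_eq f g : cmeas f -> cmeas g -> {ae mu, forall t, f t = g t} -> cint f = cint g.
Proof.
move=> [a b] [c e] fg; apply: complex_eqP; rewrite ?cRe_cint ?cIm_cint;
  by apply: Int_ae_eq => //; apply: filterS fg => t ->.
Qed.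

Lemma cmod_cint f : cL1 f -> cmod (cint f) <= Int (fun t => cmod (f t)).
Proof.
move=> hf; have [u u1 uE] := phase (cint f).
have uf := cL1Z u hf.
have -> : cmod (cint f) = Int (fun t => Re (u * f t)).
  by rewrite -cRe_cint cintZ// uE.
apply: Int_le; [by case: uf|exact: cL1_cmod|] => t _.
rewrite (le_trans (ler_norm _))// (le_trans (cRe_le_cmod _))//.
by rewrite cmodM u1 mul1r.
Qed.

End ComplexL2.

(** * Uniqueness of Fourier coefficients *)

Section Threshold.
Context (R : realType).
Implicit Types (a y : R) (n N : nat).

(** A polynomial that tends, on [[0, 1]], to the indicator of [y < 1/2]: the product of the base
    perturbation [y^n] with the exponent [2^n] is [(2 y)^n], which tends to 0 below [1/2] and to
    infinity above. *)
Definition threshold n y : R := (1 - y ^+ n) ^+ (2 ^ n).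

Lemma bernoulli_ge a N : 0 <= a <= 1 -> 1 - N%:R * a <= (1 - a) ^+ N.
Proof.
move=> /andP[a0 a1]; elim: N => [|N ih]; first by rewrite mul0r subr0 expr0.
rewrite exprS -natr1; have := ler_wpM2l (_ : 0 <= 1 - a) ih; rewrite subr_ge0 => /(_ a1).
apply: le_trans; have : 0 <= N%:R * a * a by rewrite !mulr_ge0.
lra.
Qed.

(** The upper counterpart of Bernoulli's inequality, with the denominator multiplied out:
    [(1 - a) (1 + (N + 1) a)] is at most [1 + N a]. *)
Lemma bernoulli_inv a N : 0 <= a <= 1 -> (1 - a) ^+ N * (1 + N%:R * a) <= 1.
Proof.
move=> /andP[a0 a1]; elim: N => [|N ih]; first by rewrite mul0r addr0 expr0 mul1r.
apply: le_trans ih; rewrite exprSr -mulrA ler_wpM2l ?exprn_ge0 ?subr_ge0// -natr1.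
have : 0 <= N%:R * a * a by rewrite !mulr_ge0.
have : 0 <= a * a by rewrite mulr_ge0.
lra.
Qed.

Lemma threshold_itv n y : 0 <= y <= 1 -> 0 <= threshold n y <= 1.
Proof.
move=> /andP[y0 y1]; have yn0 : 0 <= y ^+ n by rewrite exprn_ge0.
have yn1 : y ^+ n <= 1 by rewrite exprn_ile1.
by rewrite exprn_ge0 ?subr_ge0//= exprn_ile1 ?subr_ge0// lerBlDr lerDl.
Qed.

Lemma threshold_lt y : 0 <= y -> y < 2^-1 -> threshold ^~ y @ \oo --> (1 : R).
Proof.
move=> y0 y2; have y1 : y <= 1 by lra.
apply: (@squeeze_cvgr _ _ _ _ (fun n => 1 - (2 * y) ^+ n) (fun=> 1)); last exact: cvg_cst.
- apply: nearW => n; have /andP[_ ->] : 0 <= threshold n y <= 1 by apply: threshold_itv; rewrite y0.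
  rewrite andbT; have := @bernoulli_ge (y ^+ n) (2 ^ n).
  by rewrite exprn_ge0// exprn_ile1// exprMn natrX => /(_ erefl).
rewrite -[X in _ --> X]subr0; apply: cvgB; first exact: cvg_cst.
by apply: cvg_expr; rewrite ger0_norm ?mulr_ge0//; lra.
Qed.

Lemma threshold_gt y : 2^-1 < y -> y <= 1 -> threshold ^~ y @ \oo --> (0 : R).
Proof.
move=> y2 y1; have y0 : 0 <= y by lra.
have z0 : 0 < 2 * y by lra.
apply: (@squeeze_cvgr _ _ _ _ (fun=> 0) (fun n => (2 * y)^-1 ^+ n)); first 2 last.
- by apply: cvg_expr; rewrite ger0_norm ?invr_ge0 ?ltW// invf_lt1//; lra.
- apply: nearW => n; have /andP[t0 _] : 0 <= threshold n y <= 1 by apply: threshold_itv; rewrite y0.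
  rewrite t0/= exprVn -[leRHS]mul1r ler_pdivlMr ?exprn_gt0//.
  have := @bernoulli_inv (y ^+ n) (2 ^ n).
  rewrite exprn_ge0// exprn_ile1// exprMn natrX => /(_ erefl); apply: le_trans.
  by rewrite ler_wpM2l// lerDr.
exact: cvg_cst.
Qed.

End Threshold.

Section CosArc.
Context (R : realType).
Implicit Types (x t : R).

(* [cosarc x t] is above or below [1/2] according to whether [t] is in the arc [(0, x)] or not. *)
Definition cosarc x t : R := 2^-1 + (cos (2 * pi * t - pi * x) - cos (pi * x)) / 4.

Lemma cosarc_itv x t : 0 <= cosarc x t <= 1.
Proof.
rewrite /cosarc; have := cos_geN1 (2 * pi * t - pi * x); have := cos_le1 (2 * pi * t - pi * x).
have := cos_geN1 (pi * x); have := cos_le1 (pi * x).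
by move=> *; apply/andP; split; lra.
Qed.

(** The angle [2 pi t - pi x] vanishes at the midpoint of the arc and equals [- pi x] and [pi x] at
    its ends; the cosine decreases with the absolute value of the angle up to [pi]. *)
Lemma cosarc_in x t : 0 < t -> t < x -> x < 1 -> 2^-1 < cosarc x t.
Proof.
move=> t0 tx x1; rewrite /cosarc; have pi0 := pi_gt0 R.
suff : cos (pi * x) < cos (2 * pi * t - pi * x) by lra.
have [u0|u0] := leP 0 (2 * pi * t - pi * x).
  by rewrite ltr_cos ?in_itv/=; [nra|apply/andP; split; nra|apply/andP; split; nra].
rewrite -[ltRHS]cosN; rewrite ltr_cos ?in_itv/=; [nra|apply/andP; split; nra|apply/andP; split; nra].
Qed.

Lemma cosarc_out x t : 0 < x -> x < t -> t < 1 -> cosarc x t < 2^-1.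
Proof.
move=> x0 xt t1; rewrite /cosarc; have pi0 := pi_gt0 R.
suff : cos (2 * pi * t - pi * x) < cos (pi * x) by lra.
have [u0|u0] := leP (2 * pi * t - pi * x) pi.
  by rewrite ltr_cos ?in_itv/=; [nra|apply/andP; split; nra|apply/andP; split; nra].
(* Past [pi] the angle is reflected back into the interval where the cosine is decreasing. *)
have -> : cos (2 * pi * t - pi * x) = cos (pi *+ 2 - (2 * pi * t - pi * x)).
  by rewrite -[LHS]cosN -(cosD2pi (- _)); congr cos; lra.
by rewrite ltr_cos ?in_itv/=; [nra|apply/andP; split; nra|apply/andP; split; nra].
Qed.

End CosArc.

Section Fourier.
Context (R : realType).
Local Notation mu := (@mT R).
Local Notation D := (@circ_set R).
Local Notation C := (complex R).
Local Notation L1 := (L1 mu D).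
Local Notation L2 := (L2 mu D).
Local Notation Int := (Int mu D).
Local Notation Re := complex.Re.
Local Notation Im := complex.Im.
Local Notation leb := (@lebesgue_measure R).
Implicit Types f g : R -> C.

Let mD : measurable D. Proof. exact: circ_set_meas. Qed.

Definition echar (j : int) (t : R) : C := cexpi (2 * pi * j%:~R * t).

Lemma echar0 t : echar 0 t = 1.
Proof. by rewrite /echar mulr0 mul0r /cexpi cos0 sin0. Qed.

Lemma echarD i j t : echar (i + j) t = echar i t * echar j t.
Proof.
rewrite /echar intrD mulrDr mulrDl.
by apply: complex_eqP; rewrite ?cReM ?cImM /cexpi/= ?cosD ?sinD// addrC.
Qed.

Lemma echarJ j t : Num.conj (echar j t) = echar (- j) t.
Proof.
by apply: complex_eqP; rewrite ?cReJ ?cImJ /echar intrN mulrN mulNr /cexpi/= ?cosN ?sinN.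
Qed.

Lemma cmod_echar j t : cmod (echar j t) = 1.
Proof. by rewrite /cmod/= cos2Dsin2 sqrtr1. Qed.

Lemma cmeas_echar j : cmeas (echar j).
Proof.
split; apply: measurable_funTS; apply: continuous_measurable_fun => t.
  apply: (@continuous_comp _ _ _ (fun t => 2 * pi * j%:~R * t) cos); last exact: continuous_cos.
  by apply: cvgM; [exact: cvg_cst|exact: cvg_id].
apply: (@continuous_comp _ _ _ (fun t => 2 * pi * j%:~R * t) sin); last exact: continuous_sin.
by apply: cvgM; [exact: cvg_cst|exact: cvg_id].
Qed.

Lemma cL1_echar f j : cL1 f -> cL1 (fun t => echar j t * f t).
Proof. by apply: (@cbd_cL1 _ 1); [exact: cmeas_echar|apply: aeW => t; rewrite cmod_echar]. Qed.

Lemma cL2_echar f j : cL2 f -> cL2 (fun t => echar j t * f t).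
Proof. by apply: (@cbd_cL2 _ 1); [exact: cmeas_echar|apply: aeW => t; rewrite cmod_echar]. Qed.

Lemma fcoefE f j : fcoef f j = cint (fun t => echar (- j) t * f t).
Proof.
rewrite /fcoef; congr cint; apply/funext => t; rewrite mulrC /echar; congr (cexpi _ * _).
by rewrite intrN mulrN mulNr.
Qed.

Lemma fcoefD f g j : cL1 f -> cL1 g -> fcoef (fun t => f t + g t) j = fcoef f j + fcoef g j.
Proof.
move=> hf hg; rewrite !fcoefE -cintD; [|exact: cL1_echar..].
by congr cint; apply/funext => t; rewrite mulrDr.
Qed.

Lemma fcoefZ c f j : cL1 f -> fcoef (fun t => c * f t) j = c * fcoef f j.
Proof.
move=> hf; rewrite !fcoefE -cintZ; last exact: cL1_echar.
by congr cint; apply/funext => t; rewrite mulrCA.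
Qed.

Lemma fcoef_echar f i j : fcoef (fun t => echar i t * f t) j = fcoef f (j - i).
Proof.
by rewrite !fcoefE; congr cint; apply/funext => t; rewrite mulrA -echarD opprB addrC.
Qed.

Lemma fcoefJ f j : cL1 f -> fcoef (fun t => Num.conj (f t)) j = Num.conj (fcoef f (- j)).
Proof.
move=> hf; rewrite !fcoefE -cintJ; last exact: cL1_echar.
by congr cint; apply/funext => t; rewrite rmorphM/= echarJ opprK.
Qed.

Lemma fcoef_sum (I : Type) (s : seq I) (F : I -> R -> C) j :
  (forall i, cL1 (F i)) -> fcoef (fun t => \sum_(i <- s) F i t) j = \sum_(i <- s) fcoef (F i) j.
Proof.
move=> hF; under eq_bigr do rewrite fcoefE.
rewrite fcoefE -cint_sum; last by move=> i; exact: cL1_echar.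
by congr cint; apply/funext => t; rewrite mulr_sumr.
Qed.

Lemma fcoef_ae_eq f g j : cmeas f -> cmeas g -> {ae mu, forall t, f t = g t} -> fcoef f j = fcoef g j.
Proof.
move=> mf mg fg; rewrite !fcoefE; apply: cint_ae_eq.
- by apply: cmeasM => //; exact: cmeas_echar.
- by apply: cmeasM => //; exact: cmeas_echar.
by apply: filterS fg => t ->.
Qed.

Definition fcoef_null f := cL1 f /\ forall j, fcoef f j = 0.

(** These multipliers form an algebra containing the characters, so all trigonometric polynomials
    are reached through closure lemmas, with no explicit expansion. *)
Definition null_multiplier (phi : R -> C) :=
  forall f, fcoef_null f -> fcoef_null (fun t => phi t * f t).

Lemma null_multiplier_echar j : null_multiplier (echar j).
Proof.
by move=> f [f1 f0]; split=> [|i]; [exact: cL1_echar|rewrite fcoef_echar].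
Qed.

Lemma null_multiplier_cst c : null_multiplier (fun=> c).
Proof.
by move=> f [f1 f0]; split=> [|i]; [exact: cL1Z|rewrite fcoefZ// f0 mulr0].
Qed.

Lemma null_multiplierD phi psi : null_multiplier phi -> null_multiplier psi ->
  null_multiplier (fun t => phi t + psi t).
Proof.
move=> hp hq f hf; have [p1 p0] := hp _ hf; have [q1 q0] := hq _ hf.
under eq_fun do rewrite mulrDl.
by split=> [|j]; [exact: cL1D|rewrite fcoefD// p0 q0 addr0].
Qed.

Lemma null_multiplierM phi psi : null_multiplier phi -> null_multiplier psi ->
  null_multiplier (fun t => phi t * psi t).
Proof.
by move=> hp hq f /hq/hp; under eq_fun do rewrite mulrA.
Qed.

Lemma null_multiplierX phi n : null_multiplier phi -> null_multiplier (fun t => phi t ^+ n).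
Proof.
move=> hp; elim: n => [|n ih]; first exact: (null_multiplier_cst 1).
by under eq_fun do rewrite exprS; exact: null_multiplierM.
Qed.

(** The cosine splits into the characters of index 1 and -1, so [cosarc x] is a trigonometric
    polynomial of degree one. *)
Lemma null_multiplier_cosarc x : null_multiplier (fun t => (cosarc x t)%:C%C).
Proof.
have -> : (fun t => (cosarc x t)%:C%C) = (fun t =>
    (2^-1 - cos (pi * x) / 4)%:C%C +
    (((8^-1)%:C%C * cexpi (- (pi * x))) * echar 1 t + ((8^-1)%:C%C * cexpi (pi * x)) * echar (- 1) t)).
  apply/funext => t; rewrite /echar intrN mulr1 mulrN1 mulNr.
  apply: complex_eqP; rewrite ?(cReD, cImD, cReM, cImM)/= ?cosN ?sinN; last by ring.
  by rewrite /cosarc cosB; field.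
apply: null_multiplierD; first exact: null_multiplier_cst.
by apply: null_multiplierD;
  (apply: null_multiplierM; [exact: null_multiplier_cst|exact: null_multiplier_echar]).
Qed.

Lemma null_multiplier_threshold x n : null_multiplier (fun t => (threshold n (cosarc x t))%:C%C).
Proof.
under eq_fun do rewrite /threshold rmorphXn rmorphB rmorph1 rmorphXn/=.
apply: null_multiplierX; under eq_fun do rewrite -mulN1r.
apply: null_multiplierD; first exact: null_multiplier_cst.
apply: null_multiplierM; first exact: null_multiplier_cst.
by apply: null_multiplierX; exact: null_multiplier_cosarc.
Qed.

Lemma ae_neq (a : R) : {ae mu, forall t, t != a}.
Proof.
exists [set a]; split; first exact: measurable_set1.
  apply/eqP; rewrite -measure_le0; apply: (@le_trans _ _ (leb [set a])).
    rewrite /mT /mrestr; apply: le_measure; rewrite ?inE//=.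
    by apply: measurableI => //; exact: measurable_set1.
  by rewrite lebesgue_measure_set1.
by move=> t /= /negP; rewrite negbK => /eqP.
Qed.

(** The polynomials [threshold n] in [cosarc x] integrate to zero against [h] and converge boundedly
    to the indicator of the complement of the arc; the integral over the arc vanishes by difference
    with the total one. Real and imaginary parts are treated together through [hE]. *)
Lemma Int_arc_null (f : R -> C) (h : R -> R) (x : R) : fcoef_null f ->
  h = (fun t => Re (f t)) \/ h = (fun t => Im (f t)) -> 0 < x < 1 ->
  Int (fun t => \1_`]-oo, x] t * h t) = 0.
Proof.
move=> hf hE /andP[x0 x1]; have [f1 f0] := hf.
have h1 : L1 h by case: hE => ->; case: f1.
have mh := L1_measurable h1.
have Ip n : Int (fun t => threshold n (cosarc x t) * h t) = 0.
  have [p1] := null_multiplier_threshold x n hf.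
  move/(_ 0); rewrite fcoefE oppr0 (_ : (fun t => _ * (_ * _)) =
      (fun t => (threshold n (cosarc x t))%:C%C * f t)); last first.
    by apply/funext => t; rewrite echar0 mul1r.
  move=> I0; case: hE => ->;
    [transitivity (Re (0 : C)) => //|transitivity (Im (0 : C)) => //]; rewrite -I0;
    rewrite ?cRe_cint ?cIm_cint; apply: eq_Rintegral => t _;
    by rewrite ?cReM ?cImM/= mul0r ?subr0 ?addr0.
have I0 : Int h = 0.
  have := f0 0; rewrite fcoefE oppr0 (_ : (fun t => _ * _) = f); last first.
    by apply/funext => t; rewrite echar0 mul1r.
  move=> E; case: hE => ->; [transitivity (Re (0 : C)) => //|transitivity (Im (0 : C)) => //];
    by rewrite -E ?cRe_cint ?cIm_cint.
have mp n : measurable_fun D (fun t => threshold n (cosarc x t)).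
  apply: measurable_funX; apply: measurable_funB => //; apply: measurable_funX.
  apply: measurable_funD => //; apply: measurable_funM => //; apply: measurable_funB => //.
  apply: measurable_funTS; apply: continuous_measurable_fun => t.
  apply: (@continuous_comp _ _ _ (fun t => 2 * pi * t - pi * x) cos); last exact: continuous_cos.
  by apply: cvgB; [apply: cvgM; [exact: cvg_cst|exact: cvg_id]|exact: cvg_cst].
have mind : measurable_fun D (\1_`]-oo, x] : R -> R) by exact: measurable_indic.
(* The limit of the thresholds is 1 outside the arc, where [cosarc] is below [1/2]; the endpoints 0
   and [x] are a null set. *)
pose g t := (1 - \1_`]-oo, x] t) * h t.
have mg : measurable_fun D g by apply: measurable_funM => //; exact: measurable_funB.
have g1 : L1 g.
  apply: (@bounded_L1 _ _ _ _ _ _ 1) => //; first exact: measurable_funB.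
  by apply: aeW => t _; rewrite indicE; case: (_ \in _); rewrite ?subrr ?subr0 ?normr0 ?normr1.
have Ig : Int g = 0.
  suff : (fun n => Int (fun t => threshold n (cosarc x t) * h t)) @ \oo --> Int g.
    under eq_fun do rewrite Ip; move=> /cvg_lim <- //; exact: lim_cst.
  apply: (@Int_dominated _ _ _ mu D (mT_finite_part R)
    (fun n t => threshold n (cosarc x t) * h t) g _ _ mg (L1_abs h1)) => [n||n t Dt].
  - by apply: measurable_funM; [exact: mp|exact: mh].
  - apply: filterS2 (ae_neq 0) (ae_neq x) => t t0 tx; rewrite /circ_set/= in_itv/= => /andP[t0' t1].
    apply: cvgM; last exact: cvg_cst.
    rewrite indicE mem_setE in_itv/=; case: (leP t x) => xt.
      rewrite subrr; apply: threshold_gt; last by have /andP[] := cosarc_itv x t.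
      by apply: cosarc_in => //; rewrite lt_neqAle ?tx// eq_sym t0.
    by rewrite subr0; apply: threshold_lt; [have /andP[] := cosarc_itv x t|exact: cosarc_out].
  - have /andP[a b] := threshold_itv n (cosarc_itv x t).
    by rewrite normrM ler_piMl// ger0_norm.
have i1 : L1 (fun t => \1_`]-oo, x] t * h t).
  apply: (@bounded_L1 _ _ _ _ _ _ 1) => //.
  by apply: aeW => t _; rewrite indicE; case: (_ \in _); rewrite ?normr0 ?normr1.
have : Int (fun t => g t + \1_`]-oo, x] t * h t) = 0.
  by rewrite -I0; apply: eq_Rintegral => t _; rewrite /g; ring.
by rewrite IntD// Ig add0r.
Qed.

Lemma integral_mT_lebesgue (u : R -> \bar R) :
  (\int[mu]_(t in D) u t = \int[leb]_(t in D) u t)%E.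
Proof.
have mT_leb (A : set R) : measurable A -> A `<=` D -> mu A = leb A.
  by move=> mA AD; rewrite /mT /mrestr setIidl.
by apply: eq_measure_integral => A mA AD; exact: mT_leb.
Qed.

(** Lebesgue differentiation: the primitive of [h], extended by zero, is constant on []0, 1[], and
    its derivative is [h] almost everywhere. *)
Lemma ae_eq0_of_arcs (h : R -> R) : L1 h ->
  (forall x, 0 < x < 1 -> Int (fun t => \1_`]-oo, x] t * h t) = 0) ->
  {ae mu, forall t, h t = 0}.
Proof.
move=> h1 h0.
have hleb : leb.-integrable D (EFin \o h).
  have /integrableP[mh hoo] := h1; apply/integrableP; split; first exact: mh.
  by rewrite -integral_mT_lebesgue.
pose f := h \_ D.
have fleb : leb.-integrable setT (EFin \o f).
  by rewrite /f -restrict_EFin -integrable_mkcond.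
have fi y : leb.-integrable `]-oo, y] (EFin \o f) by exact: integrableS fleb.
have flocal : locally_integrable [set: R] f by exact: integrable_locally.
have F0 y : 0 < y < 1 -> (\int[leb]_(t in `]-oo, y]) f t)%R = 0.
  move=> y1; rewrite Rintegral_mkcond -[RHS](h0 y y1) /Int /Rintegral integral_mT_lebesgue -/(Rintegral _ _ _) [RHS]Rintegral_mkcond.
  apply: eq_Rintegral => t _; rewrite /f /patch !mem_setE.
  by rewrite indicE mem_setE; do 2 case: ifP => //; rewrite ?mul1r ?mul0r.
have H : {ae mu, forall t, let F x := (\int[leb]_(t in `]-oo, x]) f t)%R in derive1 F t = f t}.
  have [N [mN N0 Nf]] := FTC1Ny fi flocal.
  exists N; split; [exact: mN| |by move=> t /= ht; apply: Nf => /= -[_ ?]; exact: ht].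
  apply/eqP; rewrite -measure_le0 -N0 /mT /mrestr; apply: le_measure; rewrite ?inE//=.
  by apply: measurableI.
apply: ae_circ; apply: filterS2 H (ae_neq 0) => t /= + t0 Dt.
move: (Dt); rewrite /circ_set/= in_itv/= => /andP[t0' t1].
rewrite {2}/f patchE mem_set// => <-.
rewrite -(derive1_cst 0 t) !derive1E; apply: near_eq_derive.
have t01 : t \in `]0, 1[ by rewrite in_itv/= t1 lt_neqAle eq_sym t0 t0'.
near=> y; apply: F0; have : y \in `]0, 1[ by near: y; exact: near_in_itvoo.
by rewrite in_itv.
Unshelve. all: by end_near. Qed.

Theorem fcoef_inj0 f : fcoef_null f -> {ae mu, forall t, f t = 0}.
Proof.
move=> hf; have [[r1 i1] _] := hf.
have a : {ae mu, forall t, Re (f t) = 0}.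
  by apply: ae_eq0_of_arcs => // x; apply: Int_arc_null hf _; left.
have b : {ae mu, forall t, Im (f t) = 0}.
  by apply: ae_eq0_of_arcs => // x; apply: Int_arc_null hf _; right.
by apply: filterS2 a b => t ? ?; exact: complex_eqP.
Qed.

End Fourier.

Local Open Scope sesquilinear_scope.

(** * Operator norm and trace norm *)

Lemma sum_Cauchy_Schwarz (R : realType) (I : finType) (a b : I -> R) :
  (\sum_i a i * b i) ^+ 2 <= (\sum_i a i ^+ 2) * (\sum_i b i ^+ 2).
Proof.
apply: discr_le => [||s]; try by apply: sumr_ge0 => i _; exact: sqr_ge0.
have -> : \sum_i a i ^+ 2 + 2 * s * (\sum_i a i * b i) + s ^+ 2 * (\sum_i b i ^+ 2)
   = \sum_i (a i + s * b i) ^+ 2.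
  by rewrite !mulr_sumr -!big_split/=; apply: eq_bigr => i _; ring.
by apply: sumr_ge0 => i _; exact: sqr_ge0.
Qed.

Section Adjoint.
Context (R : realType).
Local Notation C := (complex R).

Lemma adjM m n p (A : 'M[C]_(m, n)) (B : 'M[C]_(n, p)) : (A *m B)^t* = B^t* *m A^t*.
Proof. by rewrite trmx_mul map_mxM. Qed.
Lemma adjZ m n c (A : 'M[C]_(m, n)) : (c *: A)^t* = Num.conj c *: A^t*.
Proof. by rewrite linearZ/= map_mxZ. Qed.
Lemma adj1 n : (1%:M : 'M[C]_n)^t* = 1%:M.
Proof. by rewrite trmx1 map_mx1. Qed.
Lemma adjE m n (A : 'M[C]_(m, n)) i j : A^t* i j = Num.conj (A j i).
Proof. by rewrite !mxE. Qed.
End Adjoint.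

Section VectorNorm.
Context (R : realType).
Local Notation C := (complex R).

Lemma vnorm_sqr p (x : 'cV[C]_p) : vnorm x ^+ 2 = \sum_i cmod (x i 0) ^+ 2.
Proof.
rewrite /vnorm sqr_sqrtr.
  by apply: eq_bigr => i _; rewrite cmod_sqr.
by apply: sumr_ge0 => i _; rewrite addr_ge0 ?sqr_ge0.
Qed.

Lemma vnorm_ge0 p (x : 'cV[C]_p) : 0 <= vnorm x.
Proof. exact: sqrtr_ge0. Qed.

Lemma vnorm_le_sqr p q (x : 'cV[C]_p) (y : 'cV[C]_q) c : 0 <= c ->
  vnorm x ^+ 2 <= c ^+ 2 * vnorm y ^+ 2 -> vnorm x <= c * vnorm y.
Proof.
move=> c0; rewrite -exprMn ler_pXn2r ?nnegrE ?vnorm_ge0//.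
by rewrite mulr_ge0 ?vnorm_ge0.
Qed.

Lemma vdotE p (x y : 'cV[C]_p) : (x^t* *m y) 0 0 = \sum_i Num.conj (x i 0) * y i 0.
Proof. by rewrite mxE; apply: eq_bigr => i _; rewrite !mxE. Qed.

Lemma vdot_self p (x : 'cV[C]_p) : (x^t* *m x) 0 0 = (vnorm x ^+ 2)%:C%C.
Proof.
rewrite vdotE vnorm_sqr rmorph_sum; apply: eq_bigr => i _.
exact: conj_mul_cmod.
Qed.

Lemma vdot_le p (x y : 'cV[C]_p) : cmod ((x^t* *m y) 0 0) <= vnorm x * vnorm y.
Proof.
rewrite vdotE; apply: le_trans (cmod_sum _ _) _.
have xy0 : 0 <= vnorm x * vnorm y by rewrite mulr_ge0 ?vnorm_ge0.
rewrite -(@ler_pXn2r _ 2) ?nnegrE//; last by apply: sumr_ge0 => i _; exact: cmod_ge0.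
rewrite exprMn !vnorm_sqr.
under eq_bigr do rewrite cmodM cmodJ.
exact: sum_Cauchy_Schwarz.
Qed.

Lemma vnorm0 p : vnorm (0 : 'cV[C]_p) = 0.
Proof.
by apply/eqP; rewrite -(sqrf_eq0 (vnorm _)) vnorm_sqr big1// => i _; rewrite mxE cmod0 expr0n.
Qed.

Lemma vnorm_eq0 p (x : 'cV[C]_p) : vnorm x = 0 -> x = 0.
Proof.
move=> x0; have : \sum_i cmod (x i 0) ^+ 2 == 0 by rewrite -vnorm_sqr x0 expr0n.
rewrite psumr_eq0 => [/allP h|i _]; last exact: sqr_ge0.
apply/colP => i; rewrite mxE; apply: cmod_eq0; apply/eqP.
by have := h i (mem_index_enum _); rewrite implyTb sqrf_eq0.
Qed.

Lemma vnormZ p c (x : 'cV[C]_p) : vnorm (c *: x) = cmod c * vnorm x.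
Proof.
apply/eqP; rewrite -(@eqrXn2 _ 2) ?vnorm_ge0// ?mulr_ge0 ?cmod_ge0 ?vnorm_ge0//.
rewrite exprMn !vnorm_sqr mulr_sumr; apply/eqP; apply: eq_bigr => i _.
by rewrite mxE cmodM exprMn.
Qed.

Lemma cmod_le_vnorm p (x : 'cV[C]_p) i : cmod (x i 0) <= vnorm x.
Proof.
rewrite -(@ler_pXn2r _ 2) ?nnegrE ?cmod_ge0 ?vnorm_ge0// vnorm_sqr (bigD1 i)//= lerDl.
by apply: sumr_ge0 => j _; exact: sqr_ge0.
Qed.

Lemma vnorm_le_sum p (x : 'cV[C]_p) : vnorm x <= \sum_i cmod (x i 0).
Proof.
have s0 : 0 <= \sum_i cmod (x i 0) by apply: sumr_ge0 => i _; exact: cmod_ge0.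
rewrite -(@ler_pXn2r _ 2) ?nnegrE ?vnorm_ge0// vnorm_sqr [leRHS]expr2 mulr_suml.
apply: ler_sum => i _; rewrite expr2 ler_wpM2l ?cmod_ge0// (bigD1 i)//= lerDl.
by apply: sumr_ge0 => j _; exact: cmod_ge0.
Qed.

Lemma vnormD p (x y : 'cV[C]_p) : vnorm (x + y) <= vnorm x + vnorm y.
Proof.
rewrite -(@ler_pXn2r _ 2) ?nnegrE ?addr_ge0 ?vnorm_ge0//.
suff : vnorm (x + y) ^+ 2 = vnorm x ^+ 2 + 2 * complex.Re ((x^t* *m y) 0 0) + vnorm y ^+ 2.
  have := vdot_le x y; have := cRe_le_cmod ((x^t* *m y) 0 0).
  have := ler_norm (complex.Re ((x^t* *m y) 0 0)); lra.
rewrite !vnorm_sqr vdotE cRe_sum mulr_sumr -!big_split/=; apply: eq_bigr => i _.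
by rewrite mxE !cmod_sqr !(cReD, cImD, cReM, cReJ, cImJ); ring.
Qed.

Lemma vnormN p (x : 'cV[C]_p) : vnorm (- x) = vnorm x.
Proof. by rewrite -scaleN1r vnormZ cmodN -(rmorph1 (real_complex R)) cmodR normr1 mul1r. Qed.

End VectorNorm.

Section OperatorNorm.
Context (R : realType).
Local Notation C := (complex R).

(** A crude norm whose measurability and integrability are read off the entries; it dominates both
    the operator norm and the trace norm. *)
Definition l1norm p q (A : 'M[C]_(p, q)) : R := \sum_i \sum_j cmod (A i j).

Lemma l1norm_ge0 p q (A : 'M[C]_(p, q)) : 0 <= l1norm A.
Proof. by apply: sumr_ge0 => i _; apply: sumr_ge0 => j _; exact: cmod_ge0. Qed.

Lemma vnorm_mul_l1norm p q (A : 'M[C]_(p, q)) x : vnorm (A *m x) <= l1norm A * vnorm x.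
Proof.
apply: le_trans (vnorm_le_sum _) _; rewrite mulr_suml; apply: ler_sum => i _.
rewrite mxE; apply: le_trans (cmod_sum _ _) _; rewrite mulr_suml; apply: ler_sum => j _.
by rewrite cmodM ler_wpM2l ?cmod_ge0// cmod_le_vnorm.
Qed.

Lemma opnorm_has_sup p q (A : 'M[C]_(p, q)) :
  has_sup [set vnorm (A *m x) | x in [set x : 'cV[C]_q | vnorm x <= 1]].
Proof.
split; first by exists (vnorm (A *m 0)); exists 0 => //=; rewrite vnorm0 ler01.
exists (l1norm A) => _ [x /= x1 <-]; apply: le_trans (vnorm_mul_l1norm A x) _.
by rewrite -[leRHS]mulr1 ler_wpM2l ?l1norm_ge0.
Qed.

Lemma opnorm_ge0 p q (A : 'M[C]_(p, q)) : 0 <= opnorm A.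
Proof.
have [_ ub] := opnorm_has_sup A.
by apply: le_trans (ub_le_sup ub (_ : _ (vnorm (A *m 0)))); [exact: vnorm_ge0|exists 0 => //=; rewrite vnorm0 ler01].
Qed.

Lemma opnormP p q (A : 'M[C]_(p, q)) x : vnorm (A *m x) <= opnorm A * vnorm x.
Proof.
have [/eqP x0|x0] := boolP (vnorm x == 0).
  by rewrite x0 mulr0 (vnorm_eq0 x0) mulmx0 vnorm0.
have xp : 0 < vnorm x by rewrite lt_neqAle eq_sym x0 vnorm_ge0.
have [_ ub] := opnorm_has_sup A.
rewrite -ler_pdivrMr//; apply: ub_le_sup ub _ _ => //=.
exists ((vnorm x)^-1%:C%C *: x) => /=.
  by rewrite vnormZ cmodR ger0_norm ?invr_ge0 ?vnorm_ge0// mulVf.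
by rewrite -scalemxAr vnormZ cmodR ger0_norm ?invr_ge0 ?vnorm_ge0// mulrC.
Qed.

Lemma opnorm_le p q (A : 'M[C]_(p, q)) c : 0 <= c ->
  (forall x, vnorm (A *m x) <= c * vnorm x) -> opnorm A <= c.
Proof.
move=> c0 h; have [ne _] := opnorm_has_sup A.
apply: ge_sup ne _ => _ [x /= x1 <-]; apply: le_trans (h x) _.
by rewrite -[leRHS]mulr1 ler_wpM2l.
Qed.

Lemma opnorm_le_l1norm p q (A : 'M[C]_(p, q)) : opnorm A <= l1norm A.
Proof. by apply: opnorm_le; [exact: l1norm_ge0|exact: vnorm_mul_l1norm]. Qed.

Lemma opnormM p q r (A : 'M[C]_(p, q)) (B : 'M[C]_(q, r)) : opnorm (A *m B) <= opnorm A * opnorm B.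
Proof.
apply: opnorm_le => [|x]; first by rewrite mulr_ge0 ?opnorm_ge0.
rewrite -mulmxA; apply: le_trans (opnormP _ _) _.
by rewrite -mulrA ler_wpM2l ?opnorm_ge0// opnormP.
Qed.

Lemma opnormD p q (A B : 'M[C]_(p, q)) : opnorm (A + B) <= opnorm A + opnorm B.
Proof.
apply: opnorm_le => [|x]; first by rewrite addr_ge0 ?opnorm_ge0.
by rewrite mulmxDl (le_trans (vnormD _ _))// mulrDl lerD ?opnormP.
Qed.

Lemma opnormZ_le p q c (A : 'M[C]_(p, q)) : opnorm (c *: A) <= cmod c * opnorm A.
Proof.
apply: opnorm_le => [|x]; first by rewrite mulr_ge0 ?opnorm_ge0 ?cmod_ge0.
by rewrite -scalemxAl vnormZ -mulrA ler_wpM2l ?cmod_ge0 ?opnormP.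
Qed.

Lemma opnorm0 p q : opnorm (0 : 'M[C]_(p, q)) = 0.
Proof.
apply/eqP; rewrite eq_le opnorm_ge0 andbT.
by apply: opnorm_le => // x; rewrite mul0mx vnorm0 mul0r.
Qed.

Lemma opnorm_adj_le p q (A : 'M[C]_(p, q)) : opnorm (A^t* ) <= opnorm A.
Proof.
apply: opnorm_le => [|x]; first exact: opnorm_ge0.
have [/eqP->|x0] := boolP (vnorm (A^t* *m x) == 0); first by rewrite mulr_ge0 ?opnorm_ge0 ?vnorm_ge0.
have xp : 0 < vnorm (A^t* *m x) by rewrite lt_neqAle eq_sym x0 vnorm_ge0.
rewrite -(ler_pM2r xp) -expr2 mulrAC mulrC.
have := vdot_le x (A *m (A^t* *m x)).
rewrite mulmxA (_ : x^t* *m A = (A^t* *m x)^t*); last by rewrite adjM trmxCK.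
rewrite vdot_self cmodR ger0_norm ?sqr_ge0// => /le_trans; apply.
by rewrite ler_wpM2l ?vnorm_ge0 ?opnormP.
Qed.

Lemma opnorm_adj p q (A : 'M[C]_(p, q)) : opnorm (A^t* ) = opnorm A.
Proof. by apply/eqP; rewrite eq_le opnorm_adj_le -{1}(trmxCK A) opnorm_adj_le. Qed.

Lemma mul_delta_col p q (A : 'M[C]_(p, q)) j : A *m delta_mx j 0 = col j A :> 'cV_p.
Proof. by rewrite colE. Qed.

Lemma vnorm_delta p (j : 'I_p) : vnorm (delta_mx j 0 : 'cV[C]_p) = 1.
Proof.
apply/eqP; rewrite -(@eqrXn2 _ 2) ?vnorm_ge0// vnorm_sqr (bigD1 j)//= mxE !eqxx/=.
rewrite big1 ?addr0 => [|i /negbTE ij]; last by rewrite mxE ij cmod0 expr0n.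
by rewrite -(rmorph1 (real_complex R)) cmodR normr1.
Qed.

Lemma vnorm_col_le_opnorm p q (A : 'M[C]_(p, q)) j : vnorm (col j A) <= opnorm A.
Proof. by rewrite -mul_delta_col (le_trans (opnormP _ _))// vnorm_delta mulr1. Qed.

Lemma cmod_le_opnorm p q (A : 'M[C]_(p, q)) i j : cmod (A i j) <= opnorm A.
Proof.
by apply: le_trans (vnorm_col_le_opnorm A j); have := cmod_le_vnorm (col j A) i; rewrite mxE.
Qed.

(** The Gram matrix determines the length of every image vector. *)
Lemma opnorm_isometry p q r (A : 'M[C]_(p, q)) (B : 'M[C]_(r, q)) :
  A^t* *m A = B^t* *m B -> opnorm A <= opnorm B.
Proof.
move=> AB; apply: opnorm_le => [|x]; first exact: opnorm_ge0.
apply: le_trans (opnormP _ _); rewrite -(@ler_pXn2r _ 2) ?nnegrE ?vnorm_ge0// -lecR -!vdot_self.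
by rewrite !adjM -!mulmxA (mulmxA (A^t* )) AB !mulmxA.
Qed.

Lemma opnorm1 n : opnorm (1%:M : 'M[C]_n) <= 1.
Proof. by apply: opnorm_le => // x; rewrite mul1mx mul1r. Qed.

End OperatorNorm.

(** * Singular values and trace duality *)

Section SingularValues.
Context (R : realType).
Local Notation C := (complex R).

Lemma decreasing_perm n (f : 'I_n -> R) :
  exists s : 'S_n, forall i j : 'I_n, (i <= j)%N -> f (s j) <= f (s i).
Proof.
pose r := [rel i j : 'I_n | f j <= f i].
pose t := sort_tuple r (ord_tuple n).
have /tuple_permP[s ts] : perm_eq t (ord_tuple n) by rewrite perm_sort.
exists s => i j ij.
have tn (k : 'I_n) : tnth t k = s k.
  have -> : t = [tuple tnth (ord_tuple n) (s i) | i < n] by apply: val_inj.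
  by rewrite tnth_mktuple tnth_ord_tuple.
rewrite -!tn.
have srt : sorted r t by apply: sort_sorted => a b; exact: le_total.
have rtr : transitive r by move=> a b c /= h1 h2; exact: le_trans h2 h1.
have rrefl : reflexive r by move=> a /=.
rewrite !(tnth_nth i).
by apply: (sorted_leq_nth rtr rrefl i srt) => //; rewrite inE size_tuple ltn_ord.
Qed.

(** The right half of a singular value decomposition: the spectral theorem for the adjoint of [A]
    times [A], with eigenvectors sorted. The columns of [A Y] are orthogonal of lengths [sg]; left
    singular vectors are never completed to a basis. *)
Lemma unitary_gram p q (A : 'M[C]_(p, q)) : exists (Y : 'M[C]_q) (sg : 'I_q -> R),
  [/\ Y^t* *m Y = 1%:M, Y *m Y^t* = 1%:M, forall i, 0 <= sg i,
      forall i j : 'I_q, (i <= j)%N -> sg j <= sg i &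
      (A *m Y)^t* *m (A *m Y) = diag_mx (\row_i ((sg i ^+ 2)%:C%C))].
Proof.
pose H := A^t* *m A.
have Hherm : H \is hermsymmx.
  apply/is_hermitianmxP; rewrite expr0 scale1r /H.
  by rewrite adjM trmxCK.
have /orthomx_spectralP HE := hermitian_normalmx Hherm.
set P := spectralmx H in HE; set d := spectral_diag H in HE.
have Pu : P \is unitarymx by exact: spectral_unitarymx.
have PP : P *m P^t* = 1%:M by apply/unitarymxP.
have PP' : P^t* *m P = 1%:M by exact: mulmx1C.
have gP : (A *m P^t* )^t* *m (A *m P^t* ) = diag_mx d.
  rewrite adjM trmxCK -mulmxA (mulmxA (A^t* )) -/H HE invmx_unitary// -!mulmxA PP mulmx1.
  by rewrite mulmxA PP mul1mx.
(* Reading an eigenvalue as the squared length of a column makes it real and nonnegative and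
   provides its root. *)
have dE i : d 0 i = (vnorm (col i (A *m P^t* )) ^+ 2)%:C%C.
  rewrite -vdot_self -[LHS](_ : diag_mx d i i = _); last by rewrite mxE eqxx mulr1n.
  by rewrite -gP !mxE; apply: eq_bigr => k _; rewrite !mxE.
have [s hs] := decreasing_perm (fun i => vnorm (col i (A *m P^t* ))).
exists (col_perm s (P^t* )), (fun i => vnorm (col (s i) (A *m P^t* ))).
have adj_perm : (perm_mx s^-1%g : 'M[C]_q)^t* = perm_mx s by rewrite tr_perm_mx invgK map_perm_mx.
have permK : perm_mx s *m perm_mx s^-1%g = 1%:M :> 'M[C]_q by rewrite -perm_mxM mulgV perm_mx1.
have permK' : perm_mx s^-1%g *m perm_mx s = 1%:M :> 'M[C]_q by rewrite -perm_mxM mulVg perm_mx1.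
split.
- by rewrite col_permE adjM trmxCK adj_perm -mulmxA (mulmxA P) PP mul1mx.
- by rewrite col_permE adjM trmxCK adj_perm -mulmxA (mulmxA (perm_mx _)) permK' mul1mx.
- by move=> i; exact: vnorm_ge0.
- by [].
have -> : A *m col_perm s (P^t* ) = A *m P^t* *m perm_mx s^-1%g by rewrite col_permE mulmxA.
rewrite adjM -mulmxA (mulmxA ((A *m P^t* )^t* )) gP adj_perm.
apply/matrixP => i j; rewrite mulmxA -col_permE -row_permE !mxE dE.
by rewrite (inj_eq perm_inj).
Qed.

Lemma vnorm_gram p q (A : 'M[C]_(p, q)) (sg : 'I_q -> R) (z : 'cV[C]_q) :
  A^t* *m A = diag_mx (\row_i ((sg i ^+ 2)%:C%C)) ->
  vnorm (A *m z) ^+ 2 = \sum_i sg i ^+ 2 * cmod (z i 0) ^+ 2.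
Proof.
move=> AA; apply: complexI; rewrite -vdot_self adjM -mulmxA (mulmxA (A^t* )) AA vdotE rmorph_sum.
apply: eq_bigr => i _; rewrite mul_diag_mx !mxE mulrCA conj_mul_cmod.
by rewrite -rmorphM.
Qed.

Lemma vnorm_isometry p q (U : 'M[C]_(p, q)) x : U^t* *m U = 1%:M -> vnorm (U *m x) = vnorm x.
Proof.
move=> UU; apply/eqP; rewrite -(@eqrXn2 _ 2) ?vnorm_ge0//; apply/eqP; apply: complexI.
by rewrite -!vdot_self adjM -mulmxA (mulmxA (U^t* )) UU mul1mx.
Qed.

Lemma sing_val_le p q (A B : 'M[C]_(p, q)) j : (\rank B <= j)%N -> sing_val j A <= opnorm (A - B).
Proof.
move=> rB; apply: ge_inf; last by exists B.
by exists 0 => _ [B' _ <-]; exact: opnorm_ge0.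
Qed.

Lemma le_sing_val p q (A : 'M[C]_(p, q)) j c :
  (forall B, (\rank B <= j)%N -> c <= opnorm (A - B)) -> c <= sing_val j A.
Proof.
move=> h; apply: lb_le_inf => [|_ [B /= rB <-]]; last exact: h.
by exists (opnorm (A - 0)); exists 0 => //=; rewrite mxrank0.
Qed.

Lemma sing_val_ge0 p q (A : 'M[C]_(p, q)) j : 0 <= sing_val j A.
Proof. by apply: le_sing_val => B _; exact: opnorm_ge0. Qed.

(* The minimax argument: a matrix of rank at most [j] kills a vector in the span of [j + 1] singular directions. *)
Lemma sing_valE p q (A : 'M[C]_(p, q)) (Y : 'M[C]_q) (sg : 'I_q -> R) (j : 'I_q) :
  Y^t* *m Y = 1%:M -> Y *m Y^t* = 1%:M -> (forall i, 0 <= sg i) ->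
  (forall i j : 'I_q, (i <= j)%N -> sg j <= sg i) ->
  (A *m Y)^t* *m (A *m Y) = diag_mx (\row_i ((sg i ^+ 2)%:C%C)) ->
  sing_val j A = sg j.
Proof.
move=> YY YY' sg0 sgm gram; apply/eqP; rewrite eq_le; apply/andP; split.
  (* The approximant of rank [j] keeps the first [j] singular directions; what remains has gains at
     most [sg j]. *)
  have rk : (\rank (A *m Y *m pid_mx j *m Y^t* ) <= j)%N.
    apply: leq_trans (mxrankM_maxl _ _) _; apply: leq_trans (mxrankM_maxr _ _) _.
    by rewrite rank_pid_mx// ltnW.
  apply: le_trans (sing_val_le A rk) _; apply: opnorm_le => // x.
  set z := Y^t* *m x.
  have xz : vnorm x = vnorm z by rewrite /z vnorm_isometry ?trmxCK.
  have -> : (A - A *m Y *m pid_mx j *m Y^t* ) *m x = A *m Y *m (copid_mx j *m z).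
    by rewrite /z /copid_mx mulmxBl [in RHS]mulmxBl mul1mx mulmxBr !mulmxA -(mulmxA A Y (Y^t* )) YY' mulmx1.
  clearbody z; apply: vnorm_le_sqr => //; rewrite xz (vnorm_gram _ gram) vnorm_sqr mulr_sumr.
  apply: ler_sum => i _; rewrite /copid_mx mulmxBl mul1mx 3!mxE.
  have -> : \sum_k pid_mx j i k * z k 0 = if (i < j)%N then z i 0 else 0 :> C.
    rewrite (bigD1 i)//= big1 ?addr0 => [|k ki].
      by rewrite mxE eqxx; case: ifP => _; rewrite ?mul1r ?mul0r.
    by rewrite mxE (_ : (i == k :> nat) = false) ?mul0r//; apply/negbTE; rewrite eq_sym.
  case: ltnP => ij; first by rewrite subrr cmod0 expr0n mulr0 mulr_ge0 ?sqr_ge0.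
  by rewrite subr0 ler_wpM2r ?sqr_ge0// lerXn2r ?nnegrE ?sg0// sgm.
apply: le_sing_val => B rB.
(* A kernel vector of the stacked matrix is killed by [B Y] and supported on the first [j + 1]
   coordinates. It exists because the rank is at most [j + (q - j - 1)], less than [q]. *)
pose S := col_mx (B *m Y) (copid_mx j.+1 : 'M[C]_q).
have rS : (\rank S < q)%N.
  apply: leq_ltn_trans (_ : \rank (B *m Y) + \rank (copid_mx j.+1 : 'M[C]_q) < q)%N.
    by rewrite /S -addsmxE mxrank_adds_leqif.
  rewrite rank_copid_mx//; apply: (@leq_ltn_trans (j + (q - j.+1))).
    by rewrite leq_add2r (leq_trans (mxrankM_maxl _ _)).
  by rewrite -ltn_subRL; have := ltn_ord j; lia.
have : kermx (S^T) != 0.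
  by rewrite -mxrank_eq0 mxrank_ker mxrank_tr -lt0n subn_gt0.
case/rowV0Pn => v /sub_kermxP vS v0.
pose z := v^T; have zS : S *m z = 0 by rewrite -[LHS]trmxK trmx_mul trmxK vS trmx0.
have vz : v = z^T by rewrite /z trmxK.
clearbody z; have := zS; rewrite mul_col_mx -col_mx0 => /eq_col_mx[Bz Ez].
have z0 (i : 'I_q) : (j < i)%N -> z i 0 = 0.
  move=> ji; have := congr1 (fun M : 'cV_q => M i 0) Ez; rewrite /copid_mx mulmxBl mul1mx 3!mxE.
  have -> : \sum_k pid_mx j.+1 i k * z k 0 = 0 :> C.
    by rewrite big1// => k _; rewrite mxE (ltnNge i) ji andbF mul0r.
  by rewrite subr0 mxE.
have zn : vnorm z != 0.
  by apply: contraNneq v0 => /vnorm_eq0 h; rewrite vz h trmx0.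
have zp : 0 < vnorm z by rewrite lt_neqAle eq_sym zn vnorm_ge0.
rewrite -(ler_pM2r zp); apply: le_trans (_ : vnorm (A *m Y *m z) <= _).
  rewrite -(@ler_pXn2r _ 2) ?nnegrE ?mulr_ge0 ?vnorm_ge0// exprMn (vnorm_gram _ gram).
  rewrite vnorm_sqr mulr_sumr; apply: ler_sum => i _.
  have [ji|ij] := ltnP j i; first by rewrite z0// cmod0 expr0n !mulr0.
  by rewrite ler_wpM2r ?sqr_ge0// lerXn2r ?nnegrE// sgm.
have -> : A *m Y *m z = (A - B) *m (Y *m z) by rewrite mulmxBl !mulmxA Bz subr0.
by rewrite -(vnorm_isometry z YY) opnormP.
Qed.

(** The sum is extended to all columns to match the index set of [Y]; for [j >= p] the matrix is its
    own approximant of rank at most [j]. *)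
Lemma trnorm_sum p q (A : 'M[C]_(p, q)) : trnorm A = \sum_(j < q) sing_val j A.
Proof.
rewrite /trnorm (big_ord_widen q (fun j => sing_val j A)) ?geq_minr// [RHS]big_mkcond [LHS]big_mkcond/=.
apply: eq_bigr => j _; case: ifPn => //; rewrite leq_min ltn_ord andbT -leqNgt => pj.
apply/esym/eqP; rewrite eq_le sing_val_ge0 andbT -(opnorm0 R p q) -(subrr A).
by apply: sing_val_le; rewrite (leq_trans (rank_leq_row A)).
Qed.

Lemma trnorm_ge0 p q (A : 'M[C]_(p, q)) : 0 <= trnorm A.
Proof. by apply: sumr_ge0 => j _; exact: sing_val_ge0. Qed.

(** In the basis [Y], a diagonal entry is the inner product of a unit vector with [B] applied to a
    vector of length [sg i]. *)
Lemma cmod_trace_le p q (A : 'M[C]_(p, q)) (B : 'M[C]_(q, p)) :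
  cmod (\tr (A *m B)) <= trnorm A * opnorm B.
Proof.
have [Y [sg [YY YY' sg0 sgm gram]]] := unitary_gram A.
rewrite trnorm_sum mulr_suml.
have -> : \tr (A *m B) = \tr (Y^t* *m (B *m (A *m Y))).
  by rewrite [RHS]mxtrace_mulC -mulmxA -(mulmxA A) YY' mulmx1 mxtrace_mulC.
apply: le_trans (cmod_sum _ _) _; apply: ler_sum => i _.
rewrite (sing_valE i YY YY' sg0 sgm gram).
have -> : (Y^t* *m (B *m (A *m Y))) i i = ((col i Y)^t* *m (B *m (A *m Y *m (delta_mx i 0 : 'cV[C]_q)))) 0 0.
  rewrite mul_delta_col [LHS]mxE [RHS]mxE; apply: eq_bigr => k _; congr (_ * _).
    by rewrite !mxE.
  by rewrite [LHS]mxE [RHS]mxE; apply: eq_bigr => l _; rewrite [X in _ = _ * X]mxE.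
apply: le_trans (vdot_le _ _) _.
have -> : vnorm (col i Y) = 1 by rewrite -mul_delta_col vnorm_isometry ?vnorm_delta.
rewrite mul1r (le_trans (opnormP _ _))// mulrC ler_wpM2r ?opnorm_ge0//.
rewrite -[leLHS]ger0_norm ?vnorm_ge0// -sqrtr_sqr (vnorm_gram _ gram) (bigD1 i)//= big1 => [|k ki].
  rewrite addr0 mxE !eqxx/= -(rmorph1 (real_complex R)) cmodR normr1 expr1n mulr1 sqrtr_sqr.
  by rewrite ger0_norm.
by rewrite mxE (negbTE ki)/= cmod0 expr0n mulr0.
Qed.

(** With [cmod_trace_le], this exhibits the trace norm as a supremum of linear forms, from which its
    triangle inequality follows. *)
Lemma trnorm_attained p q (A : 'M[C]_(p, q)) :
  exists2 B : 'M[C]_(q, p), opnorm B <= 1 & \tr (A *m B) = (trnorm A)%:C%C.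
Proof.
have [Y [sg [YY YY' sg0 sgm gram]]] := unitary_gram A.
(* [V] is the partial isometry of the polar decomposition, expressed in the basis [Y]; since the
   inverse of 0 is 0, zero singular values give zero columns. *)
pose Dm : 'M[C]_q := diag_mx (\row_i ((sg i)^-1%:C%C)).
pose V := A *m Y *m Dm.
have VV : V^t* *m V = diag_mx (\row_i (((sg i)^-1 * sg i) ^+ 2)%:C%C).
  rewrite /V adjM -mulmxA (mulmxA _ _ Dm) gram /Dm tr_diag_mx map_diag_mx !mulmx_diag.
  congr diag_mx; apply/rowP => i; rewrite !mxE [X in X * _]conj_real -!rmorphM/=; congr (_%:C%C); ring.
have V1 : opnorm V <= 1.
  apply: opnorm_le => // x; apply: vnorm_le_sqr => //.
  have gr : V^t* *m V = diag_mx (\row_i ((((sg i)^-1 * sg i) ^+ 2)%:C%C)) by [].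
  rewrite (vnorm_gram x gr) expr1n mul1r vnorm_sqr; apply: ler_sum => i _.
  rewrite ler_piMl ?sqr_ge0//; have [->|s0] := eqVneq (sg i) 0; first by rewrite mulr0 expr0n.
  by rewrite mulVf ?expr1n.
exists (Y *m V^t* ).
  apply: le_trans (opnormM _ _) _; rewrite opnorm_adj -[leRHS]mulr1 ler_pM ?opnorm_ge0//.
  by apply: opnorm_le => // x; rewrite vnorm_isometry ?mul1r.
rewrite mulmxA mxtrace_mulC /V adjM -mulmxA gram /Dm tr_diag_mx map_diag_mx mulmx_diag mxtrace_diag.
rewrite trnorm_sum rmorph_sum; apply: eq_bigr => i _; rewrite !mxE [X in X * _]conj_real -rmorphM/=.
rewrite (sing_valE i YY YY' sg0 sgm gram); congr (_%:C%C).
by have [->|s0] := eqVneq (sg i) 0; [rewrite expr0n mulr0|rewrite expr2 mulKf].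
Qed.

Lemma trnorm_le p q (A : 'M[C]_(p, q)) c :
  (forall B : 'M[C]_(q, p), opnorm B <= 1 -> complex.Re (\tr (A *m B)) <= c) -> trnorm A <= c.
Proof. by move=> h; have [B B1 E] := trnorm_attained A; have := h B B1; rewrite E. Qed.

Lemma Re_trace_le p q (A : 'M[C]_(p, q)) (B : 'M[C]_(q, p)) : opnorm B <= 1 ->
  complex.Re (\tr (A *m B)) <= trnorm A.
Proof.
move=> B1; apply: le_trans (ler_norm _) _; apply: le_trans (cRe_le_cmod _) _.
by apply: le_trans (cmod_trace_le _ _) _; rewrite ler_piMr ?trnorm_ge0.
Qed.

Lemma trnormD p q (A B : 'M[C]_(p, q)) : trnorm (A + B) <= trnorm A + trnorm B.
Proof.
by apply: trnorm_le => X X1; rewrite mulmxDl linearD cReD lerD ?Re_trace_le.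
Qed.

Lemma trnormZ p q (a : R) (A : 'M[C]_(p, q)) : 0 <= a -> trnorm (a%:C%C *: A) <= a * trnorm A.
Proof.
move=> a0; apply: trnorm_le => X X1; rewrite -scalemxAl linearZ/= cReM/= mul0r subr0.
by rewrite ler_wpM2l ?Re_trace_le.
Qed.

Lemma trnorm_le_l1norm p q (A : 'M[C]_(p, q)) : trnorm A <= l1norm A.
Proof.
apply: trnorm_le => X X1; apply: le_trans (ler_norm _) _; apply: le_trans (cRe_le_cmod _) _.
apply: le_trans (cmod_sum _ _) _; apply: ler_sum => i _; rewrite mxE.
apply: le_trans (cmod_sum _ _) _; apply: ler_sum => j _.
by rewrite cmodM ler_piMr ?cmod_ge0// (le_trans (cmod_le_opnorm _ _ _)).
Qed.

(** The trace of a rank one matrix times [X] is a single inner product. Rank one matrices are the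
    test values used against the operator norm. *)
Lemma trnorm_rank1 p q (x : 'cV[C]_p) (y : 'cV[C]_q) : trnorm (x *m y^t* ) <= vnorm x * vnorm y.
Proof.
apply: trnorm_le => X X1; rewrite mxtrace_mulC mulmxA mxtrace_mulC.
apply: le_trans (ler_norm _) _; apply: le_trans (cRe_le_cmod _) _.
rewrite /mxtrace big_ord1 (le_trans (vdot_le _ _))// mulrC ler_wpM2r ?vnorm_ge0//.
by rewrite (le_trans (opnormP _ _))// ler_piMl ?vnorm_ge0.
Qed.

End SingularValues.

(** * The Hilbert space of square integrable matrix functions *)

Section MatrixL2.
Context (R : realType).
Local Notation mu := (@mT R).
Local Notation D := (@circ_set R).
Local Notation C := (complex R).
Local Notation L1 := (L1 mu D).
Local Notation L2 := (L2 mu D).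
Local Notation Int := (Int mu D).
Local Notation Re := complex.Re.
Local Notation Im := complex.Im.

Definition mmeas p q (X : R -> 'M[C]_(p, q)) := forall i j, cmeas (fun t => X t i j).
Definition mL1 p q (X : R -> 'M[C]_(p, q)) := forall i j, cL1 (fun t => X t i j).
Definition mL2 p q (X : R -> 'M[C]_(p, q)) := forall i j, cL2 (fun t => X t i j).

Lemma mL2_meas p q (X : R -> 'M[C]_(p, q)) : mL2 X -> mmeas X.
Proof. by move=> h i j; exact: cL2_meas. Qed.

Lemma mL2_L1 p q (X : R -> 'M[C]_(p, q)) : mL2 X -> mL1 X.
Proof. by move=> h i j; exact: cL2_L1. Qed.

Lemma mL2_0 p q : mL2 (0 : R -> 'M[C]_(p, q)).
Proof.
by move=> i j; rewrite (_ : (fun t => _) = fun=> 0); [exact: cL2_cst|apply/funext => t; rewrite mxE].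
Qed.

Lemma mL2D p q (X Y : R -> 'M[C]_(p, q)) : mL2 X -> mL2 Y -> mL2 (X + Y).
Proof.
by move=> hX hY i j; under eq_fun do rewrite mxE; exact: cL2D.
Qed.

Lemma mL2Z p q c (X : R -> 'M[C]_(p, q)) : mL2 X -> mL2 (c *: X).
Proof. by move=> hX i j; under eq_fun do rewrite mxE; exact: cL2Z. Qed.

Lemma mL2N p q (X : R -> 'M[C]_(p, q)) : mL2 X -> mL2 (- X).
Proof. by move=> hX i j; under eq_fun do rewrite mxE; exact: cL2N. Qed.

Lemma mL2B p q (X Y : R -> 'M[C]_(p, q)) : mL2 X -> mL2 Y -> mL2 (X - Y).
Proof. by move=> hX hY; apply: mL2D => //; exact: mL2N. Qed.

Lemma mL2_adj p q (X : R -> 'M[C]_(p, q)) : mL2 X -> mL2 (fun t => (X t)^t* ).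
Proof. by move=> hX i j; under eq_fun do rewrite adjE; exact: cL2J. Qed.

Lemma mmeasM p q r (X : R -> 'M[C]_(p, q)) (Y : R -> 'M[C]_(q, r)) :
  mmeas X -> mmeas Y -> mmeas (fun t => X t *m Y t).
Proof. by move=> hX hY i j; under eq_fun do rewrite mxE; apply: cmeas_sum => k; exact: cmeasM. Qed.

Lemma mL2M p q r (X : R -> 'M[C]_(p, q)) (Y : R -> 'M[C]_(q, r)) :
  mL2 X -> mL2 Y -> mL1 (fun t => X t *m Y t).
Proof. by move=> hX hY i j; under eq_fun do rewrite mxE; apply: cL1_sum => k; exact: cL2M. Qed.

Lemma cL1_trace p (X : R -> 'M[C]_p) : mL1 X -> cL1 (fun t => \tr (X t)).
Proof. by move=> hX; apply: cL1_sum => i; exact: hX. Qed.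

(* Defined behind a [Qed] because conversion would otherwise compare integrals by unfolding them. *)
Fact cdot_sig : {f : forall p q, (R -> 'M[C]_(p, q)) -> (R -> 'M[C]_(p, q)) -> C |
  forall p q X Y, f p q X Y = cint (fun t => \tr ((X t)^t* *m Y t))}.
Proof. by eexists => p q X Y; reflexivity. Qed.
Definition cdot p q (X Y : R -> 'M[C]_(p, q)) : C := sval cdot_sig p q X Y.
Lemma cdotE p q (X Y : R -> 'M[C]_(p, q)) : cdot X Y = cint (fun t => \tr ((X t)^t* *m Y t)).
Proof. exact: (svalP cdot_sig). Qed.
Definition nrm2 p q (X : R -> 'M[C]_(p, q)) : R := Re (cdot X X).

Definition frob2 p q (A : 'M[C]_(p, q)) : R := \sum_i \sum_j cmod (A i j) ^+ 2.

Lemma trace_adj_mul p q (A B : 'M[C]_(p, q)) :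
  \tr (A^t* *m B) = \sum_i \sum_j Num.conj (A i j) * B i j.
Proof.
rewrite exchange_big; apply: eq_bigr => j _; rewrite mxE; apply: eq_bigr => i _.
by rewrite adjE.
Qed.

Lemma trace_adj_self p q (A : 'M[C]_(p, q)) : \tr (A^t* *m A) = (frob2 A)%:C%C.
Proof.
rewrite trace_adj_mul rmorph_sum; apply: eq_bigr => i _; rewrite rmorph_sum.
by apply: eq_bigr => j _; exact: conj_mul_cmod.
Qed.

Lemma frob2_ge0 p q (A : 'M[C]_(p, q)) : 0 <= frob2 A.
Proof. by apply: sumr_ge0 => i _; apply: sumr_ge0 => j _; exact: sqr_ge0. Qed.

Lemma cL1_dot p q (X Y : R -> 'M[C]_(p, q)) : mL2 X -> mL2 Y ->
  cL1 (fun t => \tr ((X t)^t* *m Y t)).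
Proof. by move=> hX hY; apply: cL1_trace; apply: mL2M => //; exact: mL2_adj. Qed.

Lemma cdotDr p q (X Y Z : R -> 'M[C]_(p, q)) : mL2 X -> mL2 Y -> mL2 Z ->
  cdot X (Y + Z) = cdot X Y + cdot X Z.
Proof.
move=> hX hY hZ; rewrite !cdotE -cintD; [|exact: cL1_dot..].
by congr cint; apply/funext => t; rewrite mulmxDr linearD.
Qed.

Lemma cdotZr p q (X Y : R -> 'M[C]_(p, q)) c : mL2 X -> mL2 Y ->
  cdot X (c *: Y) = c * cdot X Y.
Proof.
move=> hX hY; rewrite !cdotE -cintZ; last exact: cL1_dot.
by congr cint; apply/funext => t; rewrite -scalemxAr linearZ.
Qed.

Lemma cdot_conj p q (X Y : R -> 'M[C]_(p, q)) : mL2 X -> mL2 Y ->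
  Num.conj (cdot X Y) = cdot Y X.
Proof.
move=> hX hY; rewrite !cdotE -cintJ; last exact: cL1_dot.
congr cint; apply/funext => t; rewrite !trace_adj_mul !rmorph_sum; apply: eq_bigr => i _.
by rewrite rmorph_sum; apply: eq_bigr => j _; rewrite rmorphM /= conjCK mulrC.
Qed.

Lemma cdotBr p q (X Y Z : R -> 'M[C]_(p, q)) : mL2 X -> mL2 Y -> mL2 Z ->
  cdot X (Y - Z) = cdot X Y - cdot X Z.
Proof.
by move=> hX hY hZ; rewrite -scaleN1r cdotDr ?cdotZr ?mulN1r//; exact: mL2Z.
Qed.

Lemma cdotDl p q (X Y Z : R -> 'M[C]_(p, q)) : mL2 X -> mL2 Y -> mL2 Z ->
  cdot (Y + Z) X = cdot Y X + cdot Z X.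
Proof.
move=> hX hY hZ; have hYZ := mL2D hY hZ.
by rewrite -(cdot_conj hX hYZ) cdotDr// rmorphD/= !cdot_conj.
Qed.

Lemma cdotBl p q (X Y Z : R -> 'M[C]_(p, q)) : mL2 X -> mL2 Y -> mL2 Z ->
  cdot (Y - Z) X = cdot Y X - cdot Z X.
Proof.
move=> hX hY hZ; have hYZ := mL2B hY hZ.
by rewrite -(cdot_conj hX hYZ) cdotBr// rmorphB/= !cdot_conj.
Qed.

Lemma cdotZl p q (X Y : R -> 'M[C]_(p, q)) c : mL2 X -> mL2 Y ->
  cdot (c *: X) Y = Num.conj c * cdot X Y.
Proof.
move=> hX hY; have cX := mL2Z c hX.
by rewrite -(cdot_conj hY cX) cdotZr// rmorphM/= cdot_conj.
Qed.

Lemma nrm2E p q (X : R -> 'M[C]_(p, q)) : nrm2 X = Int (fun t => frob2 (X t)).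
Proof.
by rewrite /nrm2 cdotE cRe_cint; apply: eq_Rintegral => t _; rewrite trace_adj_self.
Qed.

Lemma L1_frob2 p q (X : R -> 'M[C]_(p, q)) : mL2 X -> L1 (fun t => frob2 (X t)).
Proof.
move=> hX; have [+ _] := cL1_dot hX hX.
by under eq_fun do rewrite trace_adj_self.
Qed.

Lemma nrm2_ge0 p q (X : R -> 'M[C]_(p, q)) : 0 <= nrm2 X.
Proof. by rewrite nrm2E Int_ge0// => t _; exact: frob2_ge0. Qed.

Lemma nrm2D p q (X Y : R -> 'M[C]_(p, q)) : mL2 X -> mL2 Y ->
  nrm2 (X + Y) = nrm2 X + 2 * Re (cdot X Y) + nrm2 Y.
Proof.
move=> hX hY; have hXY := mL2D hX hY.
rewrite /nrm2 (cdotDr hXY hX hY) (cdotDl hX hX hY) (cdotDl hY hX hY) !cReD.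
rewrite -(cdot_conj hX hY) cReJ.
by move: (Re (cdot X X)) (Re (cdot X Y)) (Re (cdot Y Y)) => a b c; ring.
Qed.

Lemma nrm2Z p q (X : R -> 'M[C]_(p, q)) c : mL2 X -> nrm2 (c *: X) = cmod c ^+ 2 * nrm2 X.
Proof.
move=> hX; have cX := mL2Z c hX.
by rewrite /nrm2 cdotZr// cdotZl// mulrA (mulrC c) conj_mul_cmod cReM/= mul0r subr0.
Qed.

Lemma nrm2N p q (X : R -> 'M[C]_(p, q)) : nrm2 (- X) = nrm2 X.
Proof.
rewrite !nrm2E; apply: eq_Rintegral => t _; apply: eq_bigr => i _; apply: eq_bigr => j _.
by rewrite mxE cmodN.
Qed.

Lemma nrm2_0 p q : nrm2 (0 : R -> 'M[C]_(p, q)) = 0.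
Proof.
rewrite nrm2E -[RHS](@Int0 _ _ _ mu D _); apply: eq_Rintegral => t _; rewrite /frob2 big1// => i _.
by rewrite big1// => j _; rewrite mxE cmod0 expr0n.
Qed.

Lemma Re_cdot_sqr_le p q (X Y : R -> 'M[C]_(p, q)) : mL2 X -> mL2 Y ->
  Re (cdot X Y) ^+ 2 <= nrm2 X * nrm2 Y.
Proof.
move=> hX hY; apply: discr_le => [||s]; [exact: nrm2_ge0..|].
have sY := mL2Z (s%:C%C) hY.
have := nrm2_ge0 (X + s%:C%C *: Y).
rewrite nrm2D// nrm2Z// cdotZr// cReM/= mul0r subr0 cmodR real_normK ?num_real//.
by rewrite mulrA.
Qed.

Lemma cmod_cdot_sqr_le p q (X Y : R -> 'M[C]_(p, q)) : mL2 X -> mL2 Y ->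
  cmod (cdot X Y) ^+ 2 <= nrm2 X * nrm2 Y.
Proof.
move=> hX hY; have [u u1 uE] := phase (cdot X Y).
have uY := mL2Z u hY.
have := Re_cdot_sqr_le hX uY.
by rewrite cdotZr// uE/= nrm2Z// u1 expr1n mul1r.
Qed.

Definition nrm p q (X : R -> 'M[C]_(p, q)) : R := Num.sqrt (nrm2 X).

Lemma nrm_ge0 p q (X : R -> 'M[C]_(p, q)) : 0 <= nrm X. Proof. exact: sqrtr_ge0. Qed.

Lemma nrm_sqr p q (X : R -> 'M[C]_(p, q)) : nrm X ^+ 2 = nrm2 X.
Proof. by rewrite sqr_sqrtr// nrm2_ge0. Qed.

Lemma nrmN p q (X : R -> 'M[C]_(p, q)) : nrm (- X) = nrm X.
Proof. by rewrite /nrm nrm2N. Qed.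

Lemma nrmBC p q (X Y : R -> 'M[C]_(p, q)) : nrm (X - Y) = nrm (Y - X).
Proof. by rewrite -nrmN opprB. Qed.

Lemma nrmZ p q (X : R -> 'M[C]_(p, q)) c : mL2 X -> nrm (c *: X) = cmod c * nrm X.
Proof.
by move=> hX; rewrite /nrm nrm2Z// sqrtrM ?sqr_ge0// sqrtr_sqr ger0_norm ?cmod_ge0.
Qed.

Lemma cmod_cdot_le p q (X Y : R -> 'M[C]_(p, q)) : mL2 X -> mL2 Y ->
  cmod (cdot X Y) <= nrm X * nrm Y.
Proof.
move=> hX hY; rewrite -(@ler_pXn2r _ 2) ?nnegrE ?cmod_ge0 ?mulr_ge0 ?nrm_ge0//.
by rewrite exprMn !nrm_sqr cmod_cdot_sqr_le.
Qed.

Lemma nrmD p q (X Y : R -> 'M[C]_(p, q)) : mL2 X -> mL2 Y -> nrm (X + Y) <= nrm X + nrm Y.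
Proof.
move=> hX hY; rewrite -(@ler_pXn2r _ 2) ?nnegrE ?addr_ge0 ?nrm_ge0//.
rewrite nrm_sqr nrm2D// -!nrm_sqr.
have := cmod_cdot_le hX hY; have := cRe_le_cmod (cdot X Y); have := ler_norm (Re (cdot X Y)).
lra.
Qed.

Lemma nrm_le_tri p q (X Y Z : R -> 'M[C]_(p, q)) : mL2 X -> mL2 Y -> mL2 Z ->
  nrm (X - Z) <= nrm (X - Y) + nrm (Y - Z).
Proof.
move=> hX hY hZ; rewrite -[X - Z](subrKA Y); apply: nrmD; exact: mL2B.
Qed.

Lemma Int_cmod_sqr_le_nrm2 p q (X : R -> 'M[C]_(p, q)) i j : mL2 X ->
  Int (fun t => cmod (X t i j) ^+ 2) <= nrm2 X.
Proof.
move=> hX; rewrite nrm2E; apply: Int_le.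
- by have [] := cL2_cmod (hX i j).
- exact: L1_frob2.
move=> t _; rewrite /frob2 (bigD1 i)//= (bigD1 j)//= -addrA lerDl addr_ge0//.
  by apply: sumr_ge0 => k _; exact: sqr_ge0.
by apply: sumr_ge0 => k _; apply: sumr_ge0 => l _; exact: sqr_ge0.
Qed.

Lemma cL2_complete (u : nat -> R -> C) : (forall n, cL2 (u n)) ->
  (forall e, 0 < e -> exists N, forall n m, (N <= n)%N -> (N <= m)%N ->
     Int (fun t => cmod (u n t - u m t) ^+ 2) <= e) ->
  exists2 f, cL2 f & forall e, 0 < e -> exists N, forall n, (N <= n)%N ->
     Int (fun t => cmod (u n t - f t) ^+ 2) <= e.
Proof.
move=> u2 cau.
have dL1 n m : L1 (fun t => cmod (u n t - u m t) ^+ 2).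
  by have [_] := cL2_cmod (cL2B (u2 n) (u2 m)).
have [f f2 fl] : exists2 f, L2 f & forall e, 0 < e -> exists N, forall n, (N <= n)%N ->
     Int (fun t => (Re (u n t) - f t) ^+ 2) <= e.
  apply: L2_complete => [n|e /cau[N hN]]; first by case: (u2 n).
  exists N => n m Nn Nm; apply: le_trans (hN n m Nn Nm); apply: Int_le => //.
    by have [_] := L2B (u2 n).1 (u2 m).1.
  by move=> t _; rewrite cmod_sqr cReB lerDl sqr_ge0.
have [g g2 gl] : exists2 f, L2 f & forall e, 0 < e -> exists N, forall n, (N <= n)%N ->
     Int (fun t => (Im (u n t) - f t) ^+ 2) <= e.
  apply: L2_complete => [n|e /cau[N hN]]; first by case: (u2 n).
  exists N => n m Nn Nm; apply: le_trans (hN n m Nn Nm); apply: Int_le => //.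
    by have [_] := L2B (u2 n).2 (u2 m).2.
  by move=> t _; rewrite cmod_sqr cImB lerDr sqr_ge0.
exists (fun t => Complex (f t) (g t)); first by split.
move=> e e0; have e20 : 0 < e / 2 by rewrite divr_gt0.
have [N1 h1] := fl _ e20; have [N2 h2] := gl _ e20.
exists (maxn N1 N2) => n; rewrite geq_max => /andP[n1 n2].
have -> : Int (fun t => cmod (u n t - Complex (f t) (g t)) ^+ 2) =
    Int (fun t => (Re (u n t) - f t) ^+ 2) + Int (fun t => (Im (u n t) - g t) ^+ 2).
  rewrite -IntD; [|by have [_] := L2B (u2 n).1 f2|by have [_] := L2B (u2 n).2 g2].
  by apply: eq_Rintegral => t _; rewrite cmod_sqr cReB cImB.
by rewrite [leRHS](splitr e) lerD ?h1 ?h2.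
Qed.

Theorem mL2_complete p q (X : nat -> R -> 'M[C]_(p, q)) : (forall n, mL2 (X n)) ->
  (forall e, 0 < e -> exists N, forall n m, (N <= n)%N -> (N <= m)%N -> nrm2 (X n - X m) <= e) ->
  exists2 P, mL2 P & forall e, 0 < e -> exists N, forall n, (N <= n)%N -> nrm2 (X n - P) <= e.
Proof.
move=> X2 cau.
have hc i j e : 0 < e -> exists N, forall n m, (N <= n)%N -> (N <= m)%N ->
    Int (fun t => cmod (X n t i j - X m t i j) ^+ 2) <= e.
  move=> /cau[N hN]; exists N => n m Nn Nm; apply: le_trans (hN n m Nn Nm).
  apply: le_trans (Int_cmod_sqr_le_nrm2 i j (mL2B (X2 n) (X2 m))).
  by rewrite le_eqVlt; apply/orP; left; apply/eqP/eq_Rintegral => t _; rewrite !mxE.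
have h i j := cid2 (@cL2_complete (fun n t => X n t i j) (fun n => X2 n i j) (hc i j)).
pose P t := \matrix_(i, j) (s2val (h i j) t).
have P2 : mL2 P by move=> i j; under eq_fun do rewrite mxE; exact: (s2valP (h i j)).
exists P => // e e0.
(* The error is shared among the [p q] entries; the successor avoids division by zero for empty
   matrices. *)
pose K : R := (p * q).+1%:R.
have K0 : 0 < K by rewrite ltr0n.
have /choice[N hN] : forall ij : 'I_p * 'I_q, exists N, forall n, (N <= n)%N ->
    Int (fun t => cmod (X n t ij.1 ij.2 - P t ij.1 ij.2) ^+ 2) <= e / K.
  move=> [i j] /=; have [N hN] := s2valP' (h i j) (e / K) (divr_gt0 e0 K0).
  exists N => n /hN; apply: le_trans; rewrite le_eqVlt; apply/orP; left; apply/eqP/eq_Rintegral => t _; by rewrite mxE.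
exists (\max_ij N ij) => n nN.
have cL1ij i j : L1 (fun t => cmod ((X n - P) t i j) ^+ 2).
  by have [_] := cL2_cmod (mL2B (X2 n) P2 i j).
have -> : nrm2 (X n - P) = \sum_i \sum_j Int (fun t => cmod ((X n - P) t i j) ^+ 2).
  rewrite nrm2E /frob2 Int_sum => [|i]; last exact: L1_sum.
  by apply: eq_bigr => i _; rewrite Int_sum.
apply: (@le_trans _ _ (\sum_(i < p) \sum_(j < q) e / K)).
  apply: ler_sum => i _; apply: ler_sum => j _; apply: le_trans (hN (i, j) n _); last first.
    by apply: leq_trans nN; exact: (leq_bigmax (i, j)).
  by rewrite le_eqVlt; apply/orP; left; apply/eqP/eq_Rintegral => t _; rewrite !mxE.
rewrite !sumr_const !card_ord -mulrnA -mulr_natr -mulrA ler_piMr ?(ltW e0)//.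
rewrite [leLHS]mulrC ler_pdivrMr// mul1r ler_nat; lia.
Qed.

End MatrixL2.

(** * Projections on convex sets and closed spans *)

Section Projection.
Context (R : realType) (p q : nat).
Local Notation C := (complex R).
Local Notation V := (R -> 'M[C]_(p, q)).
Local Notation Re := complex.Re.
Implicit Types (X Y Z : V) (K G : V -> Prop).

(** Membership in [L^2] is required of [X] because [nrm] is meaningful only there. *)
Definition closure2 K X := mL2 X /\ forall e, 0 < e -> exists2 Y, K Y & nrm (X - Y) <= e.

Lemma closure2_sub K X : mL2 X -> K X -> closure2 K X.
Proof. by move=> hX KX; split=> // e e0; exists X => //; rewrite subrr /nrm nrm2_0 sqrtr0 ltW. Qed.

Lemma cdot_closure2_0 K X Y : (forall Z, K Z -> mL2 Z) -> mL2 X -> closure2 K Y ->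
  (forall Z, K Z -> cdot X Z = 0) -> cdot X Y = 0.
Proof.
move=> K2 hX [hY Ycl] X0; apply: cmod_eq0; apply/eqP; rewrite eq_le cmod_ge0 andbT.
apply/ler_addgt0Pr => e e0; rewrite add0r.
(* Adding 1 makes the divisor positive even when [X] has norm zero. *)
have n0 : 0 < nrm X + 1 by rewrite ltr_wpDl ?nrm_ge0.
have [Z KZ YZ] := Ycl _ (divr_gt0 e0 n0); have hZ := K2 _ KZ.
have -> : cdot X Y = cdot X (Y - Z) by rewrite cdotBr// (X0 Z)// subr0.
apply: le_trans (cmod_cdot_le hX (mL2B hY hZ)) _.
apply: (@le_trans _ _ ((nrm X + 1) * (e / (nrm X + 1)))).
  by rewrite ler_pM ?nrm_ge0// lerDl.
by rewrite mulrC divfK// gt_eqF.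
Qed.

Lemma inv_nat_lt (e : R) : 0 < e -> exists N, forall n, (N <= n)%N -> (n.+1%:R : R)^-1 < e.
Proof. by move=> e0; have [N _ hN] := near_infty_natSinv_lt (PosNum e0); exists N => n; exact: hN. Qed.

(** A minimizing sequence is Cauchy by the parallelogram identity. As [K] need not be closed, the
    minimizer lies in its closure, and the variational inequality comes from moving slightly towards
    [Y]. *)
Theorem convex_projection K X : (forall Y, K Y -> mL2 Y) -> (exists Y, K Y) ->
  (forall Y Z (s : R), K Y -> K Z -> 0 <= s <= 1 -> K (s%:C%C *: Y + (1 - s)%:C%C *: Z)) ->
  mL2 X -> exists2 P, closure2 K P & forall Y, K Y -> Re (cdot (X - P) (Y - P)) <= 0.
Proof.
move=> K2 [Y0 KY0] Kc hX.
pose d := inf [set nrm2 (X - Y) | Y in K].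
have dinf : has_inf [set nrm2 (X - Y) | Y in K].
  split; first by exists (nrm2 (X - Y0)); exists Y0.
  by exists 0 => _ [Y _ <-]; exact: nrm2_ge0.
have dle Y : K Y -> d <= nrm2 (X - Y) by move=> KY; apply: ge_inf; [case: dinf|exists Y].
have d0 : 0 <= d by apply: lb_le_inf; [case: dinf|move=> _ [Y _ <-]; exact: nrm2_ge0].
have n0 (n : nat) : 0 < (n.+1%:R : R)^-1 by rewrite invr_gt0 ltr0n.
have /choice[Y hY] : forall n : nat, exists Y, K Y /\ nrm2 (X - Y) < d + n.+1%:R^-1.
  move=> n; have [_ [Y KY <-] h] := inf_adherent (n0 n) dinf; by exists Y.
have KY n : K (Y n) by case: (hY n).
have Y2 n : mL2 (Y n) by exact: K2.
have XY2 n : mL2 (X - Y n) by exact: mL2B.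
have cau e : 0 < e -> exists N, forall n m, (N <= n)%N -> (N <= m)%N -> nrm2 (Y n - Y m) <= e.
  move=> e0; have e4 : 0 < e / 4 by rewrite divr_gt0.
  have [N hN] := inv_nat_lt e4; exists N => n m Nn Nm.
  have hn := hN n Nn; have hm := hN m Nm.
  (* The midpoint competes for [d]; the parallelogram identity then bounds the gap by [2 (u + v)],
     where [u] and [v] are at most [e / 4]. *)
  have /dle : K ((2^-1)%:C%C *: Y n + (1 - 2^-1)%:C%C *: Y m).
    by apply: Kc => //; rewrite invr_ge0 ler0n/= invf_le1// ler1n.
  set M := X - _ => dM.
  have -> : Y n - Y m = (X - Y m) - (X - Y n) by rewrite opprB [RHS]addrC addrA subrK.
  have EM : M = (2^-1)%:C%C *: ((X - Y m) + (X - Y n)).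
    have h2 : (1 - 2^-1 : R) = 2^-1 by field.
    have hh : (2^-1 : R)%:C%C + (2^-1 : R)%:C%C = 1 by rewrite -rmorphD/= -(rmorph1 (real_complex R)); congr (_%:C%C); field.
    have XE : X = (2^-1)%:C%C *: (X + X) by rewrite scalerDr -scalerDl hh scale1r.
    have ME : M = X - (2^-1)%:C%C *: (Y n + Y m) by rewrite /M h2 scalerDr.
    by rewrite ME {1}XE -scalerBr addrACA -opprD (addrC (Y m)).
  move: dM; rewrite EM nrm2Z; last exact: mL2D.
  rewrite (nrm2D (XY2 m) (XY2 n)) (nrm2D (XY2 m) (mL2N (XY2 n))) nrm2N.
  rewrite (_ : cdot _ (- _) = - cdot (X - Y m) (X - Y n)); last first.
    by rewrite -(scaleN1r (X - Y n)) cdotZr// mulN1r.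
  rewrite cReN cmodR ger0_norm ?invr_ge0//.
  have [_ a] := hY n; have [_ b] := hY m.
  have -> : (2^-1 : R) ^+ 2 = 4^-1 by field.
  move: a b hm hn; set u := n.+1%:R^-1; set v := m.+1%:R^-1.
  set x := nrm2 _; set y := nrm2 _; set z := Re _.
  lra.
have [P P2 PY] := mL2_complete Y2 cau.
have clP : closure2 K P.
  split=> // e e0; have [N /(_ N (leqnn N)) h] := PY _ (exprn_gt0 2 e0).
  exists (Y N) => //; rewrite nrmBC -(@ler_pXn2r _ 2) ?nnegrE ?nrm_ge0 ?(ltW e0)//.
  by rewrite nrm_sqr.
exists P => //.
(* The lower bound [d] persists on the closure, which contains [P] and the segments from [P] to
   points of [K]. *)
have dcl Z : closure2 K Z -> d <= nrm2 (X - Z).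
  move=> [hZ Zcl]; rewrite -nrm_sqr -[leLHS]sqr_sqrtr//.
  rewrite ler_pXn2r ?nnegrE ?sqrtr_ge0 ?nrm_ge0//; apply/ler_addgt0Pr => e /Zcl[W KW ZW].
  have W2 := K2 _ KW.
  apply: le_trans (lerD (lexx _) ZW); apply: le_trans (nrm_le_tri hX hZ W2).
  by apply: ler_wsqrtr; exact: dle.
have dP : nrm2 (X - P) <= d.
  rewrite -nrm_sqr -[leRHS]sqr_sqrtr// ler_pXn2r ?nnegrE ?sqrtr_ge0 ?nrm_ge0//.
  apply/ler_addgt0Pr => e e0; have e20 : 0 < e / 2 by rewrite divr_gt0.
  have [N hN] := PY _ (exprn_gt0 2 e20).
  have [M hM] := inv_nat_lt (exprn_gt0 2 e20).
  pose n := maxn N M; have nM := hM n (leq_maxr _ _).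
  have nN := hN n (leq_maxl _ _).
  apply: le_trans (nrm_le_tri hX (Y2 n) P2) _; rewrite [in leRHS](splitr e) addrA; apply: lerD.
    rewrite -[leRHS]ger0_norm ?addr_ge0 ?sqrtr_ge0 ?(ltW e20)// -sqrtr_sqr; apply: ler_wsqrtr.
    have [_ /ltW h] := hY n; apply: le_trans h _; rewrite sqrrD sqr_sqrtr//.
    have : 0 <= Num.sqrt d * (e / 2) by rewrite mulr_ge0 ?sqrtr_ge0 ?ltW.
    rewrite mulr2n; move: nM.
    by move: (n.+1%:R^-1) ((e / 2) ^+ 2) (Num.sqrt d * (e / 2)) => u w z; lra.
  by rewrite -(@ler_pXn2r _ 2) ?nnegrE ?nrm_ge0 ?(ltW e20)// nrm_sqr.
move=> Z KZ; have Z2 := K2 _ KZ; have ZP2 := mL2B Z2 P2; have XP2 := mL2B hX P2.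
have conv (s : R) : 0 <= s <= 1 -> closure2 K (s%:C%C *: Z + (1 - s)%:C%C *: P).
  move=> /andP[s0 s1]; split; first by apply: mL2D; exact: mL2Z.
  move=> e e0; have [_ /(_ e e0)[W KW PW]] := clP; have W2 := K2 _ KW.
  exists (s%:C%C *: Z + (1 - s)%:C%C *: W); first by apply: Kc => //; rewrite s0.
  rewrite opprD addrACA subrr add0r -scalerBr nrmZ; last exact: mL2B.
  rewrite cmodR ger0_norm ?subr_ge0// (le_trans _ PW)// ler_piMl ?nrm_ge0//.
  by rewrite lerBlDr lerDl.
rewrite leNgt; apply/negP => a0; set a := Re _ in a0.
have nZ := nrm2_ge0 (Z - P).
(* For this step the first order gain [2 s a] exceeds the second order loss [s^2 nrm2 (Z - P)],
   which contradicts the minimality of [P]. *)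
pose s := Num.min 1 (a / (nrm2 (Z - P) + 1)).
have n1 : 0 < nrm2 (Z - P) + 1 by rewrite ltr_wpDl.
have s0 : 0 < s by rewrite lt_min ltr01 divr_gt0.
have s1 : s <= 1 by rewrite ge_min lexx.
have /conv/dcl h : 0 <= s <= 1 by rewrite (ltW s0).
have := le_trans dP h.
have -> : X - (s%:C%C *: Z + (1 - s)%:C%C *: P) = (X - P) + (- s)%:C%C *: (Z - P).
  rewrite rmorphB rmorph1 rmorphN scalerBl scale1r scaleNr scalerBr.
  rewrite opprD !opprB -[RHS]addrA; congr (_ + _).
  by rewrite addrA (addrC (- _)) [RHS]addrC.
rewrite (nrm2D XP2 (mL2Z _ ZP2)) (nrm2Z _ ZP2) cdotZr// cReM/= mul0r subr0 -/a cmodR normrN ger0_norm ?(ltW s0)//.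
have : s * (nrm2 (Z - P) + 1) <= a by rewrite -ler_pdivlMr// ge_min lexx orbT.
nra.
Qed.

Inductive span G : V -> Prop :=
| span0 : span G 0
| spanD c X Y : G X -> span G Y -> span G (c *: X + Y).

Lemma span_add G X Y : span G X -> span G Y -> span G (X + Y).
Proof.
by move=> sX sY; elim: sX => [|c Z W GZ _ ih]; rewrite ?add0r// -addrA; exact: spanD.
Qed.

Lemma span_scale G c X : span G X -> span G (c *: X).
Proof.
elim=> [|a Z W GZ _ ih]; first by rewrite scaler0; exact: span0.
by rewrite scalerDr scalerA; exact: spanD.
Qed.

Lemma span_gen G X : G X -> span G X.
Proof. by move=> GX; rewrite -[X]addr0 -[X]scale1r; apply: spanD => //; exact: span0. Qed.

Lemma span_mL2 G X : (forall Y, G Y -> mL2 Y) -> span G X -> mL2 X.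
Proof.
move=> G2; elim=> [|c Z W GZ _ ih]; first exact: mL2_0.
by apply: mL2D => //; apply: mL2Z; exact: G2.
Qed.

Lemma span_cdot0 G X Y : (forall Z, G Z -> mL2 Z) -> mL2 X ->
  (forall Z, G Z -> cdot X Z = 0) -> span G Y -> cdot X Y = 0.
Proof.
move=> G2 hX h; elim=> [|c Z W GZ sW ih].
  by rewrite -(scale0r (0 : V)) cdotZr ?mul0r//; exact: mL2_0.
rewrite cdotDr//; [|by apply: mL2Z; exact: G2|exact: span_mL2 sW].
by rewrite cdotZr ?(h _ GZ) ?ih ?mulr0 ?addr0//; exact: G2.
Qed.

Lemma closure2_span_cdot0 G X Y : (forall Z, G Z -> mL2 Z) -> mL2 X ->
  (forall Z, G Z -> cdot X Z = 0) -> closure2 (span G) Y -> cdot X Y = 0.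
Proof.
move=> G2 hX h; move/cdot_closure2_0; apply => // Z; first exact: span_mL2.
exact: span_cdot0.
Qed.

Lemma closure2_spanD G X Y : (forall Z, G Z -> mL2 Z) ->
  closure2 (span G) X -> closure2 (span G) Y -> closure2 (span G) (X + Y).
Proof.
move=> G2 [hX Xc] [hY Yc]; split; first exact: mL2D.
move=> e e0; have e2 : 0 < e / 2 by rewrite divr_gt0.
have [Z sZ hZ] := Xc _ e2; have [W sW hW] := Yc _ e2.
exists (Z + W); first exact: span_add.
have Z2 := span_mL2 G2 sZ; have W2 := span_mL2 G2 sW.
rewrite opprD addrACA (le_trans (nrmD _ _))//; [exact: mL2B..|].
by rewrite [leRHS](splitr e) lerD.
Qed.

Lemma closure2_spanZ G c X : (forall Z, G Z -> mL2 Z) ->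
  closure2 (span G) X -> closure2 (span G) (c *: X).
Proof.
move=> G2 [hX Xc]; split; first exact: mL2Z.
move=> e e0; have c1 : 0 < cmod c + 1 by rewrite ltr_wpDl ?cmod_ge0.
have [Z sZ hZ] := Xc _ (divr_gt0 e0 c1); exists (c *: Z); first exact: span_scale.
have Z2 := span_mL2 G2 sZ.
rewrite -scalerBr nrmZ; last exact: mL2B.
apply: (@le_trans _ _ ((cmod c + 1) * (e / (cmod c + 1)))).
  by rewrite ler_pM ?nrm_ge0 ?cmod_ge0// lerDl.
by rewrite mulrC divfK// gt_eqF.
Qed.

Lemma closure2_spanB G X Y : (forall Z, G Z -> mL2 Z) ->
  closure2 (span G) X -> closure2 (span G) Y -> closure2 (span G) (X - Y).
Proof.
by move=> G2 hX hY; rewrite -scaleN1r; apply: closure2_spanD => //; exact: closure2_spanZ.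
Qed.

(** For a linear span, the variational inequality tested at [Y + Z], with [Z] in the span close to
    [P], makes the real part of the pairing with [Y] nonpositive; a rotation of [Y] then annihilates
    the pairing. *)
Theorem span_projection G X : (forall Z, G Z -> mL2 Z) -> mL2 X ->
  exists2 P, closure2 (span G) P & forall Y, G Y -> cdot (X - P) Y = 0.
Proof.
move=> G2 hX; have S2 Z : span G Z -> mL2 Z by exact: span_mL2.
have [P clP hP] : exists2 P, closure2 (span G) P &
    forall Y, span G Y -> Re (cdot (X - P) (Y - P)) <= 0.
  apply: convex_projection => //; first by exists 0; exact: span0.
  by move=> Y Z s sY sZ _; apply: span_add; exact: span_scale.
exists P => //; have [P2 Pc] := clP; have XP2 := mL2B hX P2.
have re0 Y : span G Y -> Re (cdot (X - P) Y) <= 0.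
  move=> sY; have Y2 := S2 _ sY; apply/ler_addgt0Pr => e e0; rewrite add0r.
  have n1 : 0 < nrm (X - P) + 1 by rewrite ltr_wpDl ?nrm_ge0.
  have [Z sZ PZ] := Pc _ (divr_gt0 e0 n1); have Z2 := S2 _ sZ.
  have := hP _ (span_add sY sZ); rewrite -addrA cdotDr//; last exact: mL2B.
  rewrite cReD => h.
  have : - Re (cdot (X - P) (Z - P)) <= e; last lra.
  rewrite -cReN (_ : - cdot _ _ = cdot (X - P) (P - Z)); last first.
    by rewrite -(opprB Z P) -(scaleN1r (Z - P)) cdotZr ?mulN1r//; exact: mL2B.
  rewrite (le_trans (ler_norm _))// (le_trans (cRe_le_cmod _))//.
  apply: le_trans (cmod_cdot_le XP2 (mL2B P2 Z2)) _.
  apply: (@le_trans _ _ ((nrm (X - P) + 1) * (e / (nrm (X - P) + 1)))).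
    by rewrite ler_pM ?nrm_ge0// lerDl.
  by rewrite mulrC divfK// gt_eqF.
move=> Y GY; have sY := span_gen GY; have Y2 := G2 _ GY.
have [u u1 uE] := phase (cdot (X - P) Y).
apply: cmod_eq0; apply/eqP; rewrite eq_le cmod_ge0 andbT.
by have := re0 _ (span_scale u sY); rewrite cdotZr// uE.
Qed.

End Projection.

(** * Analytic functions *)

Section CharacterIntegral.
Context (R : realType).
Local Notation mu := (@mT R).
Local Notation D := (@circ_set R).
Local Notation C := (complex R).
Local Notation leb := (@lebesgue_measure R).

Lemma Int_derive (f F : R -> R) : continuous f -> (forall x : R, is_derive x (1 : R) F (f x)) ->
  Int mu D f = F 1 - F 0.
Proof.
move=> cf dF.
have cF : continuous F.
  by move=> x; apply: differentiable_continuous; apply/derivable1_diffP; have [] := dF x.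
have := @continuous_FTC2 R f F 0 1 ltr01 _ _ _.
rewrite /Int /Rintegral.
have -> : (\int[mu]_(x in D) (f x)%:E = \int[leb]_(x in `[0%R, 1%R]) (f x)%:E)%E.
  rewrite integral_mT_lebesgue.
  rewrite /circ_set integral_itv_bndo_bndc//.
  by apply/measurable_EFinP; apply: measurable_funTS; exact: continuous_measurable_fun.
move=> -> //.
- exact: continuous_subspaceT.
- split=> [x _|//|//]; first by have [] := dF x.
  + by apply: cvg_at_right_filter; exact: cF.
  + by apply: cvg_at_left_filter; exact: cF.
- by move=> x _; rewrite derive1E; exact: derive_val.
Qed.

Lemma echar_1 (k : int) : echar k (1 : R) = 1.
Proof.
have h (n : nat) : echar n%:Z (1 : R) = 1.
  elim: n => [|n ih]; first exact: echar0.
  rewrite -addn1 PoszD echarD ih mul1r /echar mulr1 mulr1.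
  by apply: complex_eqP; rewrite /cexpi/= mulr_natl ?cos2pi ?sin2pi.
case: k => n; first exact: h.
by rewrite NegzE -echarJ h conjC1.
Qed.

Lemma cint_echar (k : int) : k != 0 -> cint (echar k : R -> C) = 0.
Proof.
move=> k0; pose c : R := 2 * pi * k%:~R.
have c0 : c != 0.
  by rewrite !mulf_neq0 ?intr_eq0// ?gt_eqF ?pi_gt0.
have cc (g : R -> R) : continuous g -> continuous (fun t => g (c * t)).
  move=> cg t; apply: (@continuous_comp _ _ _ (fun t => c * t) g); last exact: cg.
  by apply: cvgM; [exact: cvg_cst|exact: cvg_id].
have per : cos c = 1 /\ sin c = 0.
  by have := echar_1 k; rewrite /echar mulr1 -/c => -[].
have dlin (x : R) : is_derive x (1 : R) (c \*: (id : R -> R)) c.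
  by apply: is_derive_eq; rewrite /GRing.scale/= mulr1.
have dsin (x : R) : is_derive x (1 : R) (c^-1 \*: (sin \o (c \*: (id : R -> R)))) (cos (c * x)).
  have h1 := is_derive1_comp (is_derive_sin (c * x)) (dlin x).
  apply: (is_derive_eq (is_deriveZ c^-1 h1)).
  by rewrite /GRing.scale/= mulrCA mulVf ?mulr1.
have dcos (x : R) : is_derive x (1 : R) (- c^-1 \*: (cos \o (c \*: (id : R -> R)))) (sin (c * x)).
  have h1 := is_derive1_comp (is_derive_cos (c * x)) (dlin x).
  apply: (is_derive_eq (is_deriveZ (- c^-1) h1)).
  by rewrite /GRing.scale/=; field.
have [pc ps] := per.
apply: complex_eqP; rewrite ?cRe_cint ?cIm_cint /echar /cexpi/= -/c.
  have -> := Int_derive (cc _ (@continuous_cos R)) dsin.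
  by rewrite /= (_ : c%:A = c) ?scaler0 ?ps ?sin0 ?subrr//; exact: mulr1.
have -> := Int_derive (cc _ (@continuous_sin R)) dcos.
by rewrite /= (_ : c%:A = c) ?scaler0 ?pc ?cos0 ?subrr//; exact: mulr1.
Qed.

End CharacterIntegral.

(** * Products of Hardy functions *)

Section HardyProduct.
Context (R : realType).
Local Notation mu := (@mT R).
Local Notation C := (complex R).
Implicit Types f g : R -> C.

Definition analytic f := forall j : nat, (0 < j)%N -> fcoef f (- j%:Z) = 0.
Definition analytic0 f := forall j : nat, fcoef f (- j%:Z) = 0.

(** Scalar functions are viewed as 1 x 1 matrix functions, so that the projection theorem applies to
    them. *)
Let emb f : R -> 'M[C]_1 := fun t => (f t)%:M.
Let echars (X : R -> 'M[C]_1) := exists i : nat, X = emb (echar i).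

Let cdot_emb f (X : R -> 'M[C]_1) :
  cdot (emb f) X = cint (fun t => Num.conj (f t) * X t 0 0).
Proof.
by rewrite cdotE; congr cint; apply/funext => t; rewrite trace_adj_mul !big_ord1 /emb mxE mulr1n.
Qed.

Let emb_mL2 f : cL2 f -> mL2 (emb f).
Proof.
move=> hf i j; rewrite !ord1 (_ : (fun t => _) = f)//.
by apply/funext => t; rewrite /emb mxE mulr1n.
Qed.

Lemma cL2_echar1 (i : int) : cL2 (echar i : R -> C).
Proof.
have h := cL2_echar i (cL2_cst (1 : C)).
rewrite (_ : echar i = fun t => echar i t * 1)//.
by apply/funext => t; rewrite mulr1.
Qed.

Let echars2 X : echars X -> mL2 X.
Proof. by move=> [i ->]; apply: emb_mL2; exact: cL2_echar1. Qed.

(* The projection of [f] on the closed span of the nonnegative characters has the same Fourier coefficients as [f]. *)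
Lemma analytic_approx f : cL2 f -> analytic f ->
  exists2 P : R -> 'M[C]_1, closure2 (span echars) P & {ae mu, forall t, P t 0 0 = f t}.
Proof.
move=> f2 fa; have [P clP hP] := span_projection echars2 (emb_mL2 f2).
have [P2 _] := clP; exists P => //.
have P00 : cL2 (fun t => P t 0 0) by exact: P2.
have null : fcoef_null (fun t => f t - P t 0 0).
  split=> [|j]; first by apply: cL2_L1; exact: cL2B.
  have dotE i : cdot (emb (echar i)) (emb f - P) = fcoef (fun t => f t - P t 0 0) i.
    rewrite cdot_emb fcoefE; congr cint; apply/funext => t.
    by rewrite echarJ /emb !mxE mulr1n.
  have E2 i : mL2 (emb (echar i)) by apply: emb_mL2; exact: cL2_echar1.
  have fP2 := mL2B (emb_mL2 f2) P2.
  (* At nonnegative indices the residual is orthogonal to the character; at negative ones the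
     coefficients of [f] and of the projection vanish separately. *)
  case: j => j.
    by rewrite -dotE -(cdot_conj fP2 (E2 j)) hP ?conjC0//; exists j.
  rewrite NegzE -dotE cdotBr//; last exact: emb_mL2.
  have -> : cdot (emb (echar (- j.+1%:Z))) (emb f) = fcoef f (- j.+1%:Z).
    by rewrite cdot_emb fcoefE; congr cint; apply/funext => t; rewrite echarJ /emb mxE mulr1n.
  rewrite fa// (closure2_span_cdot0 echars2 _ _ clP) ?subrr// => _ [i ->].
  rewrite cdot_emb -[RHS](@cint_echar R (j.+1%:Z + i)); last by rewrite -PoszD.
  by congr cint; apply/funext => t; rewrite echarJ opprK /emb mxE mulr1n echarD.
by apply: filterS (fcoef_inj0 null) => t /eqP; rewrite subr_eq0 => /eqP ->.
Qed.

(** For fixed [g], the coefficient is a continuous linear form in [f]. On the character of index [i]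
    it is the coefficient of [g] at [-(j + i)], so it vanishes on the closed span of the nonnegative
    characters. *)
Lemma fcoef_mul_analytic f g (N : nat) : cL2 f -> analytic f -> cL2 g ->
  (forall j : nat, (N <= j)%N -> fcoef g (- j%:Z) = 0) ->
  forall j : nat, (N <= j)%N -> fcoef (fun t => f t * g t) (- j%:Z) = 0.
Proof.
move=> f2 fa g2 gN j Nj; have [P clP Pf] := analytic_approx f2 fa.
have [P2 _] := clP.
have -> : fcoef (fun t => f t * g t) (- j%:Z) =
    cdot (emb (fun t => Num.conj (echar j t * g t))) P.
  rewrite fcoefE cdot_emb; apply: cint_ae_eq.
  - by apply: cmeasM; [exact: cmeas_echar|apply: cmeasM; exact: cL2_meas].
  - apply: cmeasM; last by apply: cL2_meas; exact: P2.
    by apply: cmeasJ; apply: cmeasJ; apply: cmeasM; [exact: cmeas_echar|exact: cL2_meas].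
  by apply: filterS Pf => t ->; rewrite conjCK opprK mulrA mulrAC.
have e2 : mL2 (emb (fun t => Num.conj (echar j t * g t))).
  by apply: emb_mL2; apply: cL2J; exact: cL2_echar.
apply: (closure2_span_cdot0 echars2 e2 _ clP) => _ [i ->].
rewrite cdot_emb -[RHS](gN (j + i)%N) ?(leq_trans Nj) ?leq_addr// fcoefE.
congr cint; apply/funext => t.
by rewrite conjCK /emb mxE mulr1n opprK PoszD echarD mulrAC.
Qed.

End HardyProduct.

(** * Lebesgue norms of matrix functions *)

Section LipschitzMeasurable.
Context (R : realType).
Local Notation mu := (@mT R).
Local Notation D := (@circ_set R).
Local Notation C := (complex R).

(** An enumeration of the matrices with rational real and imaginary parts; a number that codes no
    matrix gives the zero matrix. *)
Definition rat_mx p q (n : nat) : 'M[C]_(p, q) :=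
  map_mx (fun r : rat * rat => Complex (ratr r.1) (ratr r.2)) (odflt (const_mx (0, 0)) (unpickle n)).

Lemma rat_mx_dense p q (A : 'M[C]_(p, q)) e : 0 < e -> exists n, l1norm (A - rat_mx p q n) <= e.
Proof.
move=> e0; pose K : R := (p * q).+1%:R; have K0 : 0 < K by rewrite ltr0n.
have d0 : 0 < e / K / 2 by rewrite !divr_gt0.
have app (a d : R) : 0 < d -> exists r : rat, `|a - ratr r| <= d.
  move=> {}d0.
  have [|r] := @rat_in_itvoo R (a - d) (a + d); first by lra.
  rewrite in_itv/= => /andP[r1 r2]; exists r; rewrite ler_norml; apply/andP; split; lra.
have /choice[Q hQ] : forall ij : 'I_p * 'I_q, exists r : rat * rat,
    cmod (A ij.1 ij.2 - Complex (ratr r.1) (ratr r.2)) <= e / K.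
  move=> [i j] /=; have [r hr] := app (complex.Re (A i j)) _ d0; have [s hs] := app (complex.Im (A i j)) _ d0.
  exists (r, s) => /=; apply: le_trans (cmod_le _) _; rewrite cReB cImB/=.
  by rewrite [leRHS](splitr (e / K)) lerD.
exists (pickle (\matrix_(i, j) Q (i, j))).
rewrite /rat_mx pickleK/=.
apply: (@le_trans _ _ (\sum_(i < p) \sum_(j < q) e / K)).
  by apply: ler_sum => i _; apply: ler_sum => j _; rewrite !mxE; exact: hQ (i, j).
rewrite !sumr_const !card_ord -mulrnA -mulr_natr -mulrA ler_piMr ?(ltW e0)//.
by rewrite mulrC ler_pdivrMr// mul1r ler_nat; lia.
Qed.

Lemma measurable_l1norm p q (X : R -> 'M[C]_(p, q)) : mmeas X ->
  measurable_fun D (fun t => l1norm (X t)).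
Proof.
move=> mX; apply: measurable_sum => i; apply: measurable_sum => j.
exact: measurable_cmod.
Qed.

Lemma l1normN p q (A : 'M[C]_(p, q)) : l1norm (- A) = l1norm A.
Proof. by apply: eq_bigr => i _; apply: eq_bigr => j _; rewrite mxE cmodN. Qed.

(* [N] is the infimum of countably many measurable functions [N Q + l1norm (. - Q)], [Q] rational. *)
Lemma measurable_lipschitz p q (N : 'M[C]_(p, q) -> R) (X : R -> 'M[C]_(p, q)) :
  (forall A B, N (A + B) <= N A + N B) -> (forall A, N A <= l1norm A) ->
  mmeas X -> measurable_fun D (fun t => N (X t)).
Proof.
move=> ND Nl mX.
pose h n t := N (rat_mx p q n) + l1norm (X t - rat_mx p q n).
have le_h n t : N (X t) <= h n t.
  by rewrite -[X in N X](subrK (rat_mx p q n)) addrC (le_trans (ND _ _))// lerD2l Nl.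
have lb t : D t -> has_lbound (range (h ^~ t)) by move=> _; exists (N (X t)) => _ [n _ <-].
have mh n : measurable_fun D (h n).
  apply: measurable_funD => //; apply: measurable_l1norm => i j.
  under eq_fun do rewrite !mxE; apply: cmeasD => //; exact: cmeas_cst.
apply: (eq_measurable_fun (fun t => infs (h ^~ t) 0)); last exact: measurable_fun_infs.
move=> t /set_mem Dt; apply/eqP; rewrite eq_le; apply/andP; split.
  apply/ler_addgt0Pr => e e0; have e20 : 0 < e / 2 by rewrite divr_gt0.
  have [n hn] := rat_mx_dense (X t) e20.
  apply: (@le_trans _ _ (h n t)).
    by apply: ge_inf; [exists (N (X t)) => _ [k _ <-]|exists n].
  have := ND (X t) (rat_mx p q n - X t); rewrite addrC subrK /h => h1.
  have := Nl (rat_mx p q n - X t); rewrite -[in leRHS]opprB l1normN; move: hn h1; lra.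
apply: lb_le_inf; first by exists (h 0%N t); exists 0%N.
by move=> _ [n _ <-].
Qed.

Lemma measurable_opnorm p q (X : R -> 'M[C]_(p, q)) : mmeas X ->
  measurable_fun D (fun t => opnorm (X t)).
Proof. by apply: measurable_lipschitz => [A B|A]; [exact: opnormD|exact: opnorm_le_l1norm]. Qed.

Lemma measurable_trnorm p q (X : R -> 'M[C]_(p, q)) : mmeas X ->
  measurable_fun D (fun t => trnorm (X t)).
Proof. by apply: measurable_lipschitz => [A B|A]; [exact: trnormD|exact: trnorm_le_l1norm]. Qed.

Lemma L1_l1norm p q (X : R -> 'M[C]_(p, q)) : mL1 X -> L1 mu D (fun t => l1norm (X t)).
Proof. by move=> hX; apply: L1_sum => i; apply: L1_sum => j; exact: cL1_cmod. Qed.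

Lemma L2_l1norm p q (X : R -> 'M[C]_(p, q)) : mL2 X -> L2 mu D (fun t => l1norm (X t)).
Proof. by move=> hX; apply: L2_sum => i; apply: L2_sum => j; exact: cL2_cmod. Qed.

Lemma L1_opnorm p q (X : R -> 'M[C]_(p, q)) : mL1 X -> L1 mu D (fun t => opnorm (X t)).
Proof.
move=> hX; apply: (L1_le _ (L1_l1norm hX)).
  by apply: measurable_opnorm => i j; exact: cL1_meas.
by move=> t _; rewrite ger0_norm ?opnorm_ge0// opnorm_le_l1norm.
Qed.

Lemma L2_opnorm p q (X : R -> 'M[C]_(p, q)) : mL2 X -> L2 mu D (fun t => opnorm (X t)).
Proof.
move=> hX; apply: (L2_ae_le _ (L2_l1norm hX)).
  by apply: measurable_opnorm => i j; exact: cL2_meas.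
by apply: aeW => t _; rewrite !ger0_norm ?opnorm_ge0 ?l1norm_ge0// opnorm_le_l1norm.
Qed.

Lemma L2_trnorm p q (X : R -> 'M[C]_(p, q)) : mL2 X -> L2 mu D (fun t => trnorm (X t)).
Proof.
move=> hX; apply: (L2_ae_le _ (L2_l1norm hX)).
  by apply: measurable_trnorm => i j; exact: cL2_meas.
by apply: aeW => t _; rewrite !ger0_norm ?trnorm_ge0 ?l1norm_ge0// trnorm_le_l1norm.
Qed.

End LipschitzMeasurable.

Section NormConversions.
Context (R : realType).
Local Notation mu := (@mT R).
Local Notation D := (@circ_set R).
Local Notation C := (complex R).
Local Notation L1 := (L1 mu D).
Local Notation L2 := (L2 mu D).
Local Notation Int := (Int mu D).

Lemma Lnorm1E (f : R -> R) : L1 f -> (forall t, 0 <= f t) ->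
  Lnorm mu 1%:E (fun t => (f t)%:E) = (Int f)%:E.
Proof.
move=> hf f0; rewrite Lnorm1 integral_mT -EFin_Int//; apply: eq_integral => t _.
by rewrite gee0_abs// lee_fin.
Qed.

Lemma Lnorm2_sqr (f : R -> R) :
  (Lnorm mu 2%:E (fun t => (f t)%:E) `^ 2 = \int[mu]_(t in D) (f t ^+ 2)%:E)%E.
Proof.
rewrite poweR_Lnorm// integral_mT; apply: eq_integral => t _.
by rewrite poweR_EFin powR_mulrn// real_normK// num_real.
Qed.

Lemma Lnorm2E (f : R -> R) : L2 f ->
  Lnorm mu 2%:E (fun t => (f t)%:E) = (Num.sqrt (Int (fun t => f t ^+ 2)))%:E.
Proof.
move=> [_ hf]; have I0 : 0 <= Int (fun t => f t ^+ 2) by apply: Int_ge0 => t _; exact: sqr_ge0.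
have := Lnorm2_sqr f; rewrite EFin_Int// => h.
have := congr1 (fun x => (x `^ 2^-1)%E) h.
rewrite -poweRrM divff// poweRe1 ?Lnorm_ge0// => ->.
by rewrite poweR_EFin powR12_sqrt.
Qed.

End NormConversions.

Section LpConversions.
Context (R : realType).
Local Notation mu := (@mT R).
Local Notation D := (@circ_set R).
Local Notation C := (complex R).
Local Notation L1 := (L1 mu D).
Local Notation L2 := (L2 mu D).
Local Notation Int := (Int mu D).
Implicit Types f : R -> C.

Lemma cLp1P f : cLp 1%:E f <-> cL1 f.
Proof.
split=> [[mr mi foo]|hf].
  have mf : cmeas f by [].
  have f1 : L1 (fun t => cmod (f t)).
    apply/integrableP; split; first by apply/measurable_EFinP; exact: (measurable_cmod mf).
    by move: foo; rewrite Lnorm1 integral_mT.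
  by apply: (cL1_le mf f1); exact: aeW.
have [mr mi] := cL1_meas hf; split=> //.
by rewrite Lnorm1E ?ltry//; [exact: cL1_cmod|move=> t; exact: cmod_ge0].
Qed.

Lemma cLp2P f : cLp 2%:E f <-> cL2 f.
Proof.
split=> [[mr mi foo]|hf].
  have mf : cmeas f by [].
  have mc := measurable_cmod mf.
  have f2 : L2 (fun t => cmod (f t)).
    split=> //; apply/integrableP; split; first by apply/measurable_EFinP; apply: measurable_funX; exact: mc.
    under eq_integral do rewrite gee0_abs ?lee_fin ?sqr_ge0//.
    by rewrite -Lnorm2_sqr poweR_lty.
  by apply: (cL2_le mf f2); exact: aeW.
have [mr mi] := cL2_meas hf; split=> //.
by rewrite Lnorm2E ?ltry//; exact: cL2_cmod.
Qed.

Lemma mT_setT_gt0 : (0 < mu [set: R])%E.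
Proof.
have h : mu [set: R] = @lebesgue_measure R D by rewrite /mT /mrestr setTI.
rewrite [ltRHS]h /circ_set lebesgue_measure_itv/= lte_fin ltr01 sube0.
by rewrite lte_fin ltr01.
Qed.

(** At exponent [+oo], [Lnorm] is an essential supremum because the measure is positive; the value
    [-oo] is covered by the bound 0. *)
Lemma cLpy_bounded f : cLp +oo%E f -> cmeas f /\ exists M, {ae mu, forall t, cmod (f t) <= M}.
Proof.
move=> [mr mi]; rewrite unlock mT_setT_gt0 => foo; split=> //.
have [M [M0 hM]] : exists M : R, 0 <= M /\
    (ess_sup mu (abse \o (fun t => (cmod (f t))%:E)) <= M%:E)%E.
  move: foo; case: (ess_sup _ _) => [r _|//|_].
    by exists (Num.max r 0); rewrite lee_fin !le_max !lexx orbT.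
  by exists 0; rewrite leNye.
exists M; have /ess_supP := hM.
by apply: filterS => t /=; rewrite lee_fin ger0_norm ?cmod_ge0.
Qed.

Lemma mxLpy_bounded p q (X : R -> 'M[C]_(p, q)) : mxLp +oo%E X ->
  mmeas X /\ exists M, {ae mu, forall t, forall i j, cmod (X t i j) <= M}.
Proof.
move=> hX; split=> [i j|]; first by have [] := cLpy_bounded (hX i j).
have /choice[M hM] : forall ij : 'I_p * 'I_q, exists M, {ae mu, forall t, cmod (X t ij.1 ij.2) <= M}.
  by move=> [i j]; have [] := cLpy_bounded (hX i j).
exists (\sum_ij `|M ij|).
have := filter_forall (mT_ae_filter R) hM.
apply: filterS => t h i j; apply: le_trans (h (i, j)) _; apply: le_trans (ler_norm _) _.
by rewrite (bigD1 (i, j))//= lerDl sumr_ge0.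
Qed.

Lemma mxHp2P p q (X : R -> 'M[C]_(p, q)) :
  mxHp 2%:E X <-> mL2 X /\ forall i j, analytic (fun t => X t i j).
Proof.
split=> [h|[h1 h2] i j]; last by split; [exact/cLp2P|exact: h2].
by split=> i j; have [/cLp2P] := h i j.
Qed.

Lemma mxHp01P p q (X : R -> 'M[C]_(p, q)) :
  mxHp0 1%:E X <-> mL1 X /\ forall i j, analytic0 (fun t => X t i j).
Proof.
split=> [h|[h1 h2] i j].
  split=> i j; have [[/cLp1P X1 Xa] X0] := h i j => //.
  by case=> [|k]; [exact: X0|exact: Xa].
split; first by split; [exact/cLp1P|move=> k _; exact: h2].
exact: (h2 i j 0%N).
Qed.

Lemma normXM1E p q (X : R -> 'M[C]_(p, q)) : mL1 X ->
  normXM 1%:E X = (Int (fun t => opnorm (X t)))%:E.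
Proof. by move=> hX; rewrite /normXM Lnorm1E//; [exact: L1_opnorm|move=> t; exact: opnorm_ge0]. Qed.

Lemma normXM2E p q (X : R -> 'M[C]_(p, q)) : mL2 X ->
  normXM 2%:E X = (Num.sqrt (Int (fun t => opnorm (X t) ^+ 2)))%:E.
Proof. by move=> hX; rewrite /normXM Lnorm2E//; exact: L2_opnorm. Qed.

Lemma normXS12E p q (X : R -> 'M[C]_(p, q)) : mL2 X ->
  normXS1 2%:E X = (Num.sqrt (Int (fun t => trnorm (X t) ^+ 2)))%:E.
Proof. by move=> hX; rewrite /normXS1 Lnorm2E//; exact: L2_trnorm. Qed.

Lemma bounded_mul_mL2 M p q r (X : R -> 'M[C]_(p, q)) (Y : R -> 'M[C]_(q, r)) : mmeas X ->
  {ae mu, forall t, forall i j, cmod (X t i j) <= M} -> mL2 Y -> mL2 (fun t => X t *m Y t).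
Proof.
move=> mX XM hY i j; under eq_fun do rewrite mxE; apply: cL2_sum => k.
by apply: (@cbd_cL2 _ M) => //; apply: filterS XM => t; exact.
Qed.

Lemma bounded_mul_mL1 M p q r (X : R -> 'M[C]_(p, q)) (Y : R -> 'M[C]_(q, r)) : mmeas X ->
  {ae mu, forall t, forall i j, cmod (X t i j) <= M} -> mL1 Y -> mL1 (fun t => X t *m Y t).
Proof.
move=> mX XM hY i j; under eq_fun do rewrite mxE; apply: cL1_sum => k.
by apply: (@cbd_cL1 _ M) => //; apply: filterS XM => t; exact.
Qed.

End LpConversions.

(** * Duality *)

Section Selection.
Context (R : realType).
Local Notation mu := (@mT R).
Local Notation D := (@circ_set R).
Local Notation C := (complex R).
Local Notation L1 := (L1 mu D).
Local Notation L2 := (L2 mu D).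
Local Notation Int := (Int mu D).
Local Notation Re := complex.Re.
Local Notation Im := complex.Im.

Let mD : measurable D. Proof. exact: circ_set_meas. Qed.

(** The sets where the least admissible index equals a given [n] are measurable and partition the
    domain countably. *)
Lemma measurable_select (h : nat -> R -> R) (P : nat -> R -> bool) (i : R -> nat) :
  (forall n, measurable_fun D (h n)) -> (forall n, measurable_fun D (P n)) ->
  (forall t, P (i t) t) -> (forall t j, P j t -> (i t <= j)%N) ->
  measurable_fun D (fun t => h (i t) t).
Proof.
move=> mh mP Pi imin.
have mL n : measurable (D `&` [set t | forall j, (j < n)%N -> ~~ P j t]).
  elim: n => [|n ih].
    by rewrite (_ : [set t | _] = setT) ?setIT//; apply/seteqP; split.
  rewrite (_ : _ `&` _ = (D `&` [set t | forall j, (j < n)%N -> ~~ P j t]) `&`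
      (D `&` P n @^-1` [set false])).
    by apply: measurableI => //; exact: mP.
  apply/seteqP; split=> t /= [].
    by move=> Dt ht; split; split=> //; [move=> j jn; apply: ht; rewrite ltnS ltnW|apply/negbTE; exact: ht].
  move=> [Dt ht] [_ Pn]; split=> // j; rewrite ltnS leq_eqVlt => /predU1P[->|]; first by rewrite Pn.
  exact: ht.
move=> _ Y mY.
rewrite (_ : _ `&` _ = \bigcup_n ((D `&` [set t | forall j, (j < n)%N -> ~~ P j t]) `&`
      (D `&` P n @^-1` [set true]) `&` (D `&` h n @^-1` Y))); last first.
  apply/seteqP; split=> t /=.
    move=> [Dt hY]; exists (i t) => //=; split; [split; split=> //|split=> //].
    - by move=> j ji; apply/negP => /imin; rewrite leqNgt ji.
    - exact: Pi.
  move=> [n _ /= [[[Dt hn] [_ Pn]] [_ hY]]]; split=> //.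
  suff -> : i t = n by [].
  apply/eqP; rewrite eqn_leq imin//= leqNgt; apply/negP => /hn.
  by rewrite Pi.
apply: bigcupT_measurable => n; apply: measurableI; last exact: mh.
by apply: measurableI; [exact: mL|exact: mP].
Qed.

Lemma rat_vec_norming p q (A : 'M[C]_(p, q)) (th : R) : 0 < th -> th < 1 ->
  exists n, (vnorm (rat_mx R q 1 n) <= 1) && (th * opnorm A <= vnorm (A *m rat_mx R q 1 n)).
Proof.
move=> th0 th1; pose e := (1 - th) / 3.
have e0 : 0 < e by rewrite divr_gt0// subr_gt0.
have A0 := opnorm_ge0 A.
have [x x1 Ax] : exists2 x, vnorm x <= 1 & (1 - e) * opnorm A <= vnorm (A *m x).
  have [/eqP A_0|An] := boolP (opnorm A == 0).
    by exists 0; rewrite ?vnorm0// A_0 mulr0 vnorm_ge0.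
  have Ap : 0 < opnorm A by rewrite lt_neqAle eq_sym An A0.
  have eA : 0 < e * opnorm A by rewrite mulr_gt0.
  have [_ [x /= x1 <-]] := sup_adherent eA (opnorm_has_sup A).
  rewrite -/(opnorm A) => /ltW h; exists x => //.
  by rewrite mulrBl mul1r.
have [n hn] := rat_mx_dense ((1 - e)%:C%C *: x) e0; exists n.
set y := rat_mx R q 1 n in hn *.
have yx : vnorm ((1 - e)%:C%C *: x - y) <= e.
  apply: le_trans hn; apply: le_trans (vnorm_le_sum _) _.
  by rewrite /l1norm; apply: ler_sum => i _; rewrite big_ord1.
have e1 : 0 <= 1 - e by rewrite /e; lra.
have nx : vnorm ((1 - e)%:C%C *: x) = (1 - e) * vnorm x by rewrite vnormZ cmodR ger0_norm.
apply/andP; split.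
  have -> : y = (1 - e)%:C%C *: x - ((1 - e)%:C%C *: x - y) by rewrite subKr.
  apply: le_trans (vnormD _ _) _; rewrite vnormN nx.
  have : (1 - e) * vnorm x <= 1 - e by rewrite ler_piMr.
  lra.
have h1 := opnormP A ((1 - e)%:C%C *: x - y).
have h2 : opnorm A * vnorm ((1 - e)%:C%C *: x - y) <= opnorm A * e by rewrite ler_wpM2l.
have := vnormD (A *m y) (A *m ((1 - e)%:C%C *: x - y)).
rewrite -mulmxDr addrC subrK -scalemxAr vnormZ cmodR ger0_norm// => h3.
have h4 : (1 - e) * ((1 - e) * opnorm A) <= (1 - e) * vnorm (A *m x) by rewrite ler_wpM2l.
have := mulr_ge0 (mulr_ge0 (ltW e0) (ltW e0)) A0.
have -> : th = 1 - 3 * e by rewrite /e; lra.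
move: h1 h2 h3 h4; move: (vnorm (A *m y)) (vnorm (A *m _)) (vnorm (A *m x)) (opnorm A) => a b c o; nra.
Qed.

(* A near-norming rank one test function is chosen measurably among rational vectors. *)
Lemma opnorm_dual p q (Z : R -> 'M[C]_(p, q)) (c r : R) : mL2 Z -> 0 <= c -> 0 < r ->
  (forall B : R -> 'M[C]_(q, p), mL2 B -> Int (fun t => trnorm (B t) ^+ 2) <= r ^+ 2 ->
     Re (cint (fun t => \tr (B t *m Z t))) <= c) ->
  Int (fun t => opnorm (Z t) ^+ 2) <= (c / r) ^+ 2.
Proof.
move=> Z2 c0 r0 hB.
suff key (th : R) : 0 < th -> th < 1 ->
    th ^+ 2 * Int (fun t => opnorm (Z t) ^+ 2) <= (c / r) ^+ 2.
  rewrite leNgt; apply/negP => lt; set o := Int _ in lt key.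
  have o0 : 0 < o by apply: le_lt_trans lt; exact: sqr_ge0.
  pose s := (c / r) ^+ 2 / o.
  have s0 : 0 <= s by rewrite divr_ge0 ?sqr_ge0// ltW.
  have s1 : s < 1 by rewrite ltr_pdivrMr// mul1r.
  have E : (c / r) ^+ 2 = s * o by rewrite divfK// gt_eqF.
  (* The arithmetic mean of 1 and [s] exceeds their geometric mean, so its square cannot be at most
     [s]. *)
  have := key ((1 + s) / 2) _ _; rewrite E.
  rewrite ler_pM2r// => h; have {h} : ((1 + s) / 2) ^+ 2 <= s by apply: h; lra.
  have : 0 < (1 - s) ^+ 2 by rewrite exprn_gt0// subr_gt0.
  rewrite !expr2; lra.
move=> th0 th1.
pose y n := rat_mx R q 1 n.
pose P n t := (vnorm (y n) <= 1) && (th * opnorm (Z t) <= vnorm (Z t *m y n)).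
have exP t : exists n, P n t by exact: rat_vec_norming.
pose i t := ex_minn (exP t).
have Pi t : P (i t) t by rewrite /i; case: ex_minnP.
have imin t j : P j t -> (i t <= j)%N by rewrite /i; case: ex_minnP => m _; apply.
have mZ := mL2_meas Z2.
have mZy n : mmeas (fun t => Z t *m y n).
  by apply: mmeasM => // a b; exact: cmeas_cst.
have mP n : measurable_fun D (P n).
  apply: measurable_and => //; apply: measurable_fun_ler.
    by apply: measurable_funM => //; exact: measurable_opnorm.
  (* The length of a vector is its operator norm as a one-column matrix, whose measurability is
     available. *)
  apply: (eq_measurable_fun (fun t => opnorm (Z t *m y n))) => [t _|]; last exact: measurable_opnorm.
  apply/eqP; rewrite eq_le; apply/andP; split.
    apply: opnorm_le => [|x]; first exact: vnorm_ge0.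
    rewrite [x]mx11_scalar mul_mx_scalar vnormZ.
    have -> : vnorm (x 0 0)%:M = cmod (x 0 0).
      apply/eqP; rewrite -(@eqrXn2 _ 2) ?vnorm_ge0 ?cmod_ge0// vnorm_sqr big_ord1 mxE mulr1n.
      by [].
    by rewrite mulrC.
  have := vnorm_col_le_opnorm (Z t *m y n) 0; rewrite -mul_delta_col.
  by rewrite (_ : delta_mx 0 0 = 1%:M) ?mulmx1//; apply/matrixP => a b; rewrite !ord1 !mxE.
(* Pairing this rank one matrix with [Z t] gives the squared length of [Z t y], and its trace norm
   is at most that length since [y] is in the unit ball; [S] thus controls both integrals. *)
pose B t := y (i t) *m (Z t *m y (i t))^t*.
have BE t a b : B t a b = y (i t) a 0 * Num.conj ((Z t *m y (i t)) b 0).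
  by rewrite mxE big_ord1 adjE.
have mB : mmeas B.
  move=> a b; split.
    under eq_fun do rewrite BE.
    apply: (measurable_select (h := fun n t => Re (y n a 0 * Num.conj ((Z t *m y n) b 0))) _ mP Pi imin) => n.
    by have [] := cmeasM (cmeas_cst (y n a 0)) (cmeasJ (mZy n b 0)).
  under eq_fun do rewrite BE.
  apply: (measurable_select (h := fun n t => Im (y n a 0 * Num.conj ((Z t *m y n) b 0))) _ mP Pi imin) => n.
  by have [] := cmeasM (cmeas_cst (y n a 0)) (cmeasJ (mZy n b 0)).
have y1 t : vnorm (y (i t)) <= 1 by have /andP[] := Pi t.
have B2 : mL2 B.
  move=> a b; apply: (cL2_le (mB a b) (L2_opnorm Z2)); apply: aeW => t.
  rewrite BE cmodM cmodJ -[leRHS]mul1r; apply: ler_pM; rewrite ?cmod_ge0//.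
    exact: le_trans (cmod_le_vnorm _ _) (y1 t).
  apply: le_trans (cmod_le_vnorm _ _) _; apply: le_trans (opnormP _ _) _.
  by rewrite ler_piMr ?opnorm_ge0.
have trE t : \tr (B t *m Z t) = (vnorm (Z t *m y (i t)) ^+ 2)%:C%C.
  by rewrite mxtrace_mulC mulmxA mxtrace_mulC /mxtrace big_ord1 vdot_self.
have BZ := mL2M B2 Z2.
have [S1 _] := cL1_trace BZ.
set S := Re (cint (fun t => \tr (B t *m Z t))).
have SE : S = Int (fun t => Re (\tr (B t *m Z t))) by rewrite /S cRe_cint.
have oS : th ^+ 2 * Int (fun t => opnorm (Z t) ^+ 2) <= S.
  have o1 : L1 (fun t => opnorm (Z t) ^+ 2) by have [] := L2_opnorm Z2.
  rewrite SE -IntZ//; apply: Int_le => //; first exact: L1Z.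
  move=> t _; rewrite trE/= -exprMn; have /andP[_ h] := Pi t.
  by rewrite lerXn2r ?nnegrE ?vnorm_ge0// mulr_ge0 ?opnorm_ge0 ?ltW.
have tS : Int (fun t => trnorm (B t) ^+ 2) <= S.
  have t1 : L1 (fun t => trnorm (B t) ^+ 2) by have [] := L2_trnorm B2.
  rewrite SE; apply: Int_le => // t _; rewrite trE/=.
  rewrite lerXn2r ?nnegrE ?vnorm_ge0 ?trnorm_ge0// (le_trans (trnorm_rank1 _ _))//.
  by rewrite ler_piMl ?vnorm_ge0.
apply: le_trans oS _.
have S0 : 0 <= S by apply: le_trans tS; apply: Int_ge0 => t _; exact: sqr_ge0.
have [->|Sn] := eqVneq S 0; first exact: sqr_ge0.
have Sp : 0 < S by rewrite lt_neqAle eq_sym Sn.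
have sp : 0 < Num.sqrt S by rewrite sqrtr_gt0.
(* Scaling puts [B] in the ball of radius [r]; the hypothesis then reads [r sqrt S <= c]. *)
pose a := r / Num.sqrt S.
have a0 : 0 < a by rewrite divr_gt0.
have aB2 : mL2 (a%:C%C *: B) by exact: mL2Z.
have := hB _ aB2 _.
have -> : cint (fun t => \tr ((a%:C%C *: B) t *m Z t)) = a%:C%C * cint (fun t => \tr (B t *m Z t)).
  rewrite -cintZ; last exact: cL1_trace.
  by congr cint; apply/funext => t; rewrite -scalemxAl linearZ.
rewrite cReM/= mul0r subr0 -/S => h.
have {h} aS : a * S <= c.
  apply: h; have t1 : L1 (fun t => trnorm (B t) ^+ 2) by have [] := L2_trnorm B2.
  apply: (@le_trans _ _ (a ^+ 2 * Int (fun t => trnorm (B t) ^+ 2))).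
    rewrite -IntZ//; apply: Int_le; [by have [] := L2_trnorm aB2|exact: L1Z|] => t _.
    have tz : trnorm ((a%:C%C *: B) t) <= a * trnorm (B t) := trnormZ (B t) (ltW a0).
    by rewrite -exprMn lerXn2r ?nnegrE ?trnorm_ge0// mulr_ge0 ?trnorm_ge0// ltW.
  apply: (@le_trans _ _ (a ^+ 2 * S)); first by rewrite ler_wpM2l ?sqr_ge0.
  by rewrite /a expr_div_n sqr_sqrtr// divfK.
have : Num.sqrt S <= c / r.
  rewrite ler_pdivlMr//; apply: le_trans aS.
  by rewrite /a -{3}(sqr_sqrtr S0) expr2 mulrA divfK ?gt_eqF// mulrC.
move=> h; rewrite -(sqr_sqrtr S0) lerXn2r ?nnegrE ?sqrtr_ge0//.
by rewrite divr_ge0// ltW.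
Qed.

End Selection.

(** * Trace norm distance to [H^2] *)

Section Duality.
Context (R : realType).
Local Notation mu := (@mT R).
Local Notation D := (@circ_set R).
Local Notation C := (complex R).
Local Notation L1 := (L1 mu D).
Local Notation L2 := (L2 mu D).
Local Notation Int := (Int mu D).
Local Notation Re := complex.Re.

Lemma sqrt_Int_sqrD (f g : R -> R) : L2 f -> L2 g ->
  Num.sqrt (Int (fun t => (f t + g t) ^+ 2)) <=
  Num.sqrt (Int (fun t => f t ^+ 2)) + Num.sqrt (Int (fun t => g t ^+ 2)).
Proof.
move=> hf hg; have [_ f2] := hf; have [_ g2] := hg; have fg : L1 (fun t => f t * g t) by exact: L2M.
have fg2 : L1 (fun t => 2 * (f t * g t)) by exact: L1Z.
have E : Int (fun t => (f t + g t) ^+ 2) =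
    Int (fun t => f t ^+ 2) + 2 * Int (fun t => f t * g t) + Int (fun t => g t ^+ 2).
  by rewrite -IntZ// -IntD// -IntD//; [apply: eq_Rintegral => t _; ring|exact: L1D].
have : Int (fun t => f t * g t) <= Num.sqrt (Int (fun t => f t ^+ 2)) * Num.sqrt (Int (fun t => g t ^+ 2)).
  exact: Int_mul_le_sqrt.
rewrite E.
have : 0 <= Int (fun t => f t ^+ 2) by apply: Int_ge0 => t _; exact: sqr_ge0.
have : 0 <= Int (fun t => g t ^+ 2) by apply: Int_ge0 => t _; exact: sqr_ge0.
move: (Int (fun t => f t ^+ 2)) (Int (fun t => g t ^+ 2)) (Int (fun t => f t * g t)) => a b c b0 a0 h.
have -> : Num.sqrt a + Num.sqrt b = Num.sqrt ((Num.sqrt a + Num.sqrt b) ^+ 2).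
  by rewrite sqrtr_sqr ger0_norm ?addr_ge0 ?sqrtr_ge0.
apply: ler_wsqrtr; rewrite sqrrD !sqr_sqrtr// -mulr_natl; lra.
Qed.

(** The norm of [L^2(S_1)], sealed in the same way as [cdot]. *)
Fact trnrm_sig : {f : forall p q, (R -> 'M[C]_(p, q)) -> R |
  forall p q X, f p q X = Num.sqrt (Int (fun t => trnorm (X t) ^+ 2))}.
Proof. by eexists => p q X; reflexivity. Qed.
Definition trnrm p q (X : R -> 'M[C]_(p, q)) : R := sval trnrm_sig p q X.
Lemma trnrmE p q (X : R -> 'M[C]_(p, q)) :
  trnrm X = Num.sqrt (Int (fun t => trnorm (X t) ^+ 2)).
Proof. exact: (svalP trnrm_sig). Qed.

Lemma trnrm_ge0 p q (X : R -> 'M[C]_(p, q)) : 0 <= trnrm X. Proof. by rewrite trnrmE sqrtr_ge0. Qed.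

Lemma trnrm_sqr p q (X : R -> 'M[C]_(p, q)) : trnrm X ^+ 2 = Int (fun t => trnorm (X t) ^+ 2).
Proof. by rewrite trnrmE sqr_sqrtr// Int_ge0// => t _; exact: sqr_ge0. Qed.

Lemma le_sqrt_Int_sqr (f g : R -> R) : L2 f -> L2 g -> (forall t, 0 <= f t <= g t) ->
  Num.sqrt (Int (fun t => f t ^+ 2)) <= Num.sqrt (Int (fun t => g t ^+ 2)).
Proof.
move=> [_ f2] [_ g2] fg; apply: ler_wsqrtr; apply: Int_le => // t _.
have /andP[f0 h] := fg t.
by rewrite lerXn2r ?nnegrE// (le_trans f0).
Qed.

Lemma trnrmD p q (X Y : R -> 'M[C]_(p, q)) : mL2 X -> mL2 Y -> trnrm (X + Y) <= trnrm X + trnrm Y.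
Proof.
move=> hX hY; have XY := mL2D hX hY; rewrite !trnrmE.
apply: le_trans (sqrt_Int_sqrD (L2_trnorm hX) (L2_trnorm hY)).
apply: (le_sqrt_Int_sqr (L2_trnorm XY)); first exact: L2D (L2_trnorm hX) (L2_trnorm hY).
move=> t; rewrite trnorm_ge0/=; exact: trnormD.
Qed.

Lemma trnrmZ p q (a : R) (X : R -> 'M[C]_(p, q)) : 0 <= a -> mL2 X -> trnrm (a%:C%C *: X) <= a * trnrm X.
Proof.
move=> a0 hX; have aX := mL2Z (a%:C%C) hX; rewrite !trnrmE.
have -> : a * Num.sqrt (Int (fun t => trnorm (X t) ^+ 2)) = Num.sqrt (Int (fun t => (a * trnorm (X t)) ^+ 2)).
  rewrite [in RHS](_ : Int _ = a ^+ 2 * Int (fun t => trnorm (X t) ^+ 2)).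
    by rewrite sqrtrM ?sqr_ge0// sqrtr_sqr ger0_norm.
  rewrite -IntZ; last by have [] := L2_trnorm hX.
  by apply: eq_Rintegral => t _; rewrite exprMn.
apply: (le_sqrt_Int_sqr (L2_trnorm aX)); first exact: L2Z (L2_trnorm hX).
by move=> t; rewrite trnorm_ge0/=; exact: trnormZ.
Qed.

Lemma l1norm_sqr_le p q (A : 'M[C]_(p, q)) : l1norm A ^+ 2 <= (p * q)%:R * frob2 A.
Proof.
rewrite /l1norm /frob2 !pair_big/=.
have := sum_Cauchy_Schwarz (fun=> 1 : R) (fun ij : 'I_p * 'I_q => cmod (A ij.1 ij.2)).
under [X in X ^+ 2 <= _ -> _]eq_bigr do rewrite mul1r.
by rewrite expr1n sumr_const card_prod !card_ord.
Qed.

(** This comparison, with a dimensional constant, lets a Hilbert space projection serve a distance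
    measured in the trace norm. *)
Lemma trnrm_le_nrm p q (X : R -> 'M[C]_(p, q)) : mL2 X -> trnrm X <= Num.sqrt (p * q)%:R * nrm X.
Proof.
move=> hX; rewrite trnrmE /nrm -sqrtrM// nrm2E -IntZ; last exact: L1_frob2.
apply: ler_wsqrtr; apply: Int_le.
- by have [] := L2_trnorm hX.
- by apply: L1Z; exact: L1_frob2.
move=> t _; apply: le_trans (l1norm_sqr_le (X t)).
by rewrite lerXn2r ?nnegrE ?trnorm_ge0 ?l1norm_ge0// trnorm_le_l1norm.
Qed.

Definition hardy2 p q (X : R -> 'M[C]_(p, q)) := mL2 X /\ forall i j, analytic (fun t => X t i j).

Lemma hardy2_0 p q : hardy2 (0 : R -> 'M[C]_(p, q)).
Proof.
split=> [|i j k k0]; first exact: mL2_0.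
rewrite fcoefE -[RHS](cint0 R); congr cint; apply/funext => t; by rewrite mxE mulr0.
Qed.

Lemma hardy2D p q (X Y : R -> 'M[C]_(p, q)) : hardy2 X -> hardy2 Y -> hardy2 (X + Y).
Proof.
move=> [X2 Xa] [Y2 Ya]; split=> [|i j k k0]; first exact: mL2D.
rewrite (_ : (fun t => _) = fun t => X t i j + Y t i j); last by apply/funext => t; rewrite mxE.
by rewrite fcoefD ?Xa ?Ya ?addr0//; exact: cL2_L1.
Qed.

Lemma hardy2Z p q c (X : R -> 'M[C]_(p, q)) : hardy2 X -> hardy2 (c *: X).
Proof.
move=> [X2 Xa]; split=> [|i j k k0]; first exact: mL2Z.
rewrite (_ : (fun t => _) = fun t => c * X t i j); last by apply/funext => t; rewrite mxE.
by rewrite fcoefZ ?Xa ?mulr0//; exact: cL2_L1.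
Qed.

Lemma hardy2_delta p q (l : nat) (a : 'I_p) (b : 'I_q) :
  hardy2 (fun t => echar l t *: delta_mx a b : 'M[C]_(p, q)).
Proof.
have E i j : (fun t => (echar l t *: delta_mx a b : 'M[C]_(p, q)) i j) =
    (fun t => ((i == a) && (j == b))%:R * echar l t).
  by apply/funext => t; rewrite !mxE mulrC.
split=> i j; first by rewrite E; apply: cL2Z; exact: cL2_echar1.
move=> k k0; rewrite E fcoefZ; last by apply: cL2_L1; exact: cL2_echar1.
rewrite fcoefE opprK (_ : (fun t => _) = echar (k + l)%N); last first.
  by apply/funext => t; rewrite PoszD echarD.
by rewrite cint_echar ?mulr0// -lt0n ltn_addr.
Qed.

(** The inner product of [Z] with a character times a matrix unit is a coefficient of an entry of
    the adjoint, at the opposite index. The constant character gives the vanishing mean. *)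
Lemma analytic0_of_orthogonal p q (Z : R -> 'M[C]_(p, q)) : mL2 Z ->
  (forall H, hardy2 H -> cdot Z H = 0) ->
  forall i j, analytic0 (fun t => ((Z t)^t* ) i j).
Proof.
move=> Z2 Z0 i j k; rewrite -(Z0 _ (hardy2_delta k j i)) fcoefE cdotE.
congr cint; apply/funext => t; rewrite -scalemxAr linearZ/= opprK; congr (_ * _).
rewrite trace_adj_mul (bigD1 j)//= (bigD1 i)//= !big1 ?addr0.
- by rewrite adjE mxE !eqxx mulr1.
- by move=> a aj; rewrite big1// => b _; rewrite mxE (negbTE aj) mulr0.
- by move=> b bi; rewrite mxE (negbTE bi) andbF mulr0.
Qed.

(* Hahn-Banach through the orthogonal projection of [W] on [hardy2 + {B | trnrm B <= r}]. *)
Theorem trnrm_dual p q (W : R -> 'M[C]_(p, q)) (d r : R) : mL2 W -> 0 < r -> r < d ->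
  (forall H, hardy2 H -> d <= trnrm (W - H)) ->
  exists Z : R -> 'M[C]_(q, p), [/\ mL2 Z, forall i j, analytic0 (fun t => Z t i j),
    Int (fun t => opnorm (Z t) ^+ 2) <= 1 & r <= cmod (cint (fun t => \tr (W t *m Z t)))].
Proof.
move=> W2 r0 rd hd.
pose K (Y : R -> 'M[C]_(p, q)) := exists H B, [/\ Y = H + B, hardy2 H, mL2 B & trnrm B <= r].
have K2 Y : K Y -> mL2 Y by move=> [H [B [-> [H2 _] B2 _]]]; exact: mL2D.
have KH H : hardy2 H -> K H.
  move=> hH; exists H, 0; split; rewrite ?addr0//; first exact: mL2_0.
  have := trnrm_le_nrm (@mL2_0 R p q); rewrite [nrm _]/nrm nrm2_0 sqrtr0 mulr0 => /le_trans; apply.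
  exact: ltW.
have KB B : mL2 B -> trnrm B <= r -> K B.
  by move=> B2 Br; exists 0, B; split; rewrite ?add0r//; exact: hardy2_0.
have [P clP hP] : exists2 P, closure2 K P & forall Y, K Y -> Re (cdot (W - P) (Y - P)) <= 0.
  apply: convex_projection => //; first by exists 0; apply: KH; exact: hardy2_0.
  move=> Y Y' s [H [B [-> hH B2 Br]]] [H' [B' [-> hH' B2' Br']]] /andP[s0 s1].
  exists (s%:C%C *: H + (1 - s)%:C%C *: H'), (s%:C%C *: B + (1 - s)%:C%C *: B'); split.
  - by rewrite !scalerDr addrACA.
  - by apply: hardy2D; exact: hardy2Z.
  - by apply: mL2D; exact: mL2Z.
  apply: le_trans (trnrmD (mL2Z _ B2) (mL2Z _ B2')) _.
  have s1' : 0 <= 1 - s by rewrite subr_ge0.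
  have h1 : trnrm (s%:C%C *: B) <= s * r by apply: le_trans (trnrmZ s0 B2) _; rewrite ler_wpM2l.
  have h2 : trnrm ((1 - s)%:C%C *: B') <= (1 - s) * r.
    by apply: le_trans (trnrmZ s1' B2') _; rewrite ler_wpM2l.
  lra.
have [P2 Pc] := clP; have Z02 := mL2B W2 P2.
set Z0 := W - P in Z02 hP.
(* Every point of [K] is at trace distance at least [d - r] from [W]; an approximation of [P] in [K]
   within half of that would contradict [Z0] having norm zero. *)
have Zp : 0 < nrm Z0.
  rewrite lt_neqAle nrm_ge0 andbT eq_sym; apply/negP => /eqP nZ0.
  pose c : R := Num.sqrt (p * q)%:R + 1.
  have c0 : 0 < c by rewrite ltr_wpDl ?sqrtr_ge0.
  have e0 : 0 < (d - r) / 2 / c by rewrite !divr_gt0// subr_gt0.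
  have [Y [H [B [YE hH B2 Br]]] PY] := Pc _ e0.
  have H2 : mL2 H by case: hH.
  have YHB2 : mL2 (W - Y) by rewrite YE; apply: mL2B => //; exact: mL2D.
  have WY : nrm (W - Y) <= (d - r) / 2 / c.
    have Y2 : mL2 Y by rewrite YE; exact: mL2D.
    by apply: le_trans (nrm_le_tri W2 P2 Y2) _; rewrite nZ0 add0r.
  have := hd _ hH; have -> : W - H = B + (W - Y).
    by rewrite YE opprD [RHS]addrC addrA subrK.
  move=> h; have := le_trans h (trnrmD B2 YHB2).
  have h2 : trnrm (W - Y) <= (d - r) / 2.
    apply: le_trans (trnrm_le_nrm YHB2) _; apply: (@le_trans _ _ (c * ((d - r) / 2 / c))).
      by apply: ler_pM; rewrite ?sqrtr_ge0 ?nrm_ge0// lerDl.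
    by rewrite mulrC divfK// gt_eqF.
  lra.
pose c := Re (cdot Z0 W).
have cP Y : K Y -> Re (cdot Z0 Y) <= c - nrm2 Z0.
  move=> KY; have := hP _ KY; rewrite cdotBr//; last exact: K2.
  have -> : P = W - Z0 by rewrite /Z0 subKr.
  rewrite cdotBr// !cReB -/c -/(nrm2 Z0); lra.
have c0 : 0 < c.
  have := cP _ (KH _ (hardy2_0 p q)).
  rewrite -(scale0r (0 : R -> 'M[C]_(p, q))) cdotZr//; last exact: mL2_0.
  rewrite mul0r/= -nrm_sqr => h; have : 0 < nrm Z0 ^+ 2 by rewrite exprn_gt0.
  by move: h; move: (nrm Z0 ^+ 2) => x; lra.
have le_c Y : K Y -> Re (cdot Z0 Y) <= c.
  by move=> /cP /le_trans; apply; rewrite lerBlDr lerDl nrm2_ge0.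
(* A linear form bounded above on a vector space vanishes: a suitable multiple of [H] would give the
   value [2 c], above the bound [c]. *)
have orth H : hardy2 H -> cdot Z0 H = 0.
  move=> hH; have [H2 _] := hH; have [u u1 uE] := phase (cdot Z0 H).
  apply: cmod_eq0; apply/eqP; rewrite eq_le cmod_ge0 andbT leNgt; apply/negP => lt0.
  have := le_c _ (KH _ (hardy2Z ((2 * c / cmod (cdot Z0 H))%:C%C * u) hH)).
  rewrite cdotZr// -(mulrA _ u) uE -rmorphM/= divfK ?gt_eqF//; lra.
(* Duality on the ball of radius [r] bounds the operator norm of [Z0] by [c / r]; this factor
   normalizes it, and the pairing with [W] has real part [a c = r]. *)
pose a := r / c; have a0 : 0 < a by rewrite divr_gt0.
pose Z t := a%:C%C *: (Z0 t)^t*.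
have Z0a2 := mL2_adj Z02.
have Z2 : mL2 Z by exact: (mL2Z (a%:C%C) Z0a2).
have swap B : cint (fun t => \tr (B t *m (Z0 t)^t* )) = cdot Z0 B.
  by rewrite cdotE; congr cint; apply/funext => t; rewrite mxtrace_mulC.
exists Z; split=> //.
- move=> i j k; rewrite (_ : (fun t => Z t i j) = (fun t => a%:C%C * ((Z0 t)^t* ) i j)); last first.
    by apply/funext => t; rewrite mxE.
  rewrite fcoefZ; last by apply: cL2_L1; exact: Z0a2.
  by rewrite (analytic0_of_orthogonal Z02 orth) mulr0.
- have oz : Int (fun t => opnorm ((Z0 t)^t* ) ^+ 2) <= (c / r) ^+ 2.
    apply: opnorm_dual => //; first exact: ltW.
    move=> B B2 Br; rewrite swap; apply: le_c; apply: KB => //.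
    rewrite -(@ler_pXn2r _ 2) ?nnegrE ?trnrm_ge0 ?(ltW r0)// trnrm_sqr.
    exact: Br.
  have o1 : L1 (fun t => opnorm ((Z0 t)^t* ) ^+ 2) by have [] := L2_opnorm Z0a2.
  apply: (@le_trans _ _ (a ^+ 2 * Int (fun t => opnorm ((Z0 t)^t* ) ^+ 2))).
    rewrite -IntZ//; apply: Int_le; [by have [] := L2_opnorm Z2|exact: L1Z|] => t _.
    rewrite -exprMn lerXn2r ?nnegrE ?opnorm_ge0//; first by rewrite mulr_ge0 ?opnorm_ge0 ?ltW.
    by apply: le_trans (opnormZ_le _ _) _; rewrite cmodR ger0_norm// ltW.
  apply: (@le_trans _ _ (a ^+ 2 * (c / r) ^+ 2)); first by rewrite ler_wpM2l ?sqr_ge0.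
  rewrite -exprMn /a mulrA divfK ?gt_eqF// divff ?gt_eqF// expr1n//.
have -> : cint (fun t => \tr (W t *m Z t)) = a%:C%C * cdot Z0 W.
  rewrite -swap -cintZ; last by apply: cL1_trace; exact: mL2M.
  by congr cint; apply/funext => t; rewrite /Z -scalemxAr linearZ.
rewrite cmodM cmodR ger0_norm ?(ltW a0)// -[leLHS](_ : a * c = r); last by rewrite /a divfK// gt_eqF.
by rewrite ler_pM2l// (le_trans (ler_norm _))// cRe_le_cmod.
Qed.

End Duality.

(** * Factorization *)

Section Modulation.
Context (R : realType).
Local Notation mu := (@mT R).
Local Notation D := (@circ_set R).
Local Notation C := (complex R).
Local Notation Re := complex.Re.

Definition modulate p q (j : int) (X : R -> 'M[C]_(p, q)) : R -> 'M[C]_(p, q) :=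
  fun t => echar j t *: X t.

Lemma modulate_mL2 p q j (X : R -> 'M[C]_(p, q)) : mL2 X -> mL2 (modulate j X).
Proof. by move=> hX a b; under eq_fun do rewrite mxE; exact: cL2_echar. Qed.

Lemma modulateM p q i j (X : R -> 'M[C]_(p, q)) : modulate i (modulate j X) = modulate (i + j) X.
Proof. by apply/funext => t; rewrite /modulate scalerA echarD. Qed.

Lemma modulate0 p q (X : R -> 'M[C]_(p, q)) : modulate 0 X = X.
Proof. by apply/funext => t; rewrite /modulate echar0 scale1r. Qed.

Lemma modulateB p q j (X Y : R -> 'M[C]_(p, q)) : modulate j (X - Y) = modulate j X - modulate j Y.
Proof. by apply/funext => t; rewrite /modulate [LHS]scalerBr. Qed.

Lemma cdot_modulate p q j (X Y : R -> 'M[C]_(p, q)) :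
  cdot (modulate j X) (modulate j Y) = cdot X Y.
Proof.
rewrite !cdotE; congr cint; apply/funext => t.
rewrite /modulate adjZ -scalemxAl -scalemxAr scalerA echarJ -echarD.
by rewrite addNr echar0 scale1r.
Qed.

Lemma nrm_modulate p q j (X : R -> 'M[C]_(p, q)) : nrm (modulate j X) = nrm X.
Proof. by rewrite /nrm /nrm2 cdot_modulate. Qed.

Lemma closure2_modulate p q (K K' : (R -> 'M[C]_(p, q)) -> Prop) j X :
  (forall Y, K Y -> K' (modulate j Y)) -> closure2 K X -> closure2 K' (modulate j X).
Proof.
move=> KK' [hX Xc]; split=> [|e e0]; first exact: modulate_mL2.
have [Y KY XY] := Xc _ e0; exists (modulate j Y); first exact: KK'.
by rewrite -modulateB nrm_modulate.
Qed.

Lemma span_modulate p q (G G' : (R -> 'M[C]_(p, q)) -> Prop) j X :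
  (forall Y, G Y -> G' (modulate j Y)) -> span G X -> span G' (modulate j X).
Proof.
move=> GG'; elim=> [|c Y Z GY _ ih].
  rewrite (_ : modulate _ _ = 0); first exact: span0.
  by apply/funext => t; rewrite /modulate [LHS]scaler0.
rewrite (_ : modulate _ _ = c *: modulate j Y + modulate j Z).
  by apply: spanD => //; exact: GG'.
by apply/funext => t; rewrite /modulate [LHS]scalerDr scalerA mulrC -scalerA.
Qed.

Lemma closure2_mono p q (K K' : (R -> 'M[C]_(p, q)) -> Prop) X :
  (forall Y, K Y -> K' Y) -> closure2 K X -> closure2 K' X.
Proof.
move=> KK' [hX Xc]; split=> // e /Xc[Y /KK' KY XY]; by exists Y.
Qed.

Lemma span_mono p q (G G' : (R -> 'M[C]_(p, q)) -> Prop) X :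
  (forall Y, G Y -> G' Y) -> span G X -> span G' X.
Proof.
by move=> GG'; elim=> [|c Y Z /GG' GY _ ih]; [exact: span0|exact: spanD].
Qed.

Lemma cL1_mul_entry p q r (A : R -> 'M[C]_(p, q)) (B : R -> 'M[C]_(q, r)) i j l :
  mL2 A -> mL2 B -> fcoef (fun t => (A t *m B t) i j) l =
  \sum_a fcoef (fun t => A t i a * B t a j) l.
Proof.
move=> hA hB; rewrite -fcoef_sum => [|a]; last exact: cL2M.
by congr fcoef; apply/funext => t; rewrite mxE.
Qed.

Lemma analytic0_mul p q r (A : R -> 'M[C]_(p, q)) (B : R -> 'M[C]_(q, r)) :
  hardy2 A -> mL2 B -> (forall i j, analytic0 (fun t => B t i j)) ->
  forall i j, analytic0 (fun t => (A t *m B t) i j).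
Proof.
move=> [A2 Aa] B2 Ba i j l; rewrite cL1_mul_entry// big1// => a _.
exact: (fcoef_mul_analytic (A2 i a) (Aa i a) (B2 a j) (fun l _ => Ba a j l) (leq0n l)).
Qed.

Lemma analytic0_mulr p q r (A : R -> 'M[C]_(p, q)) (B : R -> 'M[C]_(q, r)) :
  hardy2 B -> mL2 A -> (forall i j, analytic0 (fun t => A t i j)) ->
  forall i j, analytic0 (fun t => (A t *m B t) i j).
Proof.
move=> [B2 Ba] A2 Aa i j l; rewrite cL1_mul_entry// big1// => a _.
rewrite (_ : (fun t => _) = fun t => B t a j * A t i a); last by apply/funext => t; rewrite mulrC.
exact: (fcoef_mul_analytic (B2 a j) (Ba a j) (A2 i a) (fun l _ => Aa i a l) (leq0n l)).
Qed.

Lemma vnorm_frob2 p q (A : 'M[C]_(p, q)) x : vnorm (A *m x) ^+ 2 <= frob2 A * vnorm x ^+ 2.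
Proof.
rewrite [X in _ * X]vnorm_sqr vnorm_sqr /frob2 mulr_suml; apply: ler_sum => i _.
apply: le_trans (_ : (\sum_j cmod (A i j) * cmod (x j 0)) ^+ 2 <= _); last exact: sum_Cauchy_Schwarz.
rewrite lerXn2r ?nnegrE ?cmod_ge0//.
  by apply: sumr_ge0 => j _; rewrite mulr_ge0 ?cmod_ge0.
rewrite mxE; apply: le_trans (cmod_sum _ _) _; apply: ler_sum => j _.
by rewrite cmodM.
Qed.

(** A nonzero vector killed by [Y] keeps its length under [U - Y]. The bound is quantitative, so it
    survives [L^2] approximation without any pointwise convergence. *)
Lemma frob2_isometry_rank p r (U Y : 'M[C]_(p, r)) : U^t* *m U = 1%:M -> (\rank Y < r)%N ->
  1 <= frob2 (U - Y).
Proof.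
move=> UU rY.
have : kermx (Y^T) != 0 by rewrite -mxrank_eq0 mxrank_ker mxrank_tr -lt0n subn_gt0.
case/rowV0Pn => v /sub_kermxP vY v0.
pose z := v^T; have Yz : Y *m z = 0 by rewrite -[LHS]trmxK trmx_mul trmxK vY trmx0.
have vz : v = z^T by rewrite /z trmxK.
clearbody z; have zn : vnorm z != 0.
  by apply: contraNneq v0 => /vnorm_eq0 h; rewrite vz h trmx0.
have zp : 0 < vnorm z by rewrite lt_neqAle eq_sym zn vnorm_ge0.
have := vnorm_frob2 (U - Y) z; rewrite mulmxBl Yz subr0 vnorm_isometry//.
by rewrite -{1}[vnorm z ^+ 2]mul1r ler_pM2r// exprn_gt0.
Qed.

End Modulation.

Section Shift.
Context (R : realType).
Local Notation C := (complex R).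

Lemma analytic0_shift (f : R -> C) : analytic0 f -> analytic (fun t => echar (- 1) t * f t).
Proof.
by move=> h [|j] // _; rewrite fcoef_echar opprK -(h j); congr fcoef; lia.
Qed.

Lemma analytic_shift (f : R -> C) : analytic f -> analytic0 (fun t => echar 1 t * f t).
Proof.
by move=> h j; rewrite fcoef_echar -(h j.+1)//; congr fcoef; lia.
Qed.

Lemma hardy2_cst p q (J : 'M[C]_(p, q)) : hardy2 (fun=> J).
Proof.
split=> [i j|i j l l0]; first exact: cL2_cst.
rewrite fcoefE (_ : (fun t => _) = fun t => J i j * echar l t); last first.
  by apply/funext => t; rewrite opprK mulrC.
by rewrite cintZ ?cint_echar ?mulr0 -?lt0n//; apply: cL2_L1; exact: cL2_echar1.
Qed.

Lemma mL2_mul_cst p q r (X : R -> 'M[C]_(p, q)) (J : 'M[C]_(q, r)) : mL2 X -> mL2 (fun t => X t *m J).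
Proof.
move=> X2 i j; under eq_fun do rewrite mxE; apply: cL2_sum => a.
by under eq_fun do rewrite mulrC; exact: cL2Z.
Qed.

End Shift.

(** * Wandering subspace and factorization *)

Section Factorization.
Context (R : realType) (n m k : nat) (Psi : R -> 'M[complex R]_(n, m)) (eps : R).
Local Notation mu := (@mT R).
Local Notation D := (@circ_set R).
Local Notation C := (complex R).
Local Notation L1 := (L1 mu D).
Local Notation L2 := (L2 mu D).
Local Notation Int := (Int mu D).
Local Notation Re := complex.Re.
Local Notation V := (R -> 'M[C]_(n, 1)).
Context (Psi1 : mL1 Psi) (Psi_an : forall i j, analytic0 (fun t => Psi t i j))
  (Psi_rank : {ae mu, forall t, (\rank (Psi t) <= k)%N}) (eps0 : 0 < eps).

Let w t := opnorm (Psi t) + eps.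
Let sw t := Num.sqrt (w t).
(** The inverse is written as a real power, whose measurability is available. *)
Let iw t := (sw t) `^ (- 1).

Let w_gt0 t : 0 < w t. Proof. by rewrite ltr_wpDl ?opnorm_ge0. Qed.
Let sw_gt0 t : 0 < sw t. Proof. by rewrite sqrtr_gt0. Qed.
Let sw_sqr t : sw t ^+ 2 = w t. Proof. by rewrite sqr_sqrtr// ltW. Qed.
Let iwE t : iw t = (sw t)^-1. Proof. by rewrite /iw powR_inv1// ltW. Qed.

Let w_L1 : L1 w.
Proof. by apply: L1D; [exact: L1_opnorm|exact: L1_cst]. Qed.

Let sw_L2 : L2 sw.
Proof. by apply: L2_sqrt => [|t _|//]; [exact: L1_measurable w_L1|exact: ltW]. Qed.

Let cw t : C := (sw t)%:C%C.
Let ci t : C := (iw t)%:C%C.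

Let cw_ci t : cw t * ci t = 1.
Proof. by rewrite -rmorphM/= iwE mulfV ?gt_eqF. Qed.

Let cw_L2 : cL2 cw.
Proof.
split=> /=; first exact: sw_L2.
exact: (L2_cst 0).
Qed.

Let ci_meas : cmeas ci.
Proof.
apply: (@cmeasR R iw); have msw : measurable_fun D sw by exact: L2_measurable sw_L2.
exact: (measurableT_comp (measurable_powR (- 1 : R)) msw).
Qed.

(** Since the norm of [Psi] is at most [w], dividing by [w^(1/2)] leaves a function dominated by a
    multiple of [w^(1/2)], which is square integrable. *)
Let col_fun (c : 'cV[C]_m) (a : nat) : V := fun t => (echar a t * ci t) *: (Psi t *m c).
Let gens (N : nat) (X : V) := exists (a : nat) (c : 'cV[C]_m), (N <= a)%N /\ X = col_fun c a.

Let Psi_meas : mmeas Psi. Proof. by move=> i j; exact: cL1_meas. Qed.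

Let col_fun_mL2 c a : mL2 (col_fun c a).
Proof.
move=> i j; apply: (cL2_le _ (L2Z (vnorm c) sw_L2)).
  under eq_fun do rewrite mxE; apply: cmeasM; first by apply: cmeasM => //; exact: cmeas_echar.
  by have := mmeasM Psi_meas (fun a b => cmeas_cst (c a b)) i j.
apply: aeW => t; rewrite mxE !cmodM cmod_echar mul1r cmodR iwE ger0_norm ?invr_ge0 ?(ltW (sw_gt0 t))//.
rewrite mulrC ler_pdivrMr// -mulrA -expr2 sw_sqr.
apply: (@le_trans _ _ (vnorm (Psi t *m c))).
  by rewrite !ord1; have := cmod_le_vnorm (Psi t *m c) i.
apply: le_trans (opnormP _ _) _; rewrite mulrC ler_wpM2l ?vnorm_ge0// lerDl.
exact: ltW.
Qed.

Let gens_mL2 N X : gens N X -> mL2 X.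
Proof. by move=> [a [c [_ ->]]]; exact: col_fun_mL2. Qed.

Let gens_modulate (N : nat) j X : gens 0 X -> (N <= j)%N -> gens N (modulate j X).
Proof.
move=> [a [c [_ ->]]] Nj; exists (j + a)%N, c; split; first by rewrite (leq_trans Nj)// leq_addr.
by apply/funext => t; rewrite /modulate /col_fun scalerA mulrA -echarD PoszD.
Qed.

Let gens1_demodulate X : gens 1 X -> gens 0 (modulate (- 1) X).
Proof.
move=> [a [c [a1 ->]]]; exists a.-1, c; split=> //.
apply/funext => t; rewrite /modulate /col_fun scalerA mulrA -echarD; congr ((echar _ _ * _) *: _).
by case: a a1 => // a _; rewrite -addn1 PoszD addrCA addNr addr0 addn1.
Qed.

(** The shift-invariant space; its image under the shift is [cl1], whose generators are shifted at
    least once. *)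
Let cl0 := closure2 (span (gens 0)).
Let cl1 := closure2 (span (gens 1)).

Let cl1_cl0 X : cl1 X -> cl0 X.
Proof.
by apply: closure2_mono => Y; apply: span_mono => Z [a [c [_ ->]]]; exists a, c.
Qed.

Let cl0_modulate (j : nat) X : cl0 X -> (0 < j)%N -> cl1 (modulate j X).
Proof.
move=> h j0; apply: closure2_modulate h => Y; apply: span_modulate => Z gZ.
exact: gens_modulate.
Qed.

Let cl1_demodulate X : cl1 X -> cl0 (modulate (- 1) X).
Proof.
by apply: closure2_modulate => Y; apply: span_modulate => Z; exact: gens1_demodulate.
Qed.

(* The wandering subspace of the shift-invariant space [cl0]. *)
Let wandering (u : V) := cl0 u /\ forall Y, gens 1 Y -> cdot u Y = 0.

Let wandering_cdot u Y : wandering u -> cl1 Y -> cdot u Y = 0.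
Proof.
move=> [[u2 _] h] Yc; apply: (closure2_span_cdot0 _ u2 h Yc) => Z; exact: gens_mL2.
Qed.

(** One step of the Wold decomposition: the projection on [cl1] is shifted back, and the residual is
    wandering. *)
Let cl0_decomp X : cl0 X -> exists q v, [/\ wandering q, cl0 v & X = q + modulate 1 v].
Proof.
move=> cX; have [X2 _] := cX.
have [P clP hP] := span_projection (@gens_mL2 1) X2.
exists (X - P), (modulate (- 1) P); split.
- split=> //; apply: closure2_spanB => //; first exact: gens_mL2.
  exact: cl1_cl0.
- exact: cl1_demodulate.
- by rewrite modulateM subrr modulate0 subrK.
Qed.

Let wandering_scale c u : wandering u -> wandering (c *: u).
Proof.
move=> [uc u0]; have [u2 _] := uc; split=> [|Y gY].
  by apply: closure2_spanZ => //; exact: gens_mL2.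
by rewrite cdotZl ?u0 ?mulr0//; exact: gens_mL2 gY.
Qed.

Let wandering_sub u v : wandering u -> wandering v -> wandering (u - v).
Proof.
move=> [uc u0] [vc v0]; have [u2 _] := uc; have [v2 _] := vc; split=> [|Y gY].
  by apply: closure2_spanB => //; exact: gens_mL2.
by rewrite (cdotBl (gens_mL2 gY) u2 v2) (u0 _ gY) (v0 _ gY) subrr.
Qed.

Let wandering_mL2 u : wandering u -> mL2 u. Proof. by case=> -[]. Qed.

Let cdot_modulate_coef (u v : V) (j : int) : mL2 u -> mL2 v ->
  cdot u (modulate j v) = fcoef (fun t => ((u t)^t* *m v t) 0 0) (- j).
Proof.
move=> u2 v2; rewrite cdotE fcoefE opprK; congr cint; apply/funext => t.
by rewrite /modulate -scalemxAr linearZ/= /mxtrace big_ord1.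
Qed.

Let cL1_inner (u v : V) : mL2 u -> mL2 v -> cL1 (fun t => ((u t)^t* *m v t) 0 0).
Proof. by move=> u2 v2; exact: (mL2M (mL2_adj u2) v2). Qed.

Let wandering_inner_coef u v (j : nat) : wandering u -> wandering v -> (0 < j)%N ->
  fcoef (fun t => ((u t)^t* *m v t) 0 0) (- j%:Z) = 0.
Proof.
move=> hu hv j0; rewrite -cdot_modulate_coef; [|exact: wandering_mL2..].
by apply: wandering_cdot => //; apply: cl0_modulate => //; case: hv.
Qed.

(* All nonzero Fourier coefficients of the pointwise inner product vanish. *)
Let wandering_inner u v : wandering u -> wandering v ->
  exists c, {ae mu, forall t, ((u t)^t* *m v t) 0 0 = c}.
Proof.
move=> hu hv; have u2 := wandering_mL2 hu; have v2 := wandering_mL2 hv.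
set h := fun t => ((u t)^t* *m v t) 0 0; have h1 : cL1 h by exact: cL1_inner.
exists (fcoef h 0).
have hj : fcoef_null (fun t => h t + - fcoef h 0).
  split=> [|j]; first by apply: cL1D => //; exact: cL1_cst.
  rewrite fcoefD//; last exact: cL1_cst.
  have -> : fcoef (fun=> - fcoef h 0) j = - fcoef h 0 * cint (echar (- j) : R -> C).
    rewrite fcoefE -cintZ; last by apply: cL2_L1; exact: cL2_echar1.
    by congr cint; apply/funext => t; rewrite mulrC.
  have [->|j0] := eqVneq j 0.
    rewrite oppr0 (_ : cint _ = 1) ?mulr1 ?subrr//.
    by rewrite -[RHS](cint_cst 1); congr cint; apply/funext => t; rewrite echar0.
  rewrite cint_echar ?oppr_eq0// mulr0 addr0.
  case: j j0 => j j0; last by rewrite NegzE; exact: wandering_inner_coef.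
  (* Positive indices reduce to negative ones by exchanging [u] and [v] and conjugating. *)
  have -> : h = fun t => Num.conj (((v t)^t* *m u t) 0 0).
    by apply/funext => t; rewrite /h -adjE adjM trmxCK.
  rewrite fcoefJ; last exact: cL1_inner.
  by rewrite wandering_inner_coef ?conjC0// lt0n.
by apply: filterS (fcoef_inj0 hj) => t /eqP; rewrite subr_eq0 => /eqP.
Qed.

Let orthoframe r (U : R -> 'M[C]_(n, r)) :=
  (forall i, wandering (fun t => col i (U t))) /\ {ae mu, forall t, (U t)^t* *m U t = 1%:M}.

(** Finite combinations take values in the column space of [Psi t], where the rank hypothesis is
    available. *)
Let span_range X : span (gens 0) X -> exists x : R -> 'cV[C]_m, forall t, X t = Psi t *m x t.
Proof.
elim=> [|c Y Z [a [d [_ ->]]] _ [z hz]].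
  by exists (fun=> 0) => t; rewrite mulmx0.
exists (fun t => (c * (echar a t * ci t)) *: d + z t) => t.
by rewrite mulmxDr -hz -scalemxAr -scalerA.
Qed.

(** The columns of [U] are approximated in [L^2] by functions of the form [Psi x]. If [k < r], these
    form matrices of deficient rank, at squared distance at least 1 from the isometry at almost
    every point. *)
Let orthoframe_rank r (U : R -> 'M[C]_(n, r)) : orthoframe U -> (r <= k)%N.
Proof.
move=> [hU UU]; rewrite leqNgt; apply/negP => kr.
(* With this precision the total squared error is at most [r / (r + 1)^2], less than 1. *)
pose e : R := (r.+1%:R)^-1; have e0 : 0 < e by rewrite invr_gt0 ltr0n.
have /fin_all_exists[x hx] : forall i : 'I_r, exists x : R -> 'cV[C]_m,
    mL2 (fun t => Psi t *m x t) /\ nrm ((fun t => col i (U t)) - (fun t => Psi t *m x t)) <= e.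
  move=> i; have [[_ /(_ e e0)[Y sY UY]] _] := hU i.
  have Y2 := span_mL2 (@gens_mL2 0) sY.
  have [x hx] := span_range sY; have YE : Y = fun t => Psi t *m x t by apply/funext.
  by exists x; rewrite -YE.
pose Y t := Psi t *m (\matrix_(a, i) x i t a 0).
have colY i t : col i (Y t) = Psi t *m x i t.
  by apply/matrixP => a b; rewrite !ord1 !mxE; apply: eq_bigr => c _; rewrite mxE.
have ge1 : {ae mu, forall t, 1 <= \sum_i frob2 (col i (U t) - Psi t *m x i t)}.
  apply: filterS2 UU Psi_rank => t UUt rt.
  have -> : \sum_i frob2 (col i (U t) - Psi t *m x i t) = frob2 (U t - Y t).
    rewrite [RHS]exchange_big; apply: eq_bigr => i _; apply: eq_bigr => a _.
    by rewrite big_ord1 -colY !mxE.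
  apply: frob2_isometry_rank => //.
  by rewrite (leq_ltn_trans _ kr)// (leq_trans (mxrankM_maxl _ _)).
have d2 i : mL2 ((fun t => col i (U t)) - (fun t => Psi t *m x i t)).
  by apply: mL2B; [exact: wandering_mL2|case: (hx i)].
have Ld i : L1 (fun t => frob2 (col i (U t) - Psi t *m x i t)) by exact: (L1_frob2 (d2 i)).
have h1 : 1 <= \sum_i nrm2 ((fun t => col i (U t)) - (fun t => Psi t *m x i t)).
  have -> : \sum_i nrm2 ((fun t => col i (U t)) - (fun t => Psi t *m x i t)) =
      Int (fun t => \sum_i frob2 (col i (U t) - Psi t *m x i t)).
    by rewrite Int_sum//; apply: eq_bigr => i _; rewrite nrm2E.
  rewrite -[leLHS](Int1_cst (1 : R)); apply: Int_ae_le; [exact: L1_cst|exact: L1_sum|].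
  by apply: filterS ge1 => t.
have h2 : \sum_i nrm2 ((fun t => col i (U t)) - (fun t => Psi t *m x i t)) <= r%:R * e ^+ 2.
  rewrite -[leRHS](_ : \sum_(i < r) e ^+ 2 = _); last by rewrite sumr_const card_ord mulr_natl.
  apply: ler_sum => i _; rewrite -nrm_sqr lerXn2r ?nnegrE ?nrm_ge0 ?(ltW e0)//.
  by case: (hx i).
have := le_trans h1 h2; apply/negP; rewrite -ltNge /e exprVn ltr_pdivrMr ?exprn_gt0// mul1r.
by rewrite -natrX ltr_nat; lia.
Qed.

Let ae_ex (P : R -> Prop) : {ae mu, forall t, P t} -> exists t, P t.
Proof.
move=> h; apply: contrapT => /forallNP hN.
have [N [mN N0 sN]] := h; have := mT_setT_gt0 R.
rewrite (_ : setT = N); first by move=> /lt_eqF; rewrite [X in (_ == X)%E]N0 eqxx.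
by apply/esym/seteqP; split=> // t _; apply: sN; exact: hN.
Qed.

Let wandering_comb r (U : R -> 'M[C]_(n, r)) (c : 'cV[C]_r) :
  (forall i, wandering (fun t => col i (U t))) -> wandering (fun t => U t *m c).
Proof.
move=> hU.
have w0 : wandering 0.
  split=> [|Y gY]; first by apply: closure2_sub; [exact: mL2_0|exact: span0].
  by rewrite -(scale0r (0 : V)) cdotZl ?conjC0 ?mul0r//; [exact: mL2_0|exact: gens_mL2 gY].
have -> : (fun t => U t *m c) = fun t => \sum_(i <- index_enum 'I_r) c i 0 *: col i (U t).
  apply/funext => t; apply/matrixP => a b; rewrite !ord1 mxE summxE; apply: eq_bigr => i _.
  by rewrite !mxE mulrC.
elim: (index_enum _) => [|i s ih].
  by rewrite (_ : (fun t => _) = 0)//; apply/funext => t; rewrite big_nil.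
rewrite (_ : (fun t => _) = (c i 0 *: (fun t => col i (U t)))
    - (-1) *: (fun t => \sum_(i <- s) c i 0 *: col i (U t))); last first.
  by apply/funext => t; rewrite big_cons scaleN1r opprK.
by apply: wandering_sub; apply: wandering_scale.
Qed.

Let adj_mul_entry r (U : 'M[C]_(n, r)) (q : 'cV[C]_n) i :
  (U^t* *m q) i 0 = ((col i U)^t* *m q) 0 0.
Proof. by rewrite !mxE; apply: eq_bigr => a _; rewrite !mxE. Qed.

Let orthoframe_extend r (U : R -> 'M[C]_(n, r)) (q : V) : orthoframe U -> wandering q ->
  {ae mu, forall t, (U t)^t* *m q t = 0} -> {ae mu, forall t, (q t)^t* *m q t = 1%:M} ->
  orthoframe (fun t => row_mx (U t) (q t)).
Proof.
move=> [hU UU] hq Uq qq; split=> [i|].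
  case: (split_ordP i) => j ->.
    by rewrite (_ : (fun t => _) = fun t => col j (U t))//; apply/funext => t; rewrite colKl.
  rewrite (_ : (fun t => _) = q)//; apply/funext => t; rewrite colKr.
  by apply/matrixP => a b; rewrite !ord1 !mxE.
apply: filterS3 UU Uq qq => t UUt Uqt qqt.
rewrite tr_row_mx map_col_mx mul_col_row UUt Uqt qqt.
have -> : (q t)^t* *m U t = 0 by rewrite -[LHS]trmxCK adjM trmxCK Uqt trmx0 map_mx0.
by rewrite -scalar_mx_block.
Qed.

(** The coefficients of a wandering [q] along the frame are constants, so its residual is again
    wandering and of constant length. A nonzero residual, normalized, would extend the frame. *)
Let orthoframe_max : exists r (U : R -> 'M[C]_(n, r)), orthoframe U /\
  forall q, wandering q -> {ae mu, forall t, q t = U t *m ((U t)^t* *m q t)}.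
Proof.
pose P r := `[< exists U : R -> 'M[C]_(n, r), orthoframe U >].
have exP : exists r, P r.
  (* The search starts from the empty frame and is bounded by [k]. *)
  exists 0%N; apply/asboolP; exists (fun=> 0); split; first by case.
  by apply: aeW => t; apply/matrixP => -[].
have ubP r : P r -> (r <= k)%N by move=> /asboolP[U]; exact: orthoframe_rank.
case: (ex_maxnP exP ubP) => r /asboolP[U oU] rmax; exists r, U; split=> // q hq.
have [hU UU] := oU.
have /fin_all_exists[c hc] : forall i, exists c, {ae mu, forall t, ((col i (U t))^t* *m q t) 0 0 = c}.
  by move=> i; exact: wandering_inner.
pose cv : 'cV[C]_r := \col_i c i.
have Uq : {ae mu, forall t, (U t)^t* *m q t = cv}.
  apply: filterS (filter_forall (mT_ae_filter R) hc) => t ht.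
  by apply/matrixP => i b; rewrite ord1 adj_mul_entry ht mxE.
pose q' : V := q - (fun t => U t *m cv).
have hq' : wandering q' by apply: wandering_sub => //; exact: wandering_comb.
have Uq' : {ae mu, forall t, (U t)^t* *m q' t = 0}.
  apply: filterS2 UU Uq => t UUt Uqt.
  by rewrite (_ : q' t = q t - U t *m cv)// mulmxBr Uqt mulmxA UUt mul1mx subrr.
have [g hg] := wandering_inner hq' hq'.
have [t0 ht0] := ae_ex hg; rewrite vdot_self in ht0.
have [v0|vn] := eqVneq (vnorm (q' t0)) 0.
  apply: filterS2 hg Uq => t; rewrite -ht0 v0 expr0n/= vdot_self => /complexI/eqP.
  rewrite sqrf_eq0 => /eqP/vnorm_eq0 q'0 ->.
  by apply/eqP; rewrite -subr_eq0; apply/eqP.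
exfalso; set v := vnorm (q' t0) in vn ht0.
have : P (r + 1)%N.
  apply/asboolP; exists (fun t => row_mx (U t) ((v^-1%:C%C *: q') t)).
  apply: orthoframe_extend => //; first exact: wandering_scale.
    by apply: filterS Uq' => t h; rewrite -scalemxAr h scaler0.
  apply: filterS hg => t h.
  rewrite adjZ -scalemxAl -scalemxAr scalerA conj_real -rmorphM/=.
  apply/matrixP => a b; rewrite !ord1 mxE h -ht0 -rmorphM/= mxE eqxx mulr1n.
  by rewrite -[RHS](rmorph1 (real_complex R)); congr (_%:C%C); field.
by move/rmax; rewrite addn1 ltnn.
Qed.

(** The coefficient is an inner product with [Y], hence continuous on [cl0]. On a generator the
    weights cancel and leave a shifted column combination of [Psi], whose mean is zero as well. *)
Let cw_cl0_analytic0 v i : cl0 v -> analytic0 (fun t => cw t * v t i 0).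
Proof.
move=> cv l; pose Y t := Num.conj (echar l%:Z t * cw t) *: (delta_mx i 0 : 'cV[C]_n).
have Y2 : mL2 Y.
  move=> a b; under eq_fun do rewrite mxE mulrC.
  apply: cL2Z; apply: cL2J; exact: cL2_echar.
have YE X : cdot Y X = cint (fun t => echar l%:Z t * (cw t * X t i 0)).
  rewrite cdotE; congr cint; apply/funext => t.
  rewrite /Y adjZ conjCK -scalemxAl linearZ/= trace_adj_mul -mulrA; congr (_ * _); congr (_ * _).
  rewrite (bigD1 i)//= big_ord1 big1 ?addr0 => [|a /negbTE ai].
    by rewrite mxE !eqxx conjC1 mul1r.
  by rewrite big_ord1 mxE ai conjC0 mul0r.
rewrite fcoefE opprK -YE; apply: (closure2_span_cdot0 (@gens_mL2 0) Y2 _ cv) => _ [a [c [_ ->]]].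
rewrite YE (_ : (fun t => _) = fun t => \sum_b c b 0 * (echar (l + a)%N t * Psi t i b)); last first.
  apply/funext => t; rewrite /col_fun !mxE PoszD echarD.
  rewrite !mulr_sumr; apply: eq_bigr => b _.
  transitivity (cw t * ci t * (c b 0 * (echar l t * echar a t * Psi t i b))); first by ring.
  by rewrite cw_ci mul1r.
rewrite cint_sum => [|b]; last by apply: cL1Z; exact: cL1_echar.
rewrite big1// => b _; rewrite cintZ; last exact: cL1_echar.
by have := Psi_an i b (l + a); rewrite fcoefE opprK => ->; rewrite mulr0.
Qed.

Let orthoframe_bounded r (U : R -> 'M[C]_(n, r)) : orthoframe U ->
  {ae mu, forall t, opnorm (U t) <= 1}.
Proof.
move=> [_]; apply: filterS => t UU; apply: le_trans (opnorm1 R r).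
by apply: opnorm_isometry; rewrite UU adj1 mulmx1.
Qed.

Let orthoframe_mL2 r (U : R -> 'M[C]_(n, r)) : orthoframe U -> mL2 U.
Proof.
move=> [hU _] i j; have := wandering_mL2 (hU j) i 0.
by under eq_fun do rewrite mxE.
Qed.

Let orthoframe_adj_mL2 r (U : R -> 'M[C]_(n, r)) (v : V) : orthoframe U -> mL2 v ->
  mL2 (fun t => (U t)^t* *m v t).
Proof.
move=> oU v2; have U2 := orthoframe_mL2 oU.
apply: (@bounded_mul_mL2 _ 1 _ _ _ (fun t => (U t)^t* )) => //.
  exact: (mL2_meas (mL2_adj U2)).
apply: filterS (orthoframe_bounded oU) => t h i j.
by rewrite adjE cmodJ (le_trans (cmod_le_opnorm _ _ _)).
Qed.

(** The coefficient at [-j] is the inner product of a wandering vector with the [j]-fold shift of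
    [v], which lies in [cl1]. *)
Let orthoframe_coef_analytic r (U : R -> 'M[C]_(n, r)) v i : orthoframe U -> cl0 v ->
  analytic (fun t => ((U t)^t* *m v t) i 0).
Proof.
move=> [hU _] cv j j0; rewrite (_ : (fun t => _) = fun t => ((col i (U t))^t* *m v t) 0 0); last first.
  by apply/funext => t; rewrite adj_mul_entry.
have [v2 _] := cv.
rewrite -cdot_modulate_coef//; last exact: wandering_mL2.
by apply: wandering_cdot => //; exact: cl0_modulate.
Qed.

Let cw_frame_mL2 r (U : R -> 'M[C]_(n, r)) : orthoframe U -> mL2 (fun t => cw t *: U t).
Proof.
move=> oU i j; under eq_fun do rewrite mxE mulrC; apply: (@cbd_cL2 _ 1) => //.
  exact: (mL2_meas (orthoframe_mL2 oU)).
apply: filterS (orthoframe_bounded oU) => t; exact: le_trans (cmod_le_opnorm _ _ _).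
Qed.

Let cw_frame_analytic0 r (U : R -> 'M[C]_(n, r)) : orthoframe U ->
  forall i j, analytic0 (fun t => (cw t *: U t) i j).
Proof.
move=> [hU _] i j; have [cU _] := hU j; have := cw_cl0_analytic0 i cU.
rewrite (_ : (fun t => cw t * _) = fun t => (cw t *: U t) i j)//.
by apply/funext => t; rewrite !mxE.
Qed.

(* The defect of [v] is divisible by every power of the shift, since [v] is the sum of a wandering
   vector and of a shifted element of [cl0]. *)
Let orthoframe_defect r (U : R -> 'M[C]_(n, r)) : orthoframe U ->
  (forall q, wandering q -> {ae mu, forall t, q t = U t *m ((U t)^t* *m q t)}) ->
  forall v, cl0 v -> {ae mu, forall t, v t = U t *m ((U t)^t* *m v t)}.
Proof.
(* Weighted by [w^(1/2)], the defect is integrable and has the Fourier coefficients of an analytic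
   function of mean zero. *)
move=> oU hU; pose h (v : V) i t := cw t * (v t - U t *m ((U t)^t* *m v t)) i 0.
have UUv (v : V) i : (fun t => cw t * (U t *m ((U t)^t* *m v t)) i 0) =
    fun t => \sum_a ((U t)^t* *m v t) a 0 * (cw t *: U t) i a.
  apply/funext => t; rewrite [in LHS]mxE mulr_sumr; apply: eq_bigr => a _.
  by rewrite [in RHS]mulrC [in RHS]mxE mulrA.
have UUv1 (v : V) i a : mL2 v -> cL1 (fun t => ((U t)^t* *m v t) a 0 * (cw t *: U t) i a).
  by move=> v2; apply: cL2M; [exact: orthoframe_adj_mL2|exact: cw_frame_mL2].
have hE (v : V) i : h v i = fun t => cw t * v t i 0 + - 1 * (cw t * (U t *m ((U t)^t* *m v t)) i 0).
  by apply/funext => t; rewrite /h !mxE mulN1r mulrBr.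
have vcw (v : V) i : mL2 v -> cL1 (fun t => cw t * v t i 0) by move=> v2; exact: cL2M.
have UUcw (v : V) i : mL2 v -> cL1 (fun t => cw t * (U t *m ((U t)^t* *m v t)) i 0).
  by move=> v2; rewrite UUv; apply: cL1_sum => a; exact: UUv1.
have h1 (v : V) i : mL2 v -> cL1 (h v i).
  by move=> v2; rewrite hE; apply: cL1D; [exact: vcw|apply: cL1Z; exact: UUcw].
have base v i : cl0 v -> analytic0 (h v i).
  move=> cv j; have [v2 _] := cv; rewrite hE fcoefD; [|exact: vcw|by apply: cL1Z; exact: UUcw].
  rewrite cw_cl0_analytic0// add0r fcoefZ; last exact: UUcw.
  rewrite UUv fcoef_sum => [|a]; last exact: UUv1.
  rewrite big1 ?mulr0// => a _.
  apply: (fcoef_mul_analytic (orthoframe_adj_mL2 oU v2 a 0) _ (cw_frame_mL2 oU i a) _ (leq0n j)).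
    exact: orthoframe_coef_analytic.
  by move=> l _; exact: cw_frame_analytic0.
(* Every integer is some [N - j]. The wandering part has no defect, so the defect of [v] is the
   shifted defect of [u], and the index drops by one at each induction step. *)
have coef (N j : nat) v i : cl0 v -> fcoef (h v i) (N%:Z - j%:Z) = 0.
  elim: N v => [|N ih] v cv; first by rewrite add0r base.
  have [q [u [wq cu vE]]] := cl0_decomp cv.
  have [v2 _] := cv; have [u2 _] := cu.
  rewrite (@fcoef_ae_eq _ _ (fun t => echar 1 t * h u i t)).
  - rewrite fcoef_echar (_ : N.+1%:Z - j%:Z - 1 = N%:Z - j%:Z) ?ih//; lia.
  - by apply: cL1_meas; exact: h1.
  - by apply: cL1_meas; apply: cL1_echar; exact: h1.
  apply: filterS (hU q wq) => t qE; rewrite /h vE mulrCA; congr (_ * _).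
  rewrite (_ : (q + modulate 1 u) t = q t + echar 1 t *: u t)// !mulmxDr -qE.
  by rewrite -!scalemxAr opprD addrACA subrr add0r -scalerBr mxE.
move=> v cv; have [v2 _] := cv.
have hv0 : forall i, {ae mu, forall t, h v i t = 0}.
  move=> i; apply: fcoef_inj0; split=> [|j]; first exact: h1.
  case: j => j; first by have := coef j 0%N v i cv; rewrite subr0.
  by have := coef 0%N j.+1 v i cv; rewrite sub0r.
apply: filterS (filter_forall (mT_ae_filter R) hv0) => t ht.
apply/eqP; rewrite -subr_eq0; apply/eqP/matrixP => i b; rewrite ord1 [RHS]mxE.
have /eqP := ht i; rewrite /h mulf_eq0 => /orP[/eqP cw0|/eqP//].
by have := cw_ci t; rewrite cw0 mul0r => /eqP; rewrite eq_sym oner_eq0.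
Qed.


Theorem analytic_factorization : exists (F : R -> 'M[C]_(n, k)) (G : R -> 'M[C]_(k, m)),
  [/\ hardy2 F, mL2 G /\ (forall i j, analytic0 (fun t => G t i j)),
      {ae mu, forall t, Psi t = F t *m G t},
      {ae mu, forall t, opnorm (F t) ^+ 2 <= opnorm (Psi t) + eps} &
      {ae mu, forall t, opnorm (G t) ^+ 2 <= opnorm (Psi t) + eps}].
Proof.
have [r [U [oU hU]]] := orthoframe_max.
have rk := orthoframe_rank oU.
(* The frame has [r <= k] columns; [J] pads them with zeros to [k] and cancels against its adjoint
   in the product. *)
have [J [JJ J1]] : exists J : 'M[C]_(r, k), J *m J^t* = 1%:M /\ opnorm J <= 1.
  pose J : 'M[C]_(r, k) := pid_mx r.
  have JJ : J *m J^t* = 1%:M.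
    rewrite /J tr_pid_mx map_pid_mx mul_pid_mx minnn.
    by rewrite (minn_idPr rk) pid_mx_1.
  exists J; split=> //; rewrite -opnorm_adj; apply: le_trans (opnorm1 R r).
  by apply: opnorm_isometry; rewrite trmxCK JJ adj1 mulmx1.
pose F0 t := (cw t *: U t) *m J; pose G0 t := J^t* *m (ci t *: ((U t)^t* *m Psi t)).
have colE l t : ci t *: (Psi t *m delta_mx l 0) = col_fun (delta_mx l 0) 0 t.
  by rewrite /col_fun echar0 mul1r.
have ccl l : cl0 (col_fun (delta_mx l 0) 0).
  apply: closure2_sub; first exact: col_fun_mL2.
  by apply: span_gen; exists 0%N, (delta_mx l 0).
have GE i l t : (ci t *: ((U t)^t* *m Psi t)) i l = ((U t)^t* *m col_fun (delta_mx l 0) 0 t) i 0.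
  rewrite -colE -scalemxAr mulmxA mul_delta_col !mxE; congr (_ * _).
have Gh : hardy2 (fun t => ci t *: ((U t)^t* *m Psi t)).
  split=> i l; under eq_fun do rewrite GE.
    by apply: (orthoframe_adj_mL2 oU); exact: col_fun_mL2.
  exact: orthoframe_coef_analytic.
have UUPsi : {ae mu, forall t, Psi t = U t *m ((U t)^t* *m Psi t)}.
  (* The weighted columns of [Psi] are unshifted generators, so they lie in [cl0] and have no
     defect. *)
  have h l := orthoframe_defect oU hU (ccl l).
  apply: filterS (filter_forall (mT_ae_filter R) h) => t ht.
  apply/matrixP => a l; have := congr1 (fun x => cw t *: x) (ht l).
  rewrite -!colE -!scalemxAr !scalerA cw_ci !scale1r !mulmxA !mul_delta_col.
  by move=> /(congr1 (fun x : 'cV[C]_n => x a 0)); rewrite mxE [RHS]mxE.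
(* [F0] inherits the zero mean of [Psi], while [G0] is merely analytic; opposite shifts transfer the
   zero to [G] and leave the product unchanged. *)
exists (modulate (- 1) F0), (modulate 1 G0).
have F02 : mL2 F0 by apply: mL2_mul_cst; exact: cw_frame_mL2.
have G02 : mL2 G0.
  move=> i j; have := mL2_adj (mL2_mul_cst J (mL2_adj (proj1 Gh))) i j.
  by under eq_fun do rewrite adjM trmxCK.
split.
- split=> [|i j]; first exact: modulate_mL2.
  rewrite (_ : (fun t => _) = fun t => echar (- 1) t * F0 t i j); last by apply/funext => t; rewrite mxE.
  apply: analytic0_shift; apply: (analytic0_mulr (hardy2_cst J) (cw_frame_mL2 oU)).
  exact: cw_frame_analytic0.
- split=> [|i j]; first exact: modulate_mL2.
  rewrite (_ : (fun t => _) = fun t => (J^t* *m modulate 1 (fun t => ci t *: ((U t)^t* *m Psi t)) t) i j); last first.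
    by apply/funext => t; rewrite /modulate -scalemxAr.
  apply: (analytic0_mul (hardy2_cst (J^t* )) (modulate_mL2 1 (proj1 Gh))) => a b.
  rewrite (_ : (fun t => _) = fun t => echar 1 t * (ci t *: ((U t)^t* *m Psi t)) a b); last first.
    by apply/funext => t; rewrite mxE.
  by apply: analytic_shift; exact: (proj2 Gh).
- apply: filterS UUPsi => t ht.
  rewrite /modulate -scalemxAl -scalemxAr scalerA -echarD addNr echar0 scale1r /F0 /G0.
  rewrite -mulmxA (mulmxA J) JJ mul1mx -scalemxAl -scalemxAr scalerA cw_ci scale1r.
  exact: ht.
- apply: filterS (orthoframe_bounded oU) => t ht; rewrite -/(w t) -sw_sqr.
  rewrite lerXn2r ?nnegrE ?opnorm_ge0 ?(ltW (sw_gt0 t))//.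
  apply: le_trans (opnormZ_le _ _) _; rewrite cmod_echar mul1r.
  apply: le_trans (opnormM _ _) _; rewrite -[leRHS]mulr1; apply: ler_pM; rewrite ?opnorm_ge0//.
  apply: le_trans (opnormZ_le _ _) _; rewrite cmodR ger0_norm ?(ltW (sw_gt0 t))//.
  by rewrite ler_piMr ?(ltW (sw_gt0 t)).
apply: filterS (orthoframe_bounded oU) => t ht; rewrite -/(w t) -sw_sqr.
rewrite lerXn2r ?nnegrE ?opnorm_ge0 ?(ltW (sw_gt0 t))//.
apply: le_trans (opnormZ_le _ _) _; rewrite cmod_echar mul1r.
apply: le_trans (opnormM _ _) _; rewrite opnorm_adj -[leRHS]mul1r; apply: ler_pM; rewrite ?opnorm_ge0//.
apply: le_trans (opnormZ_le _ _) _; rewrite cmodR iwE ger0_norm ?invr_ge0 ?(ltW (sw_gt0 t))//.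
rewrite mulrC ler_pdivrMr// -expr2 sw_sqr.
apply: le_trans (opnormM _ _) _; rewrite opnorm_adj.
apply: (@le_trans _ _ (opnorm (Psi t))); first by rewrite ler_piMl ?opnorm_ge0.
by rewrite lerDl ltW.
Qed.

End Factorization.

(** * The two inequalities *)

Section Main.
Context (R : realType).
Local Notation mu := (@mT R).
Local Notation D := (@circ_set R).
Local Notation C := (complex R).
Local Notation L1 := (L1 mu D).
Local Notation L2 := (L2 mu D).
Local Notation Int := (Int mu D).

Lemma cint_fcoef0 (f : R -> C) : cint f = fcoef f 0.
Proof. by rewrite fcoefE; congr cint; apply/funext => t; rewrite oppr0 echar0 mul1r. Qed.

Lemma cint_trace_hardy2 p q (H : R -> 'M[C]_(p, q)) (G : R -> 'M[C]_(q, p)) : hardy2 H -> mL2 G ->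
  (forall i j, analytic0 (fun t => G t i j)) -> cint (fun t => \tr (H t *m G t)) = 0.
Proof.
move=> hH G2 Ga; have [H2 _] := hH; have HG : mL1 (fun t => H t *m G t) by exact: mL2M.
rewrite cint_sum => [|i]; last exact: HG.
rewrite big1// => i _; rewrite cint_fcoef0; exact: (analytic0_mul hH G2 Ga i i 0%N).
Qed.

Section Inequalities.
Context (m n k : nat) (Phi : R -> 'M[C]_(m, n)) (Phi_oo : mxLp +oo%E Phi).

Lemma Phi_mul_mL2 q (F : R -> 'M[C]_(n, q)) : mL2 F -> mL2 (fun t => Phi t *m F t).
Proof.
by have [mP [M hM]] := mxLpy_bounded Phi_oo => F2; exact: (@bounded_mul_mL2 _ M).
Qed.

Lemma Phi_mul_mL1 q (F : R -> 'M[C]_(n, q)) : mL1 F -> mL1 (fun t => Phi t *m F t).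
Proof.
by have [mP [M hM]] := mxLpy_bounded Phi_oo => F2; exact: (@bounded_mul_mL1 _ M).
Qed.

Lemma A_k_0 : A_k k (fun=> 0 : 'M[C]_(n, m)).
Proof.
have [H2 Ha] := hardy2_0 R n m.
split.
- apply/mxHp01P; split=> [|i j l]; first exact: mL2_L1.
  rewrite fcoefE -[RHS](cint0 R); congr cint; apply/funext => t; by rewrite mxE mulr0.
- rewrite normXM1E; last exact: mL2_L1.
  rewrite (_ : (fun t => _) = fun=> 0) ?Int1_cst ?lee_fin ?ler01//.
  by apply/funext => t; rewrite opnorm0.
- by apply: aeW => t; rewrite mxrank0.
Qed.

Lemma sigma_k_ge0 : (0 <= sigma_k k Phi)%E.
Proof.
apply: le_trans (_ : ((cmod (cint (fun t => \tr (Phi t *m (0 : 'M[C]_(n, m))))))%:E <= _)%E).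
  by rewrite lee_fin cmod_ge0.
by apply: ereal_sup_ubound; exists (fun=> 0) => //; exact: A_k_0.
Qed.

Lemma mem_A_k_mul (F : R -> 'M[C]_(n, k)) (Z : R -> 'M[C]_(k, m)) : hardy2 F -> mL2 Z ->
  (forall i j, analytic0 (fun t => Z t i j)) -> Int (fun t => opnorm (F t) ^+ 2) <= 1 ->
  Int (fun t => opnorm (Z t) ^+ 2) <= 1 -> A_k k (fun t => F t *m Z t).
Proof.
move=> hF Z2 Za F1 Z1; have [F2 _] := hF; have FZ : mL1 (fun t => F t *m Z t) by exact: mL2M.
split.
- by apply/mxHp01P; split=> // i j; exact: analytic0_mul.
- rewrite normXM1E// lee_fin.
  have oF := L2_opnorm F2; have oZ := L2_opnorm Z2.
  apply: (@le_trans _ _ (Int (fun t => opnorm (F t) * opnorm (Z t)))).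
    apply: Int_le; [exact: L1_opnorm|exact: L2M|] => t _; exact: opnormM.
  apply: le_trans (Int_mul_le_sqrt oF oZ) _; rewrite -[leRHS]mulr1.
  by apply: ler_pM; rewrite ?sqrtr_ge0// -sqrtr1 ler_wsqrtr.
by apply: aeW => t; rewrite (leq_trans (mxrankM_maxl _ _))// rank_leq_col.
Qed.

Lemma le_trnrm_of_quot (F : R -> 'M[C]_(n, k)) d H : mL2 F -> hardy2 H ->
  (d%:E <= hankel_quot_norm Phi F)%E -> d <= trnrm ((fun t => Phi t *m F t) - H).
Proof.
move=> F2 hH; have [H2 _] := hH; have D2 := mL2B (Phi_mul_mL2 F2) H2 => dQ.
rewrite -lee_fin trnrmE -normXS12E//; apply: le_trans dQ _.
by apply: ereal_inf_lbound; exists H => //; apply/mxHp2P.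
Qed.

Lemma hankel_norm_le_sigma_k : (hankel_norm k Phi <= sigma_k k Phi)%E.
Proof.
apply: ge_ereal_sup => _ [F /= [/mxHp2P hF F1] <-]; have [F2 _] := hF.
rewrite leNgt; apply/negP => sQ.
have [s sE] : exists s, sigma_k k Phi = s%:E.
  move: sigma_k_ge0 sQ; case: (sigma_k k Phi) => [s _ _|_|//]; first by exists s.
  by rewrite ltNge leey.
have s0 : 0 <= s by rewrite -lee_fin -sE; exact: sigma_k_ge0.
(* A real lower bound for the quotient norm; if that norm is infinite, any real above [s] will
   do. *)
have [d sd dQ] : exists2 d, s < d & (d%:E <= hankel_quot_norm Phi F)%E.
  move: sQ; rewrite sE; case: (hankel_quot_norm Phi F) => [q|_|//].
    by rewrite lte_fin => h; exists q.
  by exists (s + 1); rewrite ?leey// ltrDl.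
(* The midpoint is below the distance, as the duality requires, and above [s], so that the resulting
   competitor exceeds the supremum. *)
have [r0 rd sr] : [/\ 0 < (s + d) / 2, (s + d) / 2 < d & s < (s + d) / 2] by split; lra.
have W2 := Phi_mul_mL2 F2.
have hd H : hardy2 H -> d <= trnrm ((fun t => Phi t *m F t) - H).
  by move=> hH; exact: le_trnrm_of_quot.
have [Z [Z2 Za Z1 rZ]] := trnrm_dual W2 r0 rd hd.
have : A_k k (fun t => F t *m Z t).
  apply: mem_A_k_mul => //; move: F1; rewrite normXM2E// lee_fin => F1.
  have : 0 <= Int (fun t => opnorm (F t) ^+ 2) by apply: Int_ge0 => t _; exact: sqr_ge0.
  move: F1; move: (Int _) => a a1 a0.
  by rewrite -(sqr_sqrtr a0) expr_le1// sqrtr_ge0.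
move=> AZ.
have : (((cmod (cint (fun t => \tr (Phi t *m (F t *m Z t)))))%:E <= sigma_k k Phi)%E).
  by apply: ereal_sup_ubound; exists (fun t => F t *m Z t).
rewrite sE lee_fin leNgt => /negP; apply; apply: lt_le_trans sr _.
by under eq_fun do rewrite mulmxA.
Qed.

Lemma cmod_pairing_le (Psi : R -> 'M[C]_(n, m)) e : A_k k Psi -> 0 < e ->
  ((cmod (cint (fun t => \tr (Phi t *m Psi t))) / (1 + e))%:E <= hankel_norm k Phi)%E.
Proof.
move=> [/mxHp01P[Psi1 Psia] Psin Psir] e0.
have [F [G [hF [G2 Ga] PFG oF oG]]] := analytic_factorization Psi1 Psia Psir e0.
have [F2 _] := hF.
have o1 : L1 (fun t => opnorm (Psi t)) by exact: L1_opnorm.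
have w1 : L1 (fun t => opnorm (Psi t) + e) by apply: L1D => //; exact: L1_cst.
pose c2 := Int (fun t => opnorm (Psi t) + e).
have c2e : c2 <= 1 + e.
  rewrite /c2 IntD//; last exact: L1_cst.
  by rewrite Int1_cst lerD2r; move: Psin; rewrite normXM1E// lee_fin.
have c2e' : e <= c2.
  rewrite /c2 IntD//; last exact: L1_cst.
  by rewrite Int1_cst lerDr; apply: Int_ge0 => t _; exact: opnorm_ge0.
have c20 : 0 < c2 by exact: lt_le_trans c2e'.
have IF : Int (fun t => opnorm (F t) ^+ 2) <= c2.
  apply: Int_ae_le => //; first by have [] := L2_opnorm F2.
  by apply: filterS oF => t h _.
have IG : Int (fun t => opnorm (G t) ^+ 2) <= c2.
  apply: Int_ae_le => //; first by have [] := L2_opnorm G2.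
  by apply: filterS oG => t h _.
(* [F] is divided by [c] to enter the unit ball, and the [L^2] norm of [G] is at most [c]; the two
   factors combine to [c2], at most [1 + e]. *)
clearbody c2; pose c := Num.sqrt c2.
have c0 : 0 < c by rewrite sqrtr_gt0.
have cc : c * c = c2 by rewrite -expr2 sqr_sqrtr// ltW.
have ci0 : 0 <= c^-1 by rewrite invr_ge0 ltW.
pose F1 : R -> 'M[C]_(n, k) := c^-1%:C%C *: F.
have hF1 : hardy2 F1 by exact: hardy2Z.
have [F12 _] := hF1.
have F1n : (normXM 2%:E F1 <= 1)%E.
  rewrite normXM2E// lee_fin -sqrtr1; apply: ler_wsqrtr.
  have oF2 : L1 (fun t => opnorm (F t) ^+ 2) by have [] := L2_opnorm F2.
  apply: (@le_trans _ _ (c^-1 ^+ 2 * Int (fun t => opnorm (F t) ^+ 2))).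
    rewrite -IntZ//; apply: Int_le; [by have [] := L2_opnorm F12|exact: L1Z|] => t _.
    rewrite -exprMn lerXn2r ?nnegrE ?opnorm_ge0//; first by rewrite mulr_ge0 ?opnorm_ge0.
    by apply: le_trans (opnormZ_le _ _) _; rewrite cmodR ger0_norm.
  by rewrite exprVn expr2 cc mulrC ler_pdivrMr// mul1r.
apply: le_trans (_ : (hankel_quot_norm Phi F1 <= _)%E); last first.
  by apply: ereal_sup_ubound; exists F1 => //; split=> //; apply/mxHp2P.
apply: le_ereal_inf_tmp => _ [H /mxHp2P hH <-]; have [H2 _] := hH.
have W2 := Phi_mul_mL2 F12.
have D2 := mL2B W2 H2.
rewrite [leRHS](_ : _ = (trnrm ((fun t => Phi t *m F1 t) - H))%:E); last first.
  by rewrite trnrmE -normXS12E.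
rewrite lee_fin ler_pdivrMr; last by rewrite addr_gt0.
set X := (fun t => Phi t *m F1 t) - H in D2 *.
(* Subtracting [H] leaves the pairing with [G] unchanged, so any representative of the coset may be
   used. *)
have E : cint (fun t => \tr (Phi t *m Psi t)) = c%:C%C * cint (fun t => \tr (X t *m G t)).
  have XG : mL1 (fun t => X t *m G t) by exact: mL2M.
  have HG : mL1 (fun t => H t *m G t) by exact: mL2M.
  have PP : mL1 (fun t => Phi t *m Psi t) by exact: Phi_mul_mL1.
  have -> : cint (fun t => \tr (X t *m G t)) = cint (fun t => \tr (X t *m G t) + \tr (H t *m G t)).
    by rewrite cintD; [|exact: cL1_trace..]; rewrite (cint_trace_hardy2 hH G2 Ga) addr0.
  have XHG : cL1 (fun t => \tr (X t *m G t) + \tr (H t *m G t)).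
    by apply: cL1D; exact: cL1_trace.
  rewrite -cintZ//; apply: cint_ae_eq.
  - by apply: cL1_meas; exact: cL1_trace.
  - by apply: cL1_meas; exact: cL1Z.
  apply: filterS PFG => t ->.
  rewrite -linearD/= -mulmxDl (_ : X t + H t = Phi t *m F1 t); last first.
    by rewrite /X [X in X + _](_ : _ = Phi t *m F1 t - H t)// subrK.
  rewrite (_ : F1 t = c^-1%:C%C *: F t)// -scalemxAr -scalemxAl linearZ/= mulrA -rmorphM/=.
  by rewrite divff ?gt_eqF// mul1r mulmxA.
rewrite E cmodM cmodR ger0_norm ?(ltW c0)//.
have XG : cL1 (fun t => \tr (X t *m G t)) by apply: cL1_trace; exact: mL2M.
have tX := L2_trnorm D2; have oG2 := L2_opnorm G2.
have h1 : cmod (cint (fun t => \tr (X t *m G t))) <= trnrm X * c.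
  apply: le_trans (cmod_cint XG) _.
  apply: (@le_trans _ _ (Int (fun t => trnorm (X t) * opnorm (G t)))).
    apply: Int_le; [exact: cL1_cmod|exact: L2M|] => t _; exact: cmod_trace_le.
  apply: le_trans (Int_mul_le_sqrt tX oG2) _; rewrite -trnrmE ler_wpM2l ?trnrm_ge0//.
  exact: ler_wsqrtr.
apply: (@le_trans _ _ (c * (trnrm X * c))); first by rewrite ler_pM2l.
by rewrite mulrCA cc ler_wpM2l// trnrm_ge0.
Qed.

Lemma sigma_k_le_hankel_norm : (sigma_k k Phi <= hankel_norm k Phi)%E.
Proof.
apply: ge_ereal_sup => _ [Psi /= APsi <-].
set x := cmod _.
have x0 : 0 <= x by exact: cmod_ge0.
have h e : 0 < e -> ((x / (1 + e))%:E <= hankel_norm k Phi)%E by exact: cmod_pairing_le.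
move: h; case: (hankel_norm k Phi) => [y h|_|h].
- rewrite lee_fin; apply/ler_addgt0Pr => d d0.
  have y0 : 0 <= y by rewrite -lee_fin (le_trans _ (h 1 ltr01))// lee_fin divr_ge0.
  have y1 : 0 < y + 1 by rewrite ltr_wpDl.
  (* For this [e] the excess [y e] is at most [d]; adding 1 covers [y = 0]. *)
  have e0 : 0 < d / (y + 1) by rewrite divr_gt0.
  have := h _ e0; rewrite lee_fin ler_pdivrMr ?addr_gt0// => /le_trans; apply.
  rewrite mulrDr mulr1 lerD2l mulrCA ler_piMr ?(ltW d0)//.
  by rewrite ler_pdivrMr// mul1r lerDl.
- by rewrite leey.
by have := h 1 ltr01; rewrite leeNy_eq.
Qed.

End Inequalities.
End Main.

Theorem theorem3p3 (R : realType) (m n k : nat) :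
  (1 < m)%N -> (1 < n)%N -> (1 <= k)%N -> (k <= minn m n)%N ->
  forall Phi : R -> 'M[complex R]_(m, n),
    mxLp +oo%E Phi ->
    sigma_k k Phi = hankel_norm k Phi.
Proof.
move=> _ _ _ _ Phi Phi_oo; apply/eqP; rewrite eq_le.
by rewrite sigma_k_le_hankel_norm// hankel_norm_le_sigma_k.
Qed.
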